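(* The following hold. (1) The family $(Sp_n(q))_{n\in\mathbb N}$ is saturated: for all $m\le n$ and $U,U'\in Sp_m(q)$, $U$ and $U'$ are conjugate in $Sp_m(q)$ if and only if $U^{\uparrow\uparrow n}$ and $U'^{\uparrow\uparrow n}$ are conjugate in $Sp_n(q)$. (2) Sending $U$ to its modified symplectic type induces a bijection between the set of conjugacy classes of $Sp_\infty(q)$ and the set $\mathcal P^{st}$ of modified symplectic functions. (3) Let $\boldsymbol\lambda\in\mathcal P^{st}$. Then $Sp_m(q)$ contains an element whose modified symplectic type is $\boldsymbol\lambda$ if and only if $\|\overline{\boldsymbol\lambda}\|\le 2m$. (4) Let $\boldsymbol\lambda\in\mathcal P^{st}$ with $\|\overline{\boldsymbol\lambda}\|=2m$, let $U\in Sp_m(q)$ have modified symplectic type $\boldsymbol\lambda$, and let $n>m$. Then the $n$-th completion $\boldsymbol\lambda^{\uparrow\uparrow n}$ equals the symplectic type of $U^{\uparrow\uparrow n}\in Sp_n(q)$. (5) The reflection length is unchanged under the embedding $Sp_m(q)\hookrightarrow Sp_n(q)$, $m\le n$, and the reflection length of an element equals the weight of its modified symplectic type.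
   Context: Let $q$ be an odd prime power. $V_n$ is the $2n$-dimensional $\mathbb F_q$-space with basis $e_1,f_1,\dots,e_n,f_n$ and alternating form $Q$ with $Q(e_i,f_j)=\delta_{ij}$, $Q(e_i,e_j)=Q(f_i,f_j)=0$; $Sp_n(q)\subset GL_{2n}(q)$ is the isometry group of $(V_n,Q)$. For $m\le n$, $Sp_m(q)$ is embedded in $Sp_n(q)$ by $U\mapsto U^{\uparrow\uparrow n}=\begin{bmatrix}U&0\\0&I_{2n-2m}\end{bmatrix}$, and $Sp_\infty(q)=\bigcup_n Sp_n(q)$. The reflection length of $U\in Sp_n(q)$ is its reflection length in $GL_{2n}(q)$: the minimal $r$ such that $U$ is a product of $r$ elements $T\in GL_{2n}(q)$ with $\dim(T-I)V_n=1$. Combinatorics. $\Phi$ is the set of monic irreducible polynomials in $\mathbb{F}_q[t]$ other than $t$. The dual of a monic $f=\sum_{i=0}^d a_it^i$, $a_0\ne0$, is $\overline f=\sum_{i=0}^d a_ia_0^{-1}t^{d-i}$. $\Phi^s$ consists of the self-dual $f\in\Phi$ and the products $g\overline g$ with $g\in\Phi$, $g\neq\overline g$. The weight $\|\lambda\|$ of a partition is the sum of its parts. A partition valued function on $\Phi^s$ assigns to each $f\in\Phi^s$ a partition $\boldsymbol\lambda(f)$, empty for almost all $f$; its weight is $\|\boldsymbol\lambda\|=\sum_f\deg(f)\|\boldsymbol\lambda(f)\|$. A signed partition is a partition with a sign $h_i\in\{\pm1\}$ attached to each occurring part size $i$; it is a symplectic partition if, for every odd $i$, the multiplicity of $i$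 is even and $h_i=-1$. A symplectic function is a triple $(\boldsymbol\lambda,h^+,h^-)$ with $\boldsymbol\lambda$ a partition valued function on $\Phi^s$ such that $(\boldsymbol\lambda(t-1),h^-)$ and $(\boldsymbol\lambda(t+1),h^+)$ are symplectic partitions; its weight is $\|\boldsymbol\lambda\|$. The modification of a symplectic function changes only the signed partition at $t-1$: each part is decreased by 1 (parts equal to 1 disappear), and the remaining parts keep their signs. $\mathcal P^{st}$, the set of modified symplectic functions, is the set of modifications of all symplectic functions; their weight is defined by the same formula. The completion $\overline{\boldsymbol\lambda}$ of $\boldsymbol\lambda\in\mathcal P^{st}$ is obtained by increasing each part at $t-1$ by 1, keeping signs. For $2n\ge\|\overline{\boldsymbol\lambda}\|$ the $n$-th completion $\boldsymbol\lambda^{\uparrow\uparrow n}$ is obtained from $\overline{\boldsymbol\lambda}$ by adjoining $2n-\|\overline{\boldsymbol\lambda}\|$ parts equal to $1$ (with sign $-1$) to the partition at $t-1$. Types. The symplectic type of $U\in Sp_n(q)$ is the symplectic function of weight $2n$ defined as follows. View $V_n$ as an $\mathbb F_q[t]$-module with $t$ acting as $U$. For $f\in\Phi^s$ irreducible, $\boldsymbol\lambda(f)$ lists the exponents $r$ of the primary cyclic summands $\mathbb F_q[t]/(f^r)$; for $f=g\overline g$, $\boldsymbol\lambda(f)$ is the analogous partition for $g$ (equal to that for $\overline g$). For $\epsilon=\pm1$, the generalized $\epsilon$-eigenspace is an orthogonal sum of $U$-invariant subspaces $W^i$ with $W^i$ free over $\mathbb F_q[t]/(t-\epsilon)^i$;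 for even $i$ the form $(\bar v,\bar w)\mapsto Q((U-U^{-1})^{i-1}v,w)$ on $W^i/(U-\epsilon)W^i$ is symmetric and non-degenerate, and the sign attached to the part $i$ at $t-\epsilon$ is $+1$ if its Gram determinant is a square in $\mathbb F_q^\times$ and $-1$ otherwise; for odd $i$ the sign is $-1$. It is a known result (Milnor, Shinoda) that two elements of $Sp_n(q)$ are conjugate if and only if they have the same symplectic type, and that every symplectic function of weight $2n$ occurs as a symplectic type. The modified symplectic type of $U$ is the modification of its symplectic type. *)

(* Defs.v *)
From HB Require Import structures.
From mathcomp Require Import all_boot all_order all_fingroup all_algebra.
From mathcomp Require Import generic_quotient finmap.

Set Implicit Arguments.
Unset Strict Implicit.
Unset Printing Implicit Defensive.

Import GRing.Theory.
Local Open Scope ring_scope.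

(* Column vectors 'cV[F]_(n.*2), with basis e_1, f_1, ..., e_n, f_n: the index
   2i stands for e_(i+1) and 2i+1 for f_(i+1).  Matrices act on the left. *)
Definition form_mx (F : finFieldType) N : 'M[F]_N :=
  \matrix_(i < N, j < N)
    ((~~ odd i && (j == i.+1 :> nat))%:R - (~~ odd j && (i == j.+1 :> nat))%:R).

Definition Q (F : finFieldType) N (v w : 'cV[F]_N) : F :=
  (v^T *m form_mx F N *m w) ord0 ord0.

Definition isometry (F : finFieldType) N : pred 'M[F]_N := fun U =>
  (U \in unitmx) && [forall v, [forall w, Q (U *m v) (U *m w) == Q v w]].

Record Sp (F : finFieldType) (n : nat) : predArgType :=
  MkSp { Sp_mx :> 'M[F]_(n.*2); _ : isometry Sp_mx }.

HB.instance Definition _ (F : finFieldType) n := [isSub for @Sp_mx F n].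
HB.instance Definition _ (F : finFieldType) n := [Finite of Sp F n by <:].

Section SpGroup.
Variables (F : finFieldType).

Lemma isometryP N (U : 'M[F]_N) :
  reflect (U \in unitmx /\ forall v w, Q (U *m v) (U *m w) = Q v w)
          (isometry U).
Proof.
apply: (iffP andP) => -[Uu UQ]; split=> //.
  by move=> v w; apply/eqP; move: v w; apply/'forall_forallP.
by apply/'forall_forallP => v w; rewrite UQ.
Qed.

Lemma isometry1 N : isometry (1%:M : 'M[F]_N).
Proof. by apply/isometryP; split=> [|v w]; rewrite ?unitmx1 // !mul1mx. Qed.

Lemma isometryM N (U V : 'M[F]_N) :
  isometry U -> isometry V -> isometry (U *m V).
Proof.
move=> /isometryP[Uu UQ] /isometryP[Vu VQ]; apply/isometryP; split=> [|v w].
  by rewrite unitmx_mul Uu.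
by rewrite -!mulmxA UQ VQ.
Qed.

Lemma isometryV N (U : 'M[F]_N) : isometry U -> isometry (invmx U).
Proof.
move=> /isometryP[Uu UQ]; apply/isometryP; split=> [|v w].
  by rewrite unitmx_inv.
by rewrite -UQ !mulKVmx.
Qed.

Variable n : nat.
Implicit Types U V : Sp F n.

Definition Sp_one : Sp F n := MkSp (isometry1 _).
Definition Sp_mul U V : Sp F n := MkSp (isometryM (valP U) (valP V)).
Definition Sp_inv U : Sp F n := MkSp (isometryV (valP U)).

Lemma Sp_mulA : associative Sp_mul.
Proof. by move=> U V W; apply: val_inj; rewrite /= mulmxA. Qed.
Lemma Sp_mul1 : left_id Sp_one Sp_mul.
Proof. by move=> U; apply: val_inj; rewrite /= mul1mx. Qed.
Lemma Sp_mulV : left_inverse Sp_one Sp_inv Sp_mul.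
Proof.
by move=> U; apply: val_inj; case/isometryP: (valP U) => /mulVmx.
Qed.

End SpGroup.

HB.instance Definition _ (F : finFieldType) n :=
  Finite_isGroup.Build (Sp F n)
    (@Sp_mulA F n) (@Sp_mul1 F n) (@Sp_mulV F n).

Definition are_conjugate (G : groupType) (x y : G) : Prop :=
  exists g : G, y = (x ^ g)%g.

(* The block matrix [U 0; 0 I] when M <= N; for M > N, where there is no
   embedding, the value is the identity by convention. *)
Definition up_mx (F : finFieldType) M N (U : 'M[F]_M) : 'M[F]_N :=
  conform_mx (1%:M : 'M[F]_N) (block_mx U 0 0 (1%:M : 'M[F]_(N - M))).

Section Up.
Variables (F : finFieldType).

Lemma up_mxE M K (U : 'M[F]_M) : up_mx (M + K) U = block_mx U 0 0 1%:M.
Proof.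
rewrite /up_mx; have: (M + K - M)%N = K by rewrite addKn.
by move: (M + K - M)%N => K' ->; rewrite conform_mx_id.
Qed.

Lemma up_mx_gt M N (U : 'M[F]_M) : (N < M)%N -> up_mx N U = 1%:M.
Proof.
move=> NM; apply: nonconform_mx; rewrite orbb.
by apply/eqP => E; move: NM; rewrite -E ltnNge leq_addr.
Qed.

Lemma up_mxM M N (U V : 'M[F]_M) : up_mx N (U *m V) = up_mx N U *m up_mx N V.
Proof.
case: (leqP M N) => [/subnKC<-|NM]; last by rewrite !up_mx_gt // mulmx1.
by rewrite !up_mxE mulmx_block !mul0mx !mulmx0 !mulmx1 !addr0 add0r.
Qed.

Lemma up_mx1 M N : up_mx N (1%:M : 'M[F]_M) = 1%:M.
Proof.
case: (leqP M N) => [/subnKC<-|NM]; last by rewrite !up_mx_gt.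
by rewrite up_mxE -scalar_mx_block.
Qed.

Lemma up_mx_inj M N : (M <= N)%N -> injective (@up_mx F M N).
Proof. by move/subnKC<- => U V; rewrite !up_mxE => e; have [] := eq_block_mx e. Qed.

Lemma up_mx_val M N (U : 'M[F]_M) i j : (M <= N)%N ->
  up_mx N U i j = match insub (val i), insub (val j) with
                  | Some i', Some j' => U i' j'
                  | _, _ => (i == j)%:R end.
Proof.
move=> MN; have e := subnKC MN; move: i j; rewrite -e => i j.
have inl a : insub (val (lshift (N - M) a)) = Some a :> option 'I_M.
  exact: (valK a).
have inr (a : 'I_(N - M)) : insub (val (rshift M a)) = None :> option 'I_M.
  by rewrite insubN //= -leqNgt leq_addr.
rewrite up_mxE; case: (split_ordP i) => i' ->; case: (split_ordP j) => j' ->.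
- by rewrite block_mxEul !inl.
- by rewrite block_mxEur inl inr mxE eq_lrshift.
- by rewrite block_mxEdl inr mxE eq_rlshift.
- by rewrite block_mxEdr inr mxE eq_rshift.
Qed.

Lemma up_up_mx M N P (U : 'M[F]_M) : (M <= N)%N -> (N <= P)%N ->
  up_mx P (up_mx N U) = up_mx P U.
Proof.
move=> MN NP; have MP := leq_trans MN NP.
apply/matrixP => i j; rewrite (up_mx_val _ _ _ NP) [RHS]up_mx_val //.
have NI k : ~~ (k < N)%N -> insub k = None :> option 'I_M.
  by move=> kN; rewrite insubN //; apply: contra kN => /leq_trans; apply.
case: (insubP _ (val i)) => [i' iN ei|/NI -> //].
case: (insubP _ (val j)) => [j' jN ej|/NI ->]; last by case: insub.
by rewrite up_mx_val // -(inj_eq val_inj) ei ej (inj_eq val_inj).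
Qed.

Lemma form_mx_block M K : ~~ odd M ->
  form_mx F (M + K) = block_mx (form_mx F M) 0 0 (form_mx F K).
Proof.
move=> Me; apply/matrixP => i j; rewrite mxE.
have no1 (a : 'I_M) (b : 'I_K) : ~~ odd a && (M + b == a.+1)%N = false.
  apply/negP => /andP[ae /eqP e]; have /eqP eM : a.+1 == M.
    by rewrite eqn_leq ltn_ord -e leq_addr.
  by have := congr1 odd eM; rewrite /= ae => oM; move: Me; rewrite -oM.
have no2 (a : 'I_M) (b : 'I_K) : (nat_of_ord a == (M + b).+1)%N = false.
  by apply: ltn_eqF; rewrite ltnS (leq_trans (ltnW (ltn_ord a))) ?leq_addr.
case: (split_ordP i) => i' ->; case: (split_ordP j) => j' ->.
- by rewrite block_mxEul mxE.
- by rewrite block_mxEur mxE /= no1 no2 andbF subrr.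
- by rewrite block_mxEdl mxE /= no1 no2 andbF subrr.
- by rewrite block_mxEdr mxE /= !oddD (negPf Me) -!addnS !eqn_add2l.
Qed.

Lemma Q_block M K (v1 w1 : 'cV[F]_M) (v2 w2 : 'cV[F]_K) : ~~ odd M ->
  Q (col_mx v1 v2) (col_mx w1 w2) = Q v1 w1 + Q v2 w2.
Proof.
move=> Me; rewrite /Q form_mx_block // tr_col_mx mul_row_block.
by rewrite !mulmx0 addr0 add0r mul_row_col mxE.
Qed.

Lemma isometry_up m n (U : Sp F m) : isometry (up_mx n.*2 (val U)).
Proof.
case: (leqP m.*2 n.*2) => [|NM]; last by rewrite up_mx_gt ?isometry1.
move/subnKC<-; rewrite up_mxE; case/isometryP: (valP U) => Uu UQ.
apply/isometryP; split=> [|v w].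
  by rewrite unitmxE det_ublock det1 mulr1 -unitmxE.
rewrite -[v]vsubmxK -[w]vsubmxK !mul_block_col !mul0mx !mul1mx !addr0 !add0r.
by rewrite !Q_block ?odd_double // UQ.
Qed.

Definition Sp_up m n (U : Sp F m) : Sp F n := MkSp (isometry_up n U).

End Up.

(* The union of the Sp_n(q) along the embeddings, that is, their direct limit:
   pairs (n, U) with U in Sp_n(q), identified when they agree after being
   embedded in a common Sp_k(q). *)
Section SpInf.
Variables (F : finFieldType).

Lemma Sp_upM m n : {morph @Sp_up F m n : U V / (U * V)%g}.
Proof. by move=> U V; apply: val_inj; apply: up_mxM. Qed.

Lemma Sp_up1 m n : Sp_up n (1 : Sp F m)%g = 1%g.
Proof. by apply: val_inj; apply: up_mx1. Qed.

Lemma Sp_upV m n : {morph @Sp_up F m n : U / (U^-1)%g}.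
Proof.
move=> U; apply: (mulIg (Sp_up n U)).
by rewrite -Sp_upM !mulVg Sp_up1.
Qed.

Lemma Sp_up_inj m n : (m <= n)%N -> injective (@Sp_up F m n).
Proof.
move=> mn U V /(congr1 val)/= UV; apply: val_inj.
by apply: up_mx_inj UV; rewrite leq_double.
Qed.

Lemma Sp_up_up m n p (U : Sp F m) : (m <= n)%N -> (n <= p)%N ->
  Sp_up p (Sp_up n U) = Sp_up p U.
Proof. by move=> ? ?; apply: val_inj; apply: up_up_mx; rewrite leq_double. Qed.

Definition Sp_pair := {n : nat & Sp F n}.

Definition Sp_eqv (x y : Sp_pair) : bool :=
  let k := maxn (tag x) (tag y) in Sp_up k (tagged x) == Sp_up k (tagged y).

Lemma Sp_eqvP k (x y : Sp_pair) : (tag x <= k)%N -> (tag y <= k)%N ->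
  Sp_eqv x y = (Sp_up k (tagged x) == Sp_up k (tagged y)).
Proof.
move=> xk yk; rewrite /Sp_eqv -(inj_eq (@Sp_up_inj _ k _)) ?geq_max ?xk //.
by rewrite !Sp_up_up ?leq_maxl ?leq_maxr ?geq_max ?xk.
Qed.

Lemma Sp_eqv_refl : reflexive Sp_eqv.
Proof. by move=> x; apply: eqxx. Qed.
Lemma Sp_eqv_sym : symmetric Sp_eqv.
Proof. by move=> x y; rewrite /Sp_eqv maxnC eq_sym. Qed.
Lemma Sp_eqv_trans : transitive Sp_eqv.
Proof.
move=> y x z; pose k := (tag x + tag y + tag z)%N.
have xk : (tag x <= k)%N by rewrite /k -addnA leq_addr.
have yk : (tag y <= k)%N by rewrite /k addnAC leq_addl.
have zk : (tag z <= k)%N by apply: leq_addl.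
by rewrite !(@Sp_eqvP k) // => /eqP-> /eqP->.
Qed.

Canonical Sp_eqv_equiv := EquivRel Sp_eqv Sp_eqv_refl Sp_eqv_sym Sp_eqv_trans.

Definition Sp_inf := {eq_quot Sp_eqv}%qT.
HB.instance Definition _ := Choice.on Sp_inf.

Definition to_inf n (U : Sp F n) : Sp_inf :=
  (\pi_({eq_quot Sp_eqv}) (Tagged (Sp F) U))%qT.

Lemma to_inf_eq m n k (U : Sp F m) (V : Sp F n) : (m <= k)%N -> (n <= k)%N ->
  (to_inf U = to_inf V) <-> Sp_up k U = Sp_up k V.
Proof.
move=> mk nk; split=> [/eqquotP|e].
  by rewrite /= (@Sp_eqvP k) //= => /eqP.
by apply/eqquotP; rewrite /= (@Sp_eqvP k) //= e.
Qed.

Lemma to_inf_up m n (U : Sp F m) : (m <= n)%N -> to_inf (Sp_up n U) = to_inf U.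
Proof. by move=> mn; apply/(@to_inf_eq _ _ n) => //; rewrite Sp_up_up. Qed.

Lemma Sp_infP (x : Sp_inf) : exists n (U : Sp F n), x = to_inf U.
Proof.
exists (tag (repr x)), (tagged (repr x)).
by rewrite /to_inf /Tagged -[LHS]reprK; case: (repr x).
Qed.

Definition inf_mul (x y : Sp_inf) : Sp_inf :=
  let k := maxn (tag (repr x)) (tag (repr y)) in
  to_inf (Sp_up k (tagged (repr x)) * Sp_up k (tagged (repr y)))%g.
Definition inf_inv (x : Sp_inf) : Sp_inf := to_inf (tagged (repr x))^-1%g.
Definition inf_one : Sp_inf := to_inf (1 : Sp F 0)%g.

Lemma repr_inf n (U : Sp F n) k :
  (n <= k)%N -> (tag (repr (to_inf U)) <= k)%N ->
  Sp_up k (tagged (repr (to_inf U))) = Sp_up k U.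
Proof.
move=> nk rk; apply/(to_inf_eq _ _ rk nk).
by rewrite /to_inf /Tagged -[RHS]reprK; case: (repr _).
Qed.

Lemma inf_mulE n (U V : Sp F n) :
  inf_mul (to_inf U) (to_inf V) = to_inf (U * V)%g.
Proof.
set r := tag (repr (to_inf U)); set s := tag (repr (to_inf V)).
pose k := maxn n (maxn r s).
have nk : (n <= k)%N by apply: leq_maxl.
have rsk : (maxn r s <= k)%N by apply: leq_maxr.
have [rk sk] : (r <= k)%N /\ (s <= k)%N by apply/andP; rewrite -geq_max.
apply/(to_inf_eq _ _ rsk nk); rewrite !Sp_upM !Sp_up_up ?leq_maxl ?leq_maxr //.
by rewrite !repr_inf.
Qed.

Lemma inf_invE n (U : Sp F n) : inf_inv (to_inf U) = to_inf U^-1%g.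
Proof.
set r := tag (repr (to_inf U)); pose k := maxn n r.
have nk : (n <= k)%N by apply: leq_maxl.
have rk : (r <= k)%N by apply: leq_maxr.
by apply/(to_inf_eq _ _ rk nk); rewrite !Sp_upV repr_inf.
Qed.

Lemma inf_oneE n : inf_one = to_inf (1 : Sp F n)%g.
Proof. by apply/(@to_inf_eq _ _ n); rewrite ?Sp_up1. Qed.

Lemma inf_mulA : associative inf_mul.
Proof.
move=> x y z; case: (Sp_infP x) => m [U ->]; case: (Sp_infP y) => n [V ->].
case: (Sp_infP z) => p [W ->]; pose k := (m + n + p)%N.
rewrite -(@to_inf_up _ k U) -?(@to_inf_up _ k V) -?(@to_inf_up _ k W).
- by rewrite !inf_mulE mulgA.
- by apply: leq_addl.
- by rewrite /k addnAC leq_addl.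
- by rewrite /k -addnA leq_addr.
Qed.

Lemma inf_mul1 : left_id inf_one inf_mul.
Proof.
by move=> x; case: (Sp_infP x) => m [U ->]; rewrite (inf_oneE m) inf_mulE mul1g.
Qed.
Lemma inf_1mul : right_id inf_one inf_mul.
Proof.
by move=> x; case: (Sp_infP x) => m [U ->]; rewrite (inf_oneE m) inf_mulE mulg1.
Qed.
Lemma inf_mulV : left_inverse inf_one inf_inv inf_mul.
Proof.
move=> x; case: (Sp_infP x) => m [U ->].
by rewrite inf_invE inf_mulE mulVg (inf_oneE m).
Qed.
Lemma inf_mulrV : right_inverse inf_one inf_inv inf_mul.
Proof.
move=> x; case: (Sp_infP x) => m [U ->].
by rewrite inf_invE inf_mulE mulgV (inf_oneE m).
Qed.

HB.instance Definition _ :=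
  isGroup.Build Sp_inf inf_mulA inf_mul1 inf_1mul inf_mulV inf_mulrV.

End SpInf.

Definition reflection (F : finFieldType) N : pred 'M[F]_N := fun T =>
  (T \in unitmx) && (\rank (T - 1%:M)%R == 1)%N.

Definition reflection_product (F : finFieldType) N (U : 'M[F]_N) r : Prop :=
  exists s : r.-tuple 'M[F]_N, all (@reflection F N) s /\ U = \prod_(T <- s) T.

Definition reflection_length (F : finFieldType) N (U : 'M[F]_N) r : Prop :=
  reflection_product U r /\
  forall r', reflection_product U r' -> (r <= r')%N.

Definition is_Phi (F : finFieldType) (f : {poly F}) : Prop :=
  [/\ f \is monic, irreducible_poly f & f != 'X].

Definition dual (F : finFieldType) (f : {poly F}) : {poly F} :=
  \sum_(i < size f) (f`_i * (f`_0)^-1) *: 'X^((size f).-1 - i).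

Definition is_Phi_s (F : finFieldType) (f : {poly F}) : Prop :=
  (is_Phi f /\ f = dual f) \/
  exists g, [/\ is_Phi g, g <> dual g & f = g * dual g].

Definition is_partition (p : seq nat) : bool := sorted geq p && (0 \notin p)%N.

(* The data (lambda, h+, h-).  A partition valued function is a finitely
   supported function on all polynomials, required to vanish outside Phi^s.
   The signs form a finite map defined on the occurring part sizes, [true]
   standing for +1 and [false] for -1. *)
Record sp_data (F : finFieldType) := SpData {
  parts : {fsfun {poly F} -> seq nat with [::]};
  sgn_plus : {fmap nat -> bool};     (* signs at t + 1 *)
  sgn_minus : {fmap nat -> bool} }.  (* signs at t - 1 *)

Definition partition_valued (F : finFieldType)
    (lam : {fsfun {poly F} -> seq nat with [::]}) : Prop :=
  (forall f, is_partition (lam f)) /\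
  (forall f, lam f != [::] -> is_Phi_s f).

Definition signed_partition (p : seq nat) (h : {fmap nat -> bool}) : Prop :=
  is_partition p /\ domf h =i p.

Definition symplectic_partition (p : seq nat) (h : {fmap nat -> bool}) : Prop :=
  signed_partition p h /\
  forall i, i \in p -> odd i ->
    ~~ odd (count_mem i p) /\ fnd h i = Some false.

Definition symplectic_function (F : finFieldType) (L : sp_data F) : Prop :=
  [/\ partition_valued (parts L),
      symplectic_partition (parts L ('X - 1)) (sgn_minus L)
    & symplectic_partition (parts L ('X + 1)) (sgn_plus L)].

Definition weight (F : finFieldType) (L : sp_data F) : nat :=
  (\sum_(f <- finsupp (parts L)) (size f).-1 * sumn (parts L f))%N.

Definition sgn_at (h : {fmap nat -> bool}) (i : nat) : bool :=
  odflt false (fnd h i).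

Definition sgn_map (p : seq nat) (s : nat -> bool) : {fmap nat -> bool} :=
  [fmap i : seq_fset tt p => s (val i)].

Definition modification (F : finFieldType) (L : sp_data F) : sp_data F :=
  let p := [seq i.-1 | i <- parts L ('X - 1) & (1 < i)%N] in
  SpData [fsfun parts L with 'X - 1 |-> p] (sgn_plus L)
         (sgn_map p (fun i => sgn_at (sgn_minus L) i.+1)).

Definition modified_symplectic (F : finFieldType) (L : sp_data F) : Prop :=
  exists M, symplectic_function M /\ L = modification M.

Definition completion (F : finFieldType) (L : sp_data F) : sp_data F :=
  let p := [seq i.+1 | i <- parts L ('X - 1)] in
  SpData [fsfun parts L with 'X - 1 |-> p] (sgn_plus L)
         (sgn_map p (fun i => sgn_at (sgn_minus L) i.-1)).

(* No part of the completion at t - 1 is equal to 1, so the value at 1 of the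
   new sign map only concerns the adjoined parts. *)
Definition nth_completion (F : finFieldType) (n : nat) (L : sp_data F) :
    sp_data F :=
  let C := completion L in
  let p := parts C ('X - 1) ++ nseq (n.*2 - weight C) 1%N in
  SpData [fsfun parts C with 'X - 1 |-> p] (sgn_plus C)
    (sgn_map p (fun i => if i == 1%N then false else sgn_at (sgn_minus C) i)).

Definition poly_act (F : finFieldType) N (U : 'M[F]_N) (p : {poly F}) :
    'M[F]_N :=
  \sum_(i < size p) p`_i *: U ^+ i.

(* The F[t]-module W, with t acting as U, is the internal direct sum of the
   cyclic submodules F[t] (b j), and F[t] (b j) is F[t]/(a j): the F[t]-linear
   map (p j) |-> \sum_j p j . b j has image W, and its kernel is the direct sum
   of the ideals (a j). *)
Definition cyclic_sum (F : finFieldType) N (U : 'M[F]_N)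
    (W : {vspace 'cV[F]_N}) k (a : 'I_k -> {poly F}) (b : 'I_k -> 'cV[F]_N) :
    Prop :=
  (forall w, w \in W <->
     exists p : 'I_k -> {poly F}, w = \sum_j poly_act U (p j) *m b j) /\
  (forall p : 'I_k -> {poly F},
     \sum_j poly_act U (p j) *m b j = 0 <-> forall j, a j %| p j).

(* s lists the pairs (g, r) of the primary cyclic summands F[t]/(g^r). *)
Definition primary_decomposition (F : finFieldType) N (U : 'M[F]_N)
    (s : seq ({poly F} * nat)) : Prop :=
  (forall x, x \in s ->
     [/\ x.1 \is monic, irreducible_poly x.1 & (0 < x.2)%N]) /\
  exists b, cyclic_sum U fullv
    (fun j : 'I_(size s) => (tnth (in_tuple s) j).1 ^+
                            (tnth (in_tuple s) j).2) b.

Definition exponents (F : finFieldType) (s : seq ({poly F} * nat))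
    (g : {poly F}) : seq nat :=
  [seq x.2 | x <- s & x.1 == g].

Definition mx_act (F : finFieldType) N (A : 'M[F]_N) : 'End('cV[F]_N) :=
  linfun (mulmx A).

Definition generalized_eigenspace (F : finFieldType) N (U : 'M[F]_N) (eps : F) :
    {vspace 'cV[F]_N} :=
  lker (mx_act ((U - eps%:M) ^+ N)).

(* W i is the summand W^i.  W^0 is free over the zero ring, hence zero, and W^i
   is zero for i > N by dimension. *)
Definition eigen_decomposition (F : finFieldType) N (U : 'M[F]_N) (eps : F)
    (W : 'I_N.+1 -> {vspace 'cV[F]_N}) : Prop :=
  [/\ generalized_eigenspace U eps = (\sum_i W i)%VS, directv (\sum_i W i),
      forall i j, i != j -> {in W i & W j, forall v w, Q v w = 0},
      forall i, (mx_act U @: W i <= W i)%VS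
    & forall i, exists k (b : 'I_k -> 'cV[F]_N),
        cyclic_sum U (W i) (fun=> ('X - eps%:P) ^+ i) b].

(* The classes of the entries of c form a basis of W / D, where D <= W. *)
Definition quotient_basis (F : finFieldType) N (W D : {vspace 'cV[F]_N})
    k (c : k.-tuple 'cV[F]_N) : bool :=
  [&& free c, (<<c>> + D == W)%VS & (<<c>> :&: D == 0)%VS].

Definition gram_det (F : finFieldType) N (U : 'M[F]_N) (i : nat)
    k (c : k.-tuple 'cV[F]_N) : F :=
  \det (\matrix_(a < k, b < k)
          Q ((U - invmx U) ^+ i.-1 *m tnth c a) (tnth c b)).

Definition nonzero_square (F : finFieldType) (x : F) : bool :=
  [exists y : F, (y != 0) && (x == y ^+ 2)].

(* h attaches the signs of U to the parts, listed in p, at t - eps. *)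
Definition eigen_signs (F : finFieldType) N (U : 'M[F]_N) (eps : F)
    (p : seq nat) (h : {fmap nat -> bool}) : Prop :=
  exists2 W : 'I_N.+1 -> {vspace 'cV[F]_N}, eigen_decomposition U eps W &
    forall i : 'I_N.+1, (i : nat) \in p ->
      if odd i then fnd h i = Some false
      else exists k (c : k.-tuple 'cV[F]_N),
        quotient_basis (W i) (mx_act (U - eps%:M) @: W i)%VS c /\
        fnd h i = Some (nonzero_square (gram_det U i c)).

(* L is a symplectic type of U, computed from some choice of the primary and
   orthogonal decompositions of V_n. *)
Definition has_symplectic_type (F : finFieldType) n (U : Sp F n)
    (L : sp_data F) : Prop :=
  [/\ symplectic_function L,
      exists2 s, primary_decomposition U s &
        (forall f, is_Phi f -> f = dual f ->
           perm_eq (parts L f) (exponents s f)) /\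
        (forall g, is_Phi g -> g <> dual g ->
           perm_eq (parts L (g * dual g)) (exponents s g)),
      eigen_signs U 1 (parts L ('X - 1)) (sgn_minus L)
    & eigen_signs U (-1) (parts L ('X + 1)) (sgn_plus L)].

Definition has_modified_type (F : finFieldType) n (U : Sp F n)
    (L : sp_data F) : Prop :=
  exists2 M, has_symplectic_type U M & L = modification M.

(* Main.v *)
Require Import Defs.
From HB Require Import structures.
From mathcomp Require Import all_boot all_order all_fingroup all_algebra.
From mathcomp Require Import finmap finfield qpoly zify ring.
From mathcomp Require Import generic_quotient.
From Stdlib Require Import IndefiniteDescription.

(** The theorem rests on a classification of symplectic spaces with an isometry.

    Let U be an isometry of a nondegenerate alternating space, seen as an
    F[t]-module.  The space is an orthogonal sum of indecomposable blocks of
    two shapes, and a block is labelled by a triple (f, r, b) with f in Phi^s.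
    A cyclic block is F[t]/(f^r) with a nondegenerate form.  It occurs for
    every f and r, except for f = t - 1 and f = t + 1 with r odd, where the
    form v |-> Q(f^(r-1) v, v) vanishes identically; there a hyperbolic block
    takes its place, a sum of two isotropic copies of F[t]/(f^r).  The boolean
    b records, for f = t - 1, t + 1 and r even, whether Q((U - U^-1)^(r-1) v, v)
    is a square on a generator v.  Since a nondegenerate binary
    quadratic form over F represents 1, at most one block with b false is
    needed for each (f, r); a list of labels with this property is called
    normal.

    Blocks are found in [dec_exists]: with r minimal such that f^r kills the
    f-part, polarisation or successive correction gives the generators
    ([cyc_exists], [hyp_exists]).  Blocks with equal labels are isometric
    ([block_iso]): the two functionals p |-> Q(p v, v) differ by a unit u of
    F[t]/(f^r) fixed by the adjoint, a change of generator multiplies u by a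
    norm y * star y, and every such u is a norm by a Hilbert 90 argument for f
    other than t - 1 and t + 1 ([norm_mod]), or by extraction of a square root
    when the signs agree.  Every list of labels occurs in some Sp_n(q)
    ([realize]).  So elements with a common label list are conjugate, and the
    label (t - 1, 1, true) of a hyperbolic plane with trivial action is the
    one that the embedding into a larger Sp_n(q) adds n - m times.

    A normal list determines a symplectic function ([type_of]) and conversely
    up to order ([type_inj], [type_exists]).  This function is a symplectic
    type of U ([has_type_dec]), and it is the only one ([type_unique]): the
    partitions are read from the ranks of g(U)^k, and the Gram determinant on
    W^i / (U - eps) W^i changes by a square because W^i spans ker (U - eps)^i
    modulo a subspace of the radical of the form.  Conjugacy is thereby
    equality of normal label lists up to order, modification forgets exactly
    the labels (t - 1, 1, true), and completion restores as many of them as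
    the dimension requires; the first four assertions follow.

    For the last one, the reflection length of U in the general linear group
    is the rank of U - 1: a reflection changes this rank by at most one, and a
    suitable one lowers it ([reflection_step]).  The rank is 2n minus the
    number of parts at t - 1, which is the weight of the modified type. *)

Set Implicit Arguments.
Unset Strict Implicit.
Unset Printing Implicit Defensive.

Import GRing.Theory.
Local Open Scope ring_scope.

(** * Polynomials acting through a matrix *)

Section PolyAct.
Variables (F : finFieldType) (N : nat) (U : 'M[F]_N).
Implicit Types p q : {poly F}.

Lemma poly_act_widen p k : (size p <= k)%N ->
  poly_act U p = \sum_(i < k) p`_i *: U ^+ i.
Proof.
move=> pk; rewrite /poly_act (big_ord_widen _ (fun i => p`_i *: U ^+ i) pk) big_mkcond /=.
apply: eq_bigr => i _; case: ltnP => // pi.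
by rewrite nth_default // scale0r.
Qed.

Lemma poly_act_is_linear : linear (poly_act U).
Proof.
move=> a p q; pose k := maxn (size (a *: p + q)) (maxn (size p) (size q)).
rewrite !(@poly_act_widen _ k) ?leq_max ?leqnn ?orbT //.
rewrite scaler_sumr -big_split; apply: eq_bigr => i _ /=.
by rewrite coefD coefZ scalerDl scalerA.
Qed.
HB.instance Definition _ :=
  GRing.isLinear.Build F {poly F} 'M[F]_N *:%R (poly_act U) poly_act_is_linear.

Lemma poly_actXn k : poly_act U 'X^k = U ^+ k.
Proof.
rewrite /poly_act size_polyXn big_ord_recr big1 /= => [|i _].
  by rewrite coefXn eqxx scale1r add0r.
by rewrite coefXn (ltn_eqF (ltn_ord i)) scale0r.
Qed.

Lemma poly_actX : poly_act U 'X = U.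
Proof. exact: (poly_actXn 1). Qed.

Lemma poly_act1 : poly_act U 1 = 1%:M.
Proof. exact: (poly_actXn 0). Qed.

Lemma poly_actC c : poly_act U c%:P = c%:M.
Proof. by rewrite -alg_polyC linearZ /= poly_act1 scalemx1. Qed.

Lemma poly_actM p q : poly_act U (p * q) = poly_act U p *m poly_act U q.
Proof.
elim/poly_ind: p => [|p c IHp]; first by rewrite mul0r linear0 mul0mx.
rewrite mulrDl !linearD /= mulmxDl poly_actC mul_scalar_mx mul_polyC linearZ /=.
congr (_ + _); rewrite mulrAC -!(mulrC 'X) => {IHp}.
have XM r : poly_act U ('X * r) = U *m poly_act U r.
  rewrite -{1}[r]coefK poly_def mulr_sumr linear_sum /= [in RHS]/poly_act.
  rewrite mulmx_sumr; apply: eq_bigr => i _.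
  by rewrite -scalerAr linearZ /= -exprS poly_actXn -scalemxAr exprS.
rewrite !XM -!mulmxA; congr (_ *m _).
elim/poly_ind: p => [|p d IHp]; first by rewrite mul0r linear0 mul0mx.
rewrite mulrDl !linearD /= mulmxDl poly_actC mul_scalar_mx mul_polyC linearZ /=.
by rewrite mulrAC -!(mulrC 'X) !XM -mulmxA IHp.
Qed.

Lemma poly_actMC p q : poly_act U p *m poly_act U q = poly_act U q *m poly_act U p.
Proof. by rewrite -!poly_actM mulrC. Qed.

Lemma poly_actXp p k : poly_act U (p ^+ k) = poly_act U p ^+ k.
Proof. by elim: k => [|k IHk]; rewrite ?poly_act1 // !exprS poly_actM IHk. Qed.

Lemma dvdp_act p q (v : 'cV_N) : p %| q -> poly_act U p *m v = 0 ->
  poly_act U q *m v = 0.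
Proof. by case/dvdpP => r -> pv; rewrite poly_actM -mulmxA pv mulmx0. Qed.

Lemma gcdp_act p q (v : 'cV_N) : poly_act U p *m v = 0 ->
  poly_act U q *m v = 0 -> poly_act U (gcdp p q) *m v = 0.
Proof.
move=> pv qv; have /eqpP[[a b] /= /andP[a0 b0] ab] := egcdpE p q.
apply: (scalerI a0); rewrite scaler0 scalemxAl -linearZ /= ab linearZ /=.
rewrite linearD /= !poly_actM -scalemxAl mulmxDl -!mulmxA pv qv.
by rewrite !mulmx0 addr0 scaler0.
Qed.

Lemma coprimep_act p q (v : 'cV_N) : coprimep p q -> poly_act U p *m v = 0 ->
  poly_act U q *m v = 0 -> v = 0.
Proof.
move=> pq pv qv; have := gcdp_act pv qv.
have /size_poly1P[c c0 ->] := pq.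
by rewrite poly_actC mul_scalar_mx => /eqP; rewrite scaler_eq0 (negPf c0) => /eqP.
Qed.

(** Cayley-Hamilton, the case of dimension 0 included. *)
Lemma char_poly_act : poly_act U (char_poly U) = 0.
Proof.
case: N U => [|n] A; first exact: flatmx0.
suff -> p : poly_act A p = horner_mx A p by apply: Cayley_Hamilton.
rewrite -[in RHS](coefK p) poly_def rmorph_sum; apply: eq_bigr => i _ /=.
by rewrite linearZ /= rmorphXn /= horner_mx_X.
Qed.

(** The inverse of U is therefore the power U^e, so that the adjoint of p(U) is
    again a polynomial in U. *)
Lemma finite_order : U \in unitmx -> exists e, U ^+ e.+1 = 1%:M.
Proof.
case: N U => [|n] A Au; first by exists 0%N; rewrite [LHS]flatmx0 [RHS]flatmx0.
pose u : {'GL_n.+1[F]} := FinRing.unit _ Au.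
exists (#[u]%g).-1; rewrite prednK ?order_gt0 //.
have := congr1 val (expg_order u); by rewrite FinRing.val_unitX.
Qed.

End PolyAct.

Lemma two_neq0 (F : finFieldType) : odd #|F| -> (2%:R : F) != 0.
Proof.
have [p pr_p pcharFp] := finPcharP F; rewrite (card_pprimeChar pcharFp) oddX.
move=> oF; apply/negP => two0.
have: 2%N \in [pchar F] by rewrite inE /= two0.
rewrite (pcharf_eq pcharFp) => /eqP p2; move: oF; have -> : odd p = false by rewrite -p2.
rewrite orbF => /eqP n0.
have := card_finRing_gt1 F; rewrite (card_pprimeChar pcharFp) n0 expn0.
by rewrite ltnn.
Qed.

(** * Duality of polynomials and the adjoint *)

Section Star.
Variable F : finFieldType.
Implicit Types (p q f g h : {poly F}) (e r : nat).

(** When U is an isometry with U^(e+1) = 1, its adjoint is U^-1 = U^e; hence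
    the adjoint of p(U) is (star e p)(U). *)
Definition star e p := p \Po 'X^e.

Lemma star_is_linear e : linear (star e).
Proof. by move=> a p q; rewrite /star comp_polyD comp_polyZ. Qed.
HB.instance Definition _ e :=
  GRing.isLinear.Build F {poly F} {poly F} *:%R (star e) (star_is_linear e).

Lemma starM e p q : star e (p * q) = star e p * star e q.
Proof. exact: comp_polyM. Qed.
Lemma star1 e : star e 1 = 1.
Proof. exact: comp_polyC. Qed.
Lemma starC e c : star e c%:P = c%:P.
Proof. exact: comp_polyC. Qed.
Lemma starX e : star e 'X = 'X^e.
Proof. exact: comp_polyX. Qed.
Lemma starXp e p k : star e (p ^+ k) = star e p ^+ k.
Proof. by elim: k => [|k IHk]; rewrite ?star1 // !exprS starM IHk. Qed.
Lemma starXn e k : star e 'X^k = 'X^(e * k).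
Proof. by rewrite starXp starX exprM. Qed.

(** Polynomials only matter modulo this one, which kills U when U^(e+1) = 1. *)
Definition cyclo e : {poly F} := 'X^(e.+1) - 1.

Lemma cyclo_dvd e k : cyclo e %| 'X^(e.+1 * k) - 1.
Proof.
by rewrite exprM /cyclo -{2}(expr1n {poly F} k) subrXX dvdp_mulr.
Qed.

Lemma size_cyclo e : size (cyclo e) = e.+2.
Proof. by rewrite /cyclo size_XnsubC. Qed.

Lemma cyclo_coprimeX e h : h %| cyclo e -> coprimep 'X h.
Proof.
move/coprimep_dvdl; apply.
by rewrite coprimep_sym coprimepX rootE /cyclo !hornerE expr0n /= sub0r oppr_eq0 oner_eq0.
Qed.

(** The adjoint is an involution: e * e = (e + 1)(e - 1) + 1, so that X^(e * e)
    is X modulo X^(e+1) - 1. *)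
Lemma starK e p : cyclo e %| star e (star e p) - p.
Proof.
elim/poly_ind: p => [|p c IHp]; first by rewrite !linear0 addr0 dvdp0.
have -> : star e (star e (p * 'X + c%:P)) = star e (star e p) * star e 'X^e + c%:P.
  by rewrite linearD /= starM starC starX linearD /= starM starC.
rewrite opprD addrACA subrr addr0; set s := star e (star e p) in IHp *.
have -> : s * star e 'X^e - p * 'X = (s - p) * 'X^(e * e) + p * ('X^(e * e) - 'X).
  by rewrite starXn; ring.
apply: dvdp_add; first exact: dvdp_mulr.
apply: dvdp_mull; case: e {IHp s} => [|e].
  by rewrite muln0 -opprB dvdpNr /cyclo.
have -> : (e.+1 * e.+1 = (e.+2 * e).+1)%N by ring.
by rewrite exprSr -[X in _ - X]mul1r -mulrBl dvdp_mulr // cyclo_dvd.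
Qed.

(** Modulo X^(e+1) - 1 the polynomial X^e is the inverse of X, so the adjoint
    of f is its dual up to the unit X^deg(f) and the scalar f(0). *)
Lemma star_dual e f : f`_0 != 0 ->
  cyclo e %| 'X^((size f).-1) * star e f - f`_0 *: dual f.
Proof.
move=> f0; rewrite /dual scaler_sumr -{2}[f]coefK poly_def linear_sum /= mulr_sumr.
rewrite -sumrB; apply: (big_ind (fun p => cyclo e %| p)) => [|x y|i _].
- exact: dvdp0.
- exact: dvdp_add.
rewrite linearZ /= starXn scalerA mulrCA mulfV // mulr1 -scalerAr -scalerBr.
rewrite -mul_polyC; apply: dvdp_mull.
have di : (i <= (size f).-1)%N by rewrite -ltnS prednK // (leq_ltn_trans _ (ltn_ord i)).
have -> : 'X^((size f).-1) = 'X^((size f).-1 - i) * 'X^i :> {poly F}.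
  by rewrite -exprD subnK.
rewrite -mulrA -exprD -mulSn -{2}['X^(_ - i)]mulr1 -mulrBr.
exact/dvdp_mull/cyclo_dvd.
Qed.

Lemma dual_rev f :
  dual f = \poly_(i < size f) (f`_((size f).-1 - i) * (f`_0)^-1).
Proof.
rewrite /dual poly_def (reindex_inj rev_ord_inj) /=.
apply: eq_bigr => i _; have := ltn_ord i; move: (nat_of_ord i) => k ki.
by congr (f`_ _ * _ *: 'X^_); lia.
Qed.

Lemma size_dual f : f`_0 != 0 -> size (dual f) = size f.
Proof.
move=> f0; have sf : (0 < size f)%N.
  by rewrite lt0n size_poly_eq0; apply: contraNneq f0 => ->; rewrite coef0.
rewrite dual_rev size_poly_eq // subnn mulfV ?oner_eq0 //.
Qed.

Lemma coef0_dual f : f \is monic -> f`_0 != 0 -> (dual f)`_0 = (f`_0)^-1.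
Proof.
move=> fm f0; have sf : (0 < size f)%N.
  by rewrite lt0n size_poly_eq0; apply: contraNneq f0 => ->; rewrite coef0.
by rewrite dual_rev coef_poly sf subn0 -/(lead_coef f) (monicP fm) mul1r.
Qed.

Lemma dual_monic f : f`_0 != 0 -> dual f \is monic.
Proof.
move=> f0; have sf : (0 < size f)%N.
  by rewrite lt0n size_poly_eq0; apply: contraNneq f0 => ->; rewrite coef0.
rewrite monicE lead_coefE size_dual // dual_rev coef_poly ltn_predL sf subnn.
by rewrite mulfV.
Qed.

(** Lets identities between duals be proved modulo X^(e+1) - 1, where duality
    is the ring morphism star, by taking e larger than the degrees. *)
Lemma eq_mod_cyclo e p q : (size p <= e.+1)%N -> (size q <= e.+1)%N ->
  cyclo e %| p - q -> p = q.
Proof.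
move=> pe qe /dvdp_leq H; apply/eqP; rewrite -subr_eq0; apply/negPn/negP => /H.
rewrite size_cyclo; have := size_polyD p (- q); rewrite size_polyN => S1 S2.
by move: (leq_trans S2 S1); rewrite leq_max !ltnNge pe qe.
Qed.

Lemma dualM f g : f`_0 != 0 -> g`_0 != 0 -> dual (f * g) = dual f * dual g.
Proof.
move=> f0 g0.
have [nf ng] : f != 0 /\ g != 0.
  by split; [apply: contraNneq f0 => ->|apply: contraNneq g0 => ->]; rewrite coef0.
have fg0 : (f * g)`_0 = f`_0 * g`_0 by rewrite -!horner_coef0 hornerM.
have fgn : (f * g)`_0 != 0 by rewrite fg0 mulf_neq0.
have sfg := size_mul nf ng.
have [sf sg] : (0 < size f)%N /\ (0 < size g)%N by rewrite !size_poly_gt0.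
pose e := (size f + size g)%N.
have se : ((size f + size g).-1 <= e.+1)%N by rewrite (leq_trans (leq_pred _)).
apply: (@eq_mod_cyclo e); first by rewrite size_dual // sfg.
  by rewrite size_mul -?size_poly_gt0 ?size_dual.
have H1 := star_dual e f0; have H2 := star_dual e g0; have H3 := star_dual e fgn.
have : cyclo e %| f`_0 * g`_0 *: (dual (f * g) - dual f * dual g).
  have -> : f`_0 * g`_0 *: (dual (f * g) - dual f * dual g) =
   ('X^((size f).-1) * star e f - f`_0 *: dual f) * ('X^((size g).-1) * star e g)
   + (f`_0 *: dual f) * ('X^((size g).-1) * star e g - g`_0 *: dual g)
   - ('X^((size (f * g)).-1) * star e (f * g) - (f * g)`_0 *: dual (f * g)).
    rewrite fg0 sfg; have -> : ((size f + size g).-1.-1 = (size f).-1 + (size g).-1)%N by lia.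
    rewrite exprD starM -!mul_polyC polyCM; ring.
  apply: dvdp_sub => //; apply: dvdp_add; first exact: dvdp_mulr.
  exact: dvdp_mull.
by rewrite dvdpZr // mulf_neq0.
Qed.

Lemma dualK f : f \is monic -> f`_0 != 0 -> dual (dual f) = f.
Proof.
move=> fm f0; have d0 := coef0_dual fm f0.
have d0n : (dual f)`_0 != 0 by rewrite d0 invr_eq0.
have sf : (0 < size f)%N.
  by rewrite lt0n size_poly_eq0; apply: contraNneq f0 => ->; rewrite coef0.
apply: (@eq_mod_cyclo (size f)); rewrite ?size_dual //.
set e := size f; have H1 := star_dual e f0; have H2 := star_dual e d0n.
have H3 := starK e f; rewrite size_dual // in H2.
set n := (size f).-1 in H1 H2.
have H4 : cyclo e %| 'X^n * star e ('X^n * star e f - f`_0 *: dual f).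
  case/dvdpP: H1 => q ->; rewrite starM mulrA; apply: dvdp_mull.
  rewrite /cyclo linearB /= starXn star1 -[(e * e.+1)%N]mulnC.
  exact: cyclo_dvd.
have X1 : cyclo e %| 'X^n * star e 'X^n - 1.
  by rewrite starXn -exprD -mulSn cyclo_dvd.
have -> : dual (dual f) - f =
   (star e (star e f) - f) + ('X^n * star e 'X^n - 1) * star e (star e f)
   - 'X^n * star e ('X^n * star e f - f`_0 *: dual f)
   - f`_0 *: ('X^n * star e (dual f) - (dual f)`_0 *: dual (dual f)).
  rewrite linearB linearZ /= starM d0 -!mul_polyC.
  have E : (f`_0)%:P * ((f`_0)^-1)%:P = 1 :> {poly F} by rewrite -polyCM mulfV.
  rewrite -[X in X - f]mul1r -[X in X * _ - f]E; ring.
apply: dvdp_sub; last by rewrite -mul_polyC; apply: dvdp_mull.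
by apply: dvdp_sub => //; apply: dvdp_add => //; apply: dvdp_mulr.
Qed.

Lemma dualXp h k : h`_0 != 0 -> dual (h ^+ k) = dual h ^+ k.
Proof.
move=> h0; elim: k => [|k IHk]; last first.
  rewrite !exprS dualM ?IHk // -horner_coef0 horner_exp horner_coef0.
  exact: expf_neq0.
rewrite !expr0 dual_rev size_poly1; apply/polyP => i; rewrite coef_poly.
by case: i => [|i]; rewrite !coef1 //= divr1.
Qed.

Lemma Phi_neq0 f : is_Phi f -> f`_0 != 0.
Proof.
case=> fm fi fX; apply: contraNneq fX => f0.
have Xf : 'X %| f by rewrite -['X]subr0 -polyC0 dvdp_XsubCl rootE horner_coef0 f0.
have := (fi.2 'X _ Xf); rewrite size_polyX => /(_ isT).
by rewrite eqp_monic ?monicX // => /eqP ->.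
Qed.

Lemma dual_factor f g h : f = g * h -> f`_0 != 0 -> g`_0 != 0 /\ h`_0 != 0.
Proof.
move=> ->; rewrite -!horner_coef0 hornerM mulf_eq0 negb_or.
by case/andP.
Qed.

Lemma Phi_dual g : is_Phi g -> is_Phi (dual g).
Proof.
move=> gP; have g0 := Phi_neq0 gP; have [gm gi gX] := gP.
have d0 : (dual g)`_0 != 0 by rewrite coef0_dual // invr_eq0.
split; first exact: dual_monic; last first.
  by apply: contraNneq d0 => ->; rewrite coefX.
split; first by rewrite size_dual //; case: gi.
move=> q sq qg; have q0 : q != 0.
  by apply: contraNneq d0 => q0; move: qg; rewrite q0 dvd0p => /eqP ->; rewrite coef0.
have lq0 : (lead_coef q)^-1 != 0 by rewrite invr_eq0 lead_coef_eq0.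
pose q' := (lead_coef q)^-1 *: q.
have qm : q' \is monic by rewrite monicE lead_coefZ mulVf // lead_coef_eq0.
have qq : q' %= q by apply: eqp_scale.
have /dvdpP[s sE] : q' %| dual g by rewrite (eqp_dvdl _ qq).
have sm : s \is monic by rewrite -(monicMr _ qm) -sE dual_monic.
have [s0 q'0] := dual_factor sE d0.
have gE : g = dual s * dual q' by rewrite -dualM // -sE dualK.
have : dual q' %= g.
  apply: gi.2; last by rewrite gE dvdp_mull.
  by rewrite size_dual // (eqp_size qq).
move/eqp_size; rewrite size_dual // (eqp_size qq) => s1.
by rewrite -dvdp_size_eqp // size_dual // s1.
Qed.

Lemma Phi_coprime g h : is_Phi g -> is_Phi h -> g != h -> coprimep g h.
Proof.
move=> [gm gi _] [hm hi _]; apply: contraNT; rewrite (irreducible_poly_coprime _ gi).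
rewrite negbK => gh; have := hi.2 g _ gh.
rewrite eqp_monic //; apply; by rewrite gtn_eqF //; case: gi.
Qed.

Lemma Phi_XsubC (c : F) : c != 0 -> is_Phi ('X - c%:P).
Proof.
move=> c0; split; first exact: monicXsubC.
  by apply: irredp_XsubC.
by apply: contraNneq c0 => /(congr1 (fun p => p`_0)) /eqP; rewrite !coefE /= sub0r oppr_eq0.
Qed.

Lemma dual_Xsub (c : F) : c ^+ 2 = 1 -> dual ('X - c%:P) = 'X - c%:P.
Proof.
move=> c2; have c0 : c != 0.
  by apply/eqP => c0; move: c2; rewrite c0 expr0n /= => /eqP; rewrite eq_sym oner_eq0.
have ci : c^-1 = c by rewrite -[RHS]mul1r -[1](mulVf c0) -mulrA -expr2 c2 mulr1.
rewrite dual_rev size_XsubC; apply/polyP => i; rewrite coef_poly !coefE /=.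
case: i => [|[|i]] /=; rewrite ?subn0 ?sub0r ?subr0 /= ?invrN ?ci ?mul1r //.
  by rewrite mulNr mulrN opprK -expr2 c2.
by rewrite oppr0.
Qed.

(** The two polynomials t - 1 and t + 1, the only ones at which the exceptional
    behaviour of odd exponents and the signs occur. *)
Definition unit_poly f := exists2 c : F, c ^+ 2 = 1 & f = 'X - c%:P.

Lemma sqr1_cases (c : F) : c ^+ 2 = 1 -> c = 1 \/ c = -1.
Proof. by move/eqP; rewrite sqrf_eq1 => /orP[] /eqP; [left|right]. Qed.

Lemma Phi_s_monic f : is_Phi_s f -> f \is monic.
Proof.
case=> [[[]//]|[g [gP _ ->]]].
by rewrite monicMr ?dual_monic ?(Phi_neq0 gP) //; case: gP.
Qed.

Lemma Phi_s_coef0 f : is_Phi_s f -> f`_0 != 0.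
Proof.
case=> [[/Phi_neq0//]|[g [gP _ ->]]].
rewrite -horner_coef0 hornerM !horner_coef0 mulf_neq0 ?(Phi_neq0 gP) //.
exact: Phi_neq0 (Phi_dual gP).
Qed.

Lemma Phi_s_dual f : is_Phi_s f -> dual f = f.
Proof.
case=> [[_ <-//]|[g [gP _ ->]]].
rewrite dualM ?(Phi_neq0 gP) ?(Phi_neq0 (Phi_dual gP)) // dualK ?(Phi_neq0 gP) //.
  by rewrite mulrC.
by case: gP.
Qed.

Lemma Phi_coprime_sqr1 g : is_Phi g -> ~ unit_poly g -> coprimep g ('X^2 - 1).
Proof.
move=> gP gu; have -> : 'X^2 - 1 = ('X - 1%:P) * ('X - (-1)%:P) :> {poly F}.
  by rewrite polyCN polyC1; ring.
rewrite coprimepMr; apply/andP; split; apply: Phi_coprime => //.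
- by apply: Phi_XsubC; rewrite oner_eq0.
- by apply: contra_notN gu => /eqP ->; exists 1 => //; rewrite expr1n.
- by apply: Phi_XsubC; rewrite oppr_eq0 oner_eq0.
- by apply: contra_notN gu => /eqP ->; exists (-1) => //; rewrite sqrrN expr1n.
Qed.

(** A factor of f dividing X^2 - 1 would be t - 1 or t + 1, which are
    self-dual, so f would be one of them. *)
Lemma Phi_s_coprime_sqr1 f : is_Phi_s f -> ~ unit_poly f -> coprimep f ('X^2 - 1).
Proof.
case=> [[fP _]|[g [gP gd ->]] _]; first exact: Phi_coprime_sqr1.
have ng h : h = g \/ h = dual g -> ~ unit_poly h.
  move=> hg [c c2 hE]; apply: gd; case: hg => hg; first by rewrite -hg hE dual_Xsub.
  have gm : g \is monic by case: gP.
  by rewrite -{1}[g]dualK ?(Phi_neq0 gP) // -hg hE dual_Xsub.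
rewrite coprimepMl !Phi_coprime_sqr1 //.
- exact: Phi_dual.
- by apply: ng; right.
by apply: ng; left.
Qed.

(** A self-dual polynomial generates a star-stable ideal; the factor X^deg(h)
    in star_dual is cancelled because X is a unit modulo h. *)
Lemma star_dual_dvd e h : h \is monic -> h`_0 != 0 -> h %| cyclo e -> dual h = h -> h %| star e h.
Proof.
move=> hm h0 he hd; have := dvdp_trans he (star_dual e h0).
rewrite hd dvdp_subl; last by rewrite -mul_polyC dvdp_mull.
rewrite mulrC Gauss_dvdpl //; rewrite coprimep_sym.
by apply: coprimep_expl; apply: cyclo_coprimeX he.
Qed.

(** A divisor of g^k * b not divisible by g^k misses a factor g, which can be
    removed from g^k * b. *)
Lemma irreducible_strip g c b k : irreducible_poly g -> c %| g ^+ k * b ->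
  ~~ (g ^+ k %| c) -> c %| g ^+ k.-1 * b.
Proof.
move=> gi; elim: k c => [|k IHk] c; first by rewrite expr0 dvd1p.
move=> cg ngc /=; case: (boolP (g %| c)) => [/dvdpP[c1 cE]|ngc1]; last first.
  rewrite -irreducible_poly_coprime // in ngc1.
  have cb : c %| b by rewrite -(@Gauss_dvdpr _ _ (g ^+ k.+1)) // coprimep_sym coprimep_expl.
  exact: dvdp_mull.
have g0 : g != 0 by apply: irredp_neq0.
have : c1 %| g ^+ k.-1 * b.
  apply: IHk; first by move: cg; rewrite cE mulrC exprS -mulrA dvdp_mul2l.
  by apply: contra ngc; rewrite cE exprSr dvdp_mul2r.
case: k {IHk cg} ngc => [|k]; first by rewrite expr1 cE dvdp_mull.
by move=> _ /= c1g; rewrite cE mulrC exprS -mulrA dvdp_mul2l.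
Qed.

Lemma irreducible_Bezout f r p : irreducible_poly f -> ~~ (f ^+ r %| p) ->
  exists a b, f ^+ r.-1 = a * p + b * f ^+ r.
Proof.
move=> fi nfp; pose c := gcdp p (f ^+ r).
have : c %| f ^+ r.-1 * 1.
  apply: irreducible_strip => //; first by rewrite mulr1 dvdp_gcdr.
  by apply: contra nfp; rewrite dvdp_gcd => /andP[].
rewrite mulr1 => /dvdpP[z zE]; have /eqpP[[a b] /= /andP[a0 b0] ab] := egcdpE p (f ^+ r).
exists (z * (a^-1 * b)%:P * (egcdp p (f ^+ r)).1), (z * (a^-1 * b)%:P * (egcdp p (f ^+ r)).2).
rewrite -!mulrA -!mulrDr zE; congr (_ * _).
by rewrite polyCM -mulrA !mul_polyC -ab scalerA mulVf // scale1r.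
Qed.

(** For f irreducible this holds because the ideals containing f^r are the
    (f^k). For f = g * dual g, an element outside (f^r) yields u^(r-1) * v^r in
    I with u, v the two factors in some order; star-stability yields v^(r-1) *
    u^r, and a Bezout combination of the two is f^(r-1). It reduces the
    nondegeneracy of a cyclic block to the single value of the form on f^(r-1).
    *)
Lemma Phi_s_ideal f e r (I : {poly F} -> Prop) : is_Phi_s f -> I (cyclo e) ->
  (0 < r)%N ->
  (forall p q, I p -> I q -> I (p + q)) -> (forall p q, I p -> I (q * p)) ->
  (forall p, I p -> I (star e p)) -> I (f ^+ r) ->
  forall p, I p -> ~~ (f ^+ r %| p) -> I (f ^+ r.-1).
Proof.
move=> fP fe r0 ID IM Istar If p Ip nfp.
have Igcd x y : I x -> I y -> I (gcdp x y).
  move=> Ix Iy; have /eqpP[[a b] /= /andP[a0 b0] ab] := egcdpE x y.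
  have -> : gcdp x y = (a^-1 * b)%:P * ((egcdp x y).1 * x + (egcdp x y).2 * y).
    by rewrite polyCM -mulrA !mul_polyC -ab scalerA mulVf // scale1r.
  by apply/IM/ID; apply: IM.
have Idvd x y : I x -> x %| y -> I y by move=> Ix /dvdpP[z ->]; apply: IM.
pose c := gcdp p (f ^+ r).
have Ic : I c by apply: Igcd.
have cf : c %| f ^+ r by apply: dvdp_gcdr.
have nfc : ~~ (f ^+ r %| c) by apply: contra nfp; rewrite dvdp_gcd => /andP[].
case: (fP) => [[[fm fi _] _]|[g [gP gd fE]]].
  apply: Idvd Ic _; rewrite -[f ^+ r.-1]mulr1; apply: irreducible_strip => //.
  by rewrite mulr1.
have g'P := Phi_dual gP; set g' := dual g in fE g'P.
have cop : coprimep g g' by apply: Phi_coprime => //; apply/eqP.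
have [gm gi _] := gP; have [g'm g'i _] := g'P.
have Idual (h : {poly F}) : h`_0 != 0 -> I h -> I (dual h).
  move=> h0 Ih; have /dvdpP[z zE] := star_dual e h0.
  have -> : dual h = (h`_0)^-1%:P * ('X^((size h).-1) * star e h + (- z) * cyclo e).
    by rewrite mulNr -zE opprB addrC subrK mul_polyC scalerA mulVf // scale1r.
  apply: (IM); apply: ID; apply: IM => //; exact: Istar.
(* The dual of u^(r-1) * v^r is v^(r-1) * u^r. *)
have swap (u v : {poly F}) : u`_0 != 0 -> v`_0 != 0 -> dual u = v -> dual v = u -> f = u * v ->
    coprimep u v -> I (u ^+ r.-1 * v ^+ r) -> I (f ^+ r.-1).
  move=> u0 v0 du dv fuv cuv I1; have p0 (h : {poly F}) k : h`_0 != 0 -> (h ^+ k)`_0 != 0.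
    by move=> h0; rewrite -horner_coef0 horner_exp horner_coef0; apply: expf_neq0.
  have := Idual _ _ I1; rewrite -horner_coef0 hornerM !horner_coef0.
  rewrite mulf_neq0 ?p0 // => /(_ isT); rewrite dualM ?p0 // !dualXp // du dv => I2.
  have /Bezout_eq1_coprimepP[[s t] /= st] := cuv.
  have -> : f ^+ r.-1 = t * (u ^+ r.-1 * v ^+ r) + s * (v ^+ r.-1 * u ^+ r).
    rewrite -(prednK r0) /= !exprS fuv exprMn -[LHS]mulr1 -st; ring.
  by apply: ID; apply: IM.
have g0 := Phi_neq0 gP; have g'0 := Phi_neq0 g'P.
have gK : dual g' = g by rewrite dualK.
have : ~~ (g ^+ r %| c) || ~~ (g' ^+ r %| c).
  apply: contraR nfc; rewrite negb_or !negbK => /andP[gc g'c].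
  by rewrite fE exprMn Gauss_dvdp ?gc // coprimep_expl // coprimep_expr.
rewrite fE exprMn in cf; case/orP => nc.
  apply: (swap g g') => //; apply: Idvd Ic _; exact: irreducible_strip nc.
apply: (swap g' g); rewrite // 1?mulrC // 1?coprimep_sym //.
apply: Idvd Ic _; rewrite mulrC; apply: irreducible_strip nc => //.
by rewrite mulrC.
Qed.

End Star.

(** * Norms for the adjoint involution *)

(* Finiteness of the quotient rings, on which the counting below relies. *)
HB.instance Definition _ (F : finFieldType) (h : {poly F}) :=
  Finite.copy {poly %/ h} {poly_(size (mk_monic h)).-1 F}.

Section NormOnto.
Variables (R : finComUnitRingType) (s : R -> R).
Hypotheses (s1 : s 1 = 1) (sM : forall x y, s (x * y) = s x * s y)
  (sD : forall x y, s (x + y) = s x + s y) (sK : forall x, s (s x) = x).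

(** Counting in the group of units, with N x = x * s x and D x = x / s x: the
    image of N lies in the kernel of D, which consists of the fixed units, and
    the kernel of N lies in the image of D by the hypothesis, as y = z + x * s
    z satisfies x * s y = y. As #|ker N| * #|im N| = #|ker D| * #|im D|, these
    inclusions are equalities. *)
Lemma norm_onto :
  (forall x, x * s x = 1 -> exists z, z + x * s z \is a GRing.unit) ->
  forall u, u \is a GRing.unit -> s u = u ->
    exists2 y, y \is a GRing.unit & y * s y = u.
Proof.
move=> H90 u0 uu0 su0.
have sU (x : {unit R}) : s (val x) \is a GRing.unit.
  by apply/unitrP; exists (s (val x)^-1); rewrite -!sM mulVr ?mulrV ?s1 // (valP x).
pose sg (x : {unit R}) : {unit R} := FinRing.unit R (sU x).
have mC (x y : {unit R}) : (x * y = y * x)%g.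
  by apply: val_inj; rewrite /= mulrC.
have sgM (x y : {unit R}) : (sg (x * y) = sg x * sg y)%g.
  by apply: val_inj; rewrite /= sM.
have sgK x : sg (sg x) = x by apply: val_inj; rewrite /= sK.
have sgV (x : {unit R}) : (sg x^-1 = (sg x)^-1)%g.
  apply: (mulgI (sg x)); rewrite -sgM !mulgV; apply: val_inj; exact: s1.
have acm (a b c d : {unit R}) : ((a * b) * (c * d) = (a * c) * (b * d))%g.
  by rewrite !mulgA; congr (_ * _)%g; rewrite -!mulgA; congr (_ * _)%g; apply: mC.
have nM : {in [set: {unit R}] &, {morph (fun x => x * sg x)%g : x y / (x * y)%g}}.
  by move=> x y _ _ /=; rewrite sgM acm.
have dM : {in [set: {unit R}] &, {morph (fun x => x * (sg x)^-1)%g : x y / (x * y)%g}}.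
  by move=> x y _ _ /=; rewrite sgM invMg [((sg y)^-1 * _)%g]mC acm.
pose Nm := @Morphism _ _ [set: {unit R}]%G _ nM.
pose Dm := @Morphism _ _ [set: {unit R}]%G _ dM.
have kerD x : (x \in ('ker Dm)%g) = (sg x == x).
  rewrite !inE /=; apply/eqP/eqP => [E|->]; last by rewrite mulgV.
  by rewrite -[LHS]mul1g -E mulgKV.
have subI : (Nm @* setT)%g \subset ('ker Dm)%g.
  apply/subsetP => _ /morphimP[x _ _ ->]; rewrite kerD /= sgM sgK.
  by rewrite mC.
have subK : ('ker Nm)%g \subset (Dm @* setT)%g.
  apply/subsetP => x; rewrite !inE /= => /eqP /(congr1 val) /= xsx.
  have [z zu] := H90 _ xsx.
  pose y : {unit R} := FinRing.unit R zu.
  apply/morphimP; exists y; rewrite ?inE //=.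
  apply: (mulIg (sg y)); rewrite mulgKV; apply: val_inj => /=.
  by rewrite sD sM sK mulrDr mulrA xsx mul1r addrC.
have cN := card_morphim Nm setT; have cD := card_morphim Dm setT.
rewrite !setTI in cN cD.
have LN := Lagrange (subsetT ('ker Nm)%G); have LD := Lagrange (subsetT ('ker Dm)%G).
rewrite -cN in LN; rewrite -cD in LD.
have /eqP NE : (Nm @* setT == 'ker Dm)%g.
  rewrite eqEcard subI /= -(leq_pmul2l (cardG_gt0 ('ker Nm)%G)) LN -LD mulnC.
  by rewrite leq_mul2l subset_leq_card ?orbT.
pose v : {unit R} := FinRing.unit R uu0.
have : v \in (Nm @* setT)%g by rewrite NE kerD; apply/eqP/val_inj.
case/morphimP => y _ _ vE; exists (val y); first exact: (valP y).
by have := congr1 val vE.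
Qed.
End NormOnto.

Section NormPoly.
Variables (F : finFieldType) (f : {poly F}) (r e : nat).
Hypotheses (fP : is_Phi_s f) (fu : ~ unit_poly f) (r0 : (0 < r)%N).
Hypothesis fe : f ^+ r %| cyclo F e.
Let h := f ^+ r.

Lemma Phi_s_size : (1 < size f)%N.
Proof.
case: fP => [[[_ [] //]]|[g [gP _ ->]]].
have [_ [sg _] _] := gP; have [_ [sd _] _] := Phi_dual gP.
have [ng nd] : g != 0 /\ dual g != 0 by split; apply: irredp_neq0; [case: gP|case: (Phi_dual gP)].
rewrite size_mul //; have := leq_add sg sd.
by case: (size g + size (dual g))%N => [|[|[|k]]].
Qed.

Let hm : h \is monic.
Proof. by rewrite /h monic_exp // Phi_s_monic. Qed.

Let hs : (1 < size h)%N.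
Proof.
have := size_exp f r; have := Phi_s_size; rewrite -/h.
case: (size f) (size h) r0 => [|[|k]] // [|[|l]] //= rp _; rewrite ?subn0 => /esym/eqP;
by rewrite muln_eq0 /= (gtn_eqF rp).
Qed.

Let hq : mk_monic h = h.
Proof. by rewrite /mk_monic hs hm. Qed.

Lemma in_qpoly_eq p q : in_qpoly h p = in_qpoly h q <-> h %| p - q.
Proof.
have E : in_qpoly h p = in_qpoly h q <-> p %% h = q %% h.
  split=> [/(congr1 val)|H]; last apply: val_inj.
    by rewrite /= hq !Pdiv.IdomainMonic.modpE.
  by rewrite /= hq -!Pdiv.IdomainMonic.modpE.
rewrite E /dvdp modpD modpN; split=> [->|/eqP/subr0_eq //].
by rewrite subrr.
Qed.

Lemma coprimep_exp_r p : coprimep h p = coprimep f p.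
Proof. by rewrite /h coprimep_pexpl. Qed.

Let hd : dual h = h.
Proof. by rewrite /h dualXp ?Phi_s_dual // Phi_s_coef0. Qed.

Let h0 : h`_0 != 0.
Proof. by rewrite /h -horner_coef0 horner_exp horner_coef0 expf_neq0 // Phi_s_coef0. Qed.

Let hstar p : h %| p -> h %| star e p.
Proof.
case/dvdpP => q ->; rewrite starM dvdp_mull //.
exact: star_dual_dvd.
Qed.

(** Hilbert 90 for the involution star of F[t]/(f^r). If neither z = 1 nor z =
    X gave a unit z + x * star z, an irreducible factor g of f would divide
    both 1 + x and X + x * X^e, hence X^2 - 1, so g would be t - 1 or t + 1. *)
Lemma norm_mod u : coprimep f u -> h %| star e u - u ->
  exists2 y, coprimep f y & h %| y * star e y - u.
Proof.
move=> cu su; pose s (x : {poly %/ h}) : {poly %/ h} := in_qpoly h (star e (val x)).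
have inK (x : {poly %/ h}) : in_qpoly h (val x) = x.
  by apply: val_inj; apply: in_qpoly_small; apply: size_mk_monic.
have sE p : s (in_qpoly h p) = in_qpoly h (star e p).
  apply/in_qpoly_eq; rewrite -linearB; apply: hstar; apply/in_qpoly_eq.
  by rewrite inK.
have unitE p : (in_qpoly h p \is a GRing.unit) = coprimep f p.
  have -> : (in_qpoly h p \is a GRing.unit) = coprimep (mk_monic h) (val (in_qpoly h p)) by [].
  by rewrite /= hq -Pdiv.IdomainMonic.modpE // coprimep_modr coprimep_exp_r.
have [g [gP gf gnc]] : exists g, [/\ is_Phi g, g %| f &
    forall y, ~~ coprimep f y -> (g %| y) || (dual g %| y)].
  case: (fP) => [[gP gd]|[g [gP _ fE]]].
    exists f; split=> // y; have [_ gi _] := gP.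
    by rewrite irreducible_poly_coprime // negbK => ->.
  exists g; split=> // [|y]; first by rewrite fE dvdp_mulr.
  have [_ gi _] := gP; have [_ di _] := Phi_dual gP.
  by rewrite fE coprimepMl negb_and !irreducible_poly_coprime // !negbK.
have gh : g %| h by rewrite /h -(prednK r0) exprS dvdp_mulr.
have ge : g %| cyclo F e := dvdp_trans gh fe.
have gX : coprimep g 'X by rewrite coprimep_sym; apply: cyclo_coprimeX ge.
have gs y : dual g %| y -> g %| star e y.
  case/dvdpP => z ->; rewrite starM dvdp_mull //.
  have g0 := Phi_neq0 gP; have gm : g \is monic by case: gP.
  have d0 : (dual g)`_0 != 0 by rewrite coef0_dual // invr_eq0.
  have := dvdp_trans ge (star_dual e d0); rewrite dualK //.
  rewrite dvdp_subl; last by rewrite -mul_polyC dvdp_mull.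
  by rewrite mulrC Gauss_dvdpl // coprimep_expr.
have inM p q : in_qpoly h (p * q) = in_qpoly h p * in_qpoly h q by apply: in_qpolyM.
have inD p q : in_qpoly h (p + q) = in_qpoly h p + in_qpoly h q by apply: in_qpolyD.
have s1 : s 1 = 1 by rewrite -[1](in_qpoly1 h) sE star1.
have sM x y : s (x * y) = s x * s y.
  by rewrite -(inK x) -(inK y) -inM !sE starM inM.
have sD x y : s (x + y) = s x + s y.
  by rewrite -(inK x) -(inK y) -inD !sE linearD inD.
have sK x : s (s x) = x by rewrite -(inK x) !sE; apply/in_qpoly_eq/(dvdp_trans fe)/starK.
have H90 x : x * s x = 1 -> exists z, z + x * s z \is a GRing.unit.
  rewrite -(inK x); move: (val x) => {}x; rewrite sE -inM -(in_qpoly1 h).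
  move/in_qpoly_eq => xx.
  have H p : coprimep f (p + x * star e p) -> exists z, z + in_qpoly h x * s z \is a GRing.unit.
    by exists (in_qpoly h p); rewrite sE -inM -inD unitE.
  case: (boolP (coprimep f (1 + x * star e 1))) => [/H //|/gnc n1].
  case: (boolP (coprimep f ('X + x * star e 'X))) => [/H //|/gnc nX].
  (* If dual g divides p + x * star p, applying star shows that g divides star
     p + star x * p, and x * star x = 1 gives back p + x * star p. *)
  have G p : (g %| p + x * star e p) || (dual g %| p + x * star e p) ->
      g %| p + x * star e p.
    case/orP => // /gs; rewrite linearD /= starM => gy.
    have -> : p + x * star e p = x * (star e p + star e x * star e (star e p))
      - x * star e x * (star e (star e p) - p) - (x * star e x - 1) * p by ring.
    apply: dvdp_sub; last by apply/dvdp_mulr/(dvdp_trans gh).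
    by apply: dvdp_sub; apply: dvdp_mull => //; apply: dvdp_trans ge (starK e p).
  have {n1}n1 := G _ n1; have {nX}nX := G _ nX.
  rewrite star1 mulr1 in n1; rewrite starX in nX.
  have : g %| 'X^2 - 1.
    have -> : 'X^2 - 1 = 'X * ('X + x * 'X^e) - 'X^(e.+1) * (1 + x) + cyclo F e.
      by rewrite /cyclo ['X^(e.+1)]exprS; ring.
    by apply: dvdp_add => //; apply: dvdp_sub; apply: dvdp_mull.
  have gcop : coprimep g ('X^2 - 1).
    by apply: coprimep_dvdr (Phi_s_coprime_sqr1 fP fu); rewrite // coprimep_sym.
  by move: gcop; have [_ gi _] := gP; rewrite irreducible_poly_coprime // => /negP.
have uu : in_qpoly h u \is a GRing.unit by rewrite unitE.
have suE : s (in_qpoly h u) = in_qpoly h u by rewrite sE; apply/in_qpoly_eq.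
have [y yu yE] := norm_onto s1 sM sD sK H90 uu suE.
exists (val y); first by rewrite -unitE inK.
by apply/in_qpoly_eq; rewrite inM -sE inK.
Qed.
End NormPoly.

(** * Alternating forms with an isometry *)

Section FunctionalRep.
Variables (F : finFieldType) (h : {poly F}).
Hypothesis hm : h \is monic.
Variables psi phi : {linear {poly F} -> F | *%R}.
Hypotheses (psih : forall p, psi (p * h) = 0) (phih : forall p, phi (p * h) = 0).
Hypothesis nd : forall p, (forall y, psi (p * y) = 0) -> h %| p.

(** A nondegenerate pairing psi (x * y) on the finite dimensional algebra
    F[t]/(h) identifies the algebra with its dual; concretely the matrix of the
    values psi (X^i * X^j) is invertible. *)
Lemma functional_rep : exists u, forall x, phi x = psi (x * u).
Proof.
have h0 : h != 0 by apply: monic_neq0.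
pose d := (size h).-1.
have dE : size h = d.+1 by rewrite prednK ?size_poly_gt0.
have sm x : (size (x %% h)%R <= d)%N by rewrite -ltnS -dE ltn_modp.
have modE (f : {linear {poly F} -> F | *%R}) x :
    (forall p, f (p * h) = 0) -> f x = f (x %% h).
  by move=> fh; rewrite {1}(divp_eq x h) linearD /= fh add0r.
have modM x y : psi (x * y) = psi (x * (y %% h)).
  by rewrite {1}(divp_eq y h) mulrDr linearD /= mulrA psih add0r.
pose M : 'M[F]_d := \matrix_(i, j) psi ('X^i * 'X^j).
have pE (g : {linear {poly F} -> F | *%R}) (x : {poly F}) : (size x <= d)%N ->
    g x = \sum_(i < d) x`_i * g 'X^i.
  move=> sx; have {1}-> : x = \sum_(i < d) x`_i *: 'X^i.
    by rewrite -poly_def -[x in LHS](poly_rV_K sx) /rVpoly /poly_rV; apply/polyP => k;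
       rewrite !coef_poly; case: ltnP => // kd; rewrite insubT mxE.
  by rewrite linear_sum; apply: eq_bigr => i _; rewrite linearZ.
have mulE (c y : {poly F}) : (size c <= d)%N -> psi (c * y) = \sum_(i < d) c`_i * psi ('X^i * y).
  move=> sc; have {1}-> : c = \sum_(i < d) c`_i *: 'X^i.
    by rewrite -poly_def -[c in LHS](poly_rV_K sc) /rVpoly /poly_rV; apply/polyP => k;
       rewrite !coef_poly; case: ltnP => // kd; rewrite insubT mxE.
  rewrite mulr_suml linear_sum; apply: eq_bigr => i _.
  by rewrite -scalerAl linearZ.
have Mfree : row_free M.
  apply: inj_row_free => c cM; pose p := rVpoly c.
  have sp : (size p <= d)%N by apply: size_poly.
  have pc (i : 'I_d) : p`_i = c 0 i by rewrite coef_rVpoly_ord.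
  have : h %| p.
    apply: nd => y; rewrite modM mulrC mulE //; apply: big1 => j _.
    rewrite ['X^j * p]mulrC mulE // [X in _ * X](_ : _ = 0) ?mulr0 //.
    have := congr1 (fun A : 'rV_d => A 0 j) cM; rewrite !mxE => cM0.
    rewrite -[RHS]cM0; by apply: eq_bigr => i _; rewrite pc mxE.
  move/dvdp_leq => lp; suff p0 : p = 0 by apply/rowP => i; rewrite -pc p0 coef0 mxE.
  apply/eqP/negPn/negP => /lp; rewrite dE => /leq_trans/(_ sp); by rewrite ltnn.
have Mu : M \in unitmx by rewrite -row_free_unit.
pose b : 'cV[F]_d := \col_i phi 'X^i.
pose u := rVpoly (invmx M *m b)^T; exists u => x.
have su : (size u <= d)%N by apply: size_poly.
have H i : (i < d)%N -> phi 'X^i = psi ('X^i * u).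
  move=> id; have := mulKVmx Mu b => /colP/(_ (Ordinal id)); rewrite [RHS]mxE /= => <-.
  rewrite mulrC mulE // mxE; apply: eq_bigr => j _.
  by rewrite coef_rVpoly_ord !mxE /= mulrC ['X^_ * _]mulrC.
rewrite (modE phi) // pE // [in RHS]mulrC modM mulrC mulE //.
by apply: eq_bigr => i _; rewrite H.
Qed.
End FunctionalRep.

Section Form.
Variables (F : finFieldType) (N : nat) (J : 'M[F]_N).
Definition bform (v w : 'cV[F]_N) : F := (v^T *m J *m w) ord0 ord0.

Lemma bform_is_linear v : linear_for *%R (bform v).
Proof. by move=> a x y; rewrite /bform mulmxDr -scalemxAr !mxE. Qed.
HB.instance Definition _ v :=
  GRing.isLinear.Build F 'cV[F]_N F *%R (bform v) (bform_is_linear v).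

Lemma bformDl x y w : bform (x + y) w = bform x w + bform y w.
Proof. by rewrite /bform linearD /= !mulmxDl mxE. Qed.
Lemma bformZl a x w : bform (a *: x) w = a * bform x w.
Proof. by rewrite /bform linearZ /= -!scalemxAl mxE. Qed.
Lemma bformNl x w : bform (- x) w = - bform x w.
Proof. by rewrite -scaleN1r bformZl mulN1r. Qed.
Lemma bform0l w : bform 0 w = 0.
Proof. by rewrite -(scale0r 0) bformZl mul0r. Qed.
Lemma bform0r w : bform w 0 = 0.
Proof. exact: linear0. Qed.
Lemma bformDr w x y : bform w (x + y) = bform w x + bform w y.
Proof. exact: linearD. Qed.
Lemma bformZr w a x : bform w (a *: x) = a * bform w x.
Proof. exact: linearZ. Qed.
Lemma bform_suml I (s : seq I) P (x : I -> _) w :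
  bform (\sum_(i <- s | P i) x i) w = \sum_(i <- s | P i) bform (x i) w.
Proof.
apply: (big_ind2 (fun u v => bform u w = v)) => [|x1 x2 y1 y2 <- <-|//].
  exact: bform0l.
exact: bformDl.
Qed.

Lemma bformC v w : J^T = - J -> bform v w = - bform w v.
Proof.
move=> JT; rewrite /bform -[v^T *m J *m w]trmxK mxE trmx_mul trmx_mul trmxK JT.
by rewrite mulNmx mulmxN mulmxA !mxE.
Qed.
End Form.

Lemma Q_form (F : finFieldType) N (v w : 'cV[F]_N) : Q v w = bform (form_mx F N) v w.
Proof. by []. Qed.

(** A nondegenerate skew form J, which is alternating in odd characteristic,
    with an isometry U. The order e + 1 is kept explicit because star e depends
    on it. *)
Definition symp (F : finFieldType) N (J U : 'M[F]_N) e : Prop :=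
  [/\ J^T = - J, J \in unitmx, U^T *m J *m U = J & U ^+ e.+1 = 1%:M].

Definition stable (F : finFieldType) N (U : 'M[F]_N) (W : {vspace 'cV[F]_N}) :=
  forall x, x \in W -> U *m x \in W.
Definition nondeg (F : finFieldType) N (J : 'M[F]_N) (W : {vspace 'cV[F]_N}) :=
  forall x, x \in W -> (forall y, y \in W -> bform J x y = 0) -> x = 0.

Section Space.
Variables (F : finFieldType) (N : nat) (J U : 'M[F]_N) (e : nat).
Hypothesis H : symp J U e.
Implicit Types (p q : {poly F}) (v w x y : 'cV[F]_N) (W : {vspace 'cV[F]_N}).
Local Notation bform := (bform J).
Local Notation act p v := (poly_act U p *m v).
Local Notation star := (star e).

Lemma bform_skew v w : bform v w = - bform w v.
Proof. by apply: bformC; case: H. Qed.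

Lemma bform_U v w : bform (U *m v) (U *m w) = bform v w.
Proof. by case: H => _ _ UJ _; rewrite /bform trmx_mul -{2}UJ !mulmxA. Qed.

Lemma expU k : U ^+ (e.+1 * k) = 1%:M.
Proof. by case: H => _ _ _ Ue; rewrite exprM Ue; apply: expr1n. Qed.

Lemma actUU a b v : U ^+ a *m (U ^+ b *m v) = U ^+ (a + b) *m v.
Proof. by rewrite mulmxA exprD. Qed.

Lemma bform_act p v w : bform (act p v) w = bform v (act (star p) w).
Proof.
have Uk k x y : bform (U ^+ k *m x) y = bform x (U ^+ (e * k) *m y).
  have Uf x' y' : bform (U ^+ k *m x') (U ^+ k *m y') = bform x' y'.
    elim: k => [|k IHk]; first by rewrite !mul1mx.
    by rewrite exprS -!mulmxA bform_U.
  rewrite -[RHS]Uf; congr (bform _ _).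
  by rewrite actUU -mulSn expU mul1mx.
rewrite -[p]coefK poly_def !linear_sum /= mulmx_suml bform_suml mulmx_suml linear_sum.
apply: eq_bigr => i _; rewrite !linearZ /= starXn !poly_actXn -!scalemxAl.
by rewrite bformZl linearZ /= Uk.
Qed.

Lemma act_cyclo p v : cyclo F e %| p -> act p v = 0.
Proof.
case/dvdpP => q ->; rewrite poly_actM /cyclo linearB /= poly_actXn poly_act1.
by case: H => _ _ _ ->; rewrite subrr mulmx0 mul0mx.
Qed.

Lemma act_eqmod p q v : cyclo F e %| p - q -> act p v = act q v.
Proof. by move/(act_cyclo v)/eqP; rewrite linearB mulmxBl subr_eq0 => /eqP. Qed.

Lemma act_starK p v : act (star (star p)) v = act p v.
Proof. exact/act_eqmod/starK. Qed.

Lemma bform_actr p v w : bform v (act p w) = bform (act (star p) v) w.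
Proof. by rewrite bform_act act_starK. Qed.

Lemma stable_act W p x : stable U W -> x \in W -> act p x \in W.
Proof.
move=> sW; elim/poly_ind: p x => [|p c IHp] x xW; first by rewrite linear0 mul0mx mem0v.
rewrite linearD /= poly_actM poly_actX poly_actC mulmxDl -mulmxA mul_scalar_mx.
by rewrite memvD ?memvZ ?IHp // sW.
Qed.

Definition pairing W : 'Hom('cV[F]_N, 'cV[F]_(\dim W)) :=
  linfun (mulmx ((\matrix_(i, j) (vbasis W)`_j i 0 : 'M_(N, \dim W))^T *m J)).
(** Encoded as the kernel of the pairing with a basis of W, so that its
    dimension is bounded below by rank-nullity. *)
Definition perp W : {vspace 'cV[F]_N} := lker (pairing W).

Lemma mem_perp W x : reflect (forall y, y \in W -> bform y x = 0) (x \in perp W).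
Proof.
have colE (j : 'I_(\dim W)) : (row j (\matrix_(i, j) (vbasis W)`_j i 0 : 'M_(N, \dim W))^T)
     = ((vbasis W)`_j)^T.
  by apply/rowP => i; rewrite !mxE.
rewrite memv_ker lfunE /=; apply: (iffP eqP) => [E y yW|E]; last first.
  apply/colP => j; rewrite [RHS]mxE.
  have <- := E (vbasis W)`_j; last by apply: vbasis_mem; rewrite mem_nth // size_tuple.
  by rewrite /bform -colE -!row_mul !mxE.
rewrite (coord_vbasis yW) bform_suml big1 // => j _; rewrite bformZl.
suff -> : bform (vbasis W)`_j x = 0 by rewrite mulr0.
by move/colP/(_ j): E; rewrite /bform -colE -!row_mul !mxE.
Qed.

Lemma dim_perp W : (N <= \dim (perp W) + \dim W)%N.
Proof.
have := limg_ker_dim (pairing W) fullv; rewrite capfv dimvf /dim /= muln1 => E.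
rewrite -[X in (X <= _)%N]E leq_add2l.
by apply: leq_trans (dimvS (subvf _)) _; rewrite dimvf /dim /= muln1.
Qed.

Lemma nondeg_cap W : nondeg J W -> (W :&: perp W = 0)%VS.
Proof.
move=> nW; apply/eqP; rewrite -subv0; apply/subvP => x.
rewrite memv_cap memv0 => /andP[xW /mem_perp xp]; apply/eqP/nW => // y yW.
by rewrite bform_skew xp // oppr0.
Qed.

Lemma nondeg_split W1 : nondeg J W1 -> (W1 + perp W1 = fullv)%VS.
Proof.
move=> nW; apply/eqP; rewrite eqEdim subvf /= dimv_disjoint_sum ?nondeg_cap //.
by rewrite dimvf /dim /= muln1 addnC dim_perp.
Qed.

Lemma orth_split W W1 : nondeg J W -> nondeg J W1 -> (W1 <= W)%VS ->
  [/\ W = (W1 + (W :&: perp W1))%VS, nondeg J (W :&: perp W1) &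
     forall x y, x \in W1 -> y \in (W :&: perp W1)%VS -> bform x y = 0].
Proof.
move=> nW nW1 sW.
have o x y : x \in W1 -> y \in (W :&: perp W1)%VS -> bform x y = 0.
  by move=> xW; rewrite memv_cap => /andP[_ /mem_perp]; apply.
have E : W = (W1 + (W :&: perp W1))%VS.
  by rewrite [(W :&: _)%VS]capvC vspace_modl // nondeg_split // capfv.
split=> // x xW2 x0; apply: nW; first by move: xW2; rewrite memv_cap => /andP[].
move=> y; rewrite E => /memv_addP[y1 y1W [y2 y2W ->]].
by rewrite bformDr (x0 y2) // addr0 bform_skew o // oppr0.
Qed.

Lemma stable_perp W : stable U W -> stable U (perp W).
Proof.
move=> sW x /mem_perp xp; apply/mem_perp => y yW.
by rewrite -[U in U *m x](poly_actX U) bform_actr xp // stable_act.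
Qed.

Lemma stable_cap W1 W2 : stable U W1 -> stable U W2 -> stable U (W1 :&: W2).
Proof. by move=> s1 s2 x; rewrite !memv_cap => /andP[/s1-> /s2->]. Qed.

Definition cycl v : {vspace 'cV[F]_N} := <<[seq U ^+ i *m v | i <- iota 0 e.+1]>>%VS.

Lemma mem_cycl v x : x \in cycl v <-> exists p, x = act p v.
Proof.
split=> [|[p ->]].
  set L := [seq U ^+ i *m v | i <- iota 0 e.+1]; pose X := in_tuple L.
  move/(coord_span (X := X)) ->.
  exists (\sum_i coord X i x *: 'X^i); rewrite linear_sum mulmx_suml.
  apply: eq_bigr => i _; rewrite linearZ /= -scalemxAl poly_actXn.
  have iE : (i < e.+1)%N by rewrite -[X in (_ < X)%N](size_iota 0) -(size_map (fun i => U ^+ i *m v)).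
  by rewrite (nth_map 0%N) ?size_iota // nth_iota.
rewrite /poly_act mulmx_suml; apply: memv_suml => i _; rewrite -scalemxAl memvZ //.
apply: memv_span; apply/mapP; exists (i %% e.+1)%N.
  by rewrite mem_iota /= ltn_mod.
by rewrite {1}(divn_eq i e.+1) exprD mulnC expU; congr (_ *m _); apply: mul1mx.
Qed.

Lemma cycl_id v : v \in cycl v.
Proof. by apply/mem_cycl; exists 1; rewrite poly_act1 mul1mx. Qed.

Lemma stable_cycl v : stable U (cycl v).
Proof.
move=> x /mem_cycl[p ->]; apply/mem_cycl; exists ('X * p).
by rewrite poly_actM poly_actX mulmxA.
Qed.

Lemma cycl_sub v W : stable U W -> v \in W -> (cycl v <= W)%VS.
Proof. by move=> sW vW; apply/subvP => x /mem_cycl[p ->]; apply: stable_act. Qed.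

End Space.

(** * Finding nondegenerate blocks *)

Notation pact U p v := (poly_act U p *m v).

Section Blocks.
Variables (F : finFieldType) (N : nat) (J U : 'M[F]_N).
Implicit Types (f : {poly F}) (v w : 'cV[F]_N) (W : {vspace 'cV[F]_N}).

(** The last condition makes the form on W = F[t]/(h) nondegenerate: the kernel
    of the functional p |-> Q(p v, v) contains no nonzero ideal of F[t]/(h). *)
Definition cyc_block W (h : {poly F}) v : Prop :=
  [/\ forall x, x \in W <-> exists p, x = pact U p v, pact U h v = 0
    & forall p, (forall y, bform J (pact U (p * y) v) v = 0) -> h %| p].

(** W is the sum of two totally isotropic copies of F[t]/(h), generated by v
    and w and put in duality by the form. *)
Definition hyp_block W (h : {poly F}) v w : Prop :=
  [/\ forall x, x \in W <-> exists p y, x = pact U p v + pact U y w,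
      pact U h v = 0 /\ pact U h w = 0,
      (forall p, bform J (pact U p v) v = 0) /\ (forall p, bform J (pact U p w) w = 0)
    & forall p, (forall y, bform J (pact U (p * y) v) w = 0) -> h %| p].

(** The functional on F[t] that encodes the form between the cyclic modules of
    v and w. *)
Definition funct v w (p : {poly F}) : F := bform J (pact U p v) w.
Lemma funct_is_linear v w : linear_for *%R (funct v w).
Proof.
by move=> a p q; rewrite /funct linearP /= mulmxDl -scalemxAl bformDl bformZl.
Qed.
HB.instance Definition _ v w :=
  GRing.isLinear.Build F {poly F} F *%R (funct v w) (funct_is_linear v w).
Lemma functE v w p : funct v w p = bform J (pact U p v) w. Proof. by []. Qed.
End Blocks.

Section Steps.
Variables (F : finFieldType) (N : nat) (J U : 'M[F]_N) (e : nat).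
Hypothesis (oF : odd #|F|) (H : symp J U e).
Implicit Types (p q : {poly F}) (v w : 'cV[F]_N) (W : {vspace 'cV[F]_N}).
Local Notation bform := (bform J).
Local Notation pact p v := (pact U p v).
Local Notation star := (star e).

Lemma skew_funct v p : bform (pact (star p) v) v = - bform (pact p v) v.
Proof. by rewrite (bform_act H) (act_starK H) (bform_skew H). Qed.

Lemma bform_actA p q v w : bform (pact p v) (pact q w) = bform (pact (p * star q) v) w.
Proof. by rewrite (bform_actr H) mulmxA -poly_actM mulrC. Qed.

(** The polynomials p with Q(p y v, v) = 0 for all y form a star-stable ideal
    containing f^r, and f^(r-1) is not one of them. *)
Lemma nondeg_gen f r v x : is_Phi_s f -> (0 < r)%N -> pact (f ^+ r) v = 0 ->
  bform (pact (f ^+ r.-1 * x) v) v != 0 ->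
  forall p, (forall y, bform (pact (p * y) v) v = 0) -> f ^+ r %| p.
Proof.
move=> fP r0 fv fx p Ip; apply: contraNT fx => nfp; apply/eqP.
pose I p := forall y, bform (pact (p * y) v) v = 0.
apply: (@Phi_s_ideal _ f e r I _ _ _ _ _ _ _ p) => //.
- by move=> y; rewrite (act_cyclo H) ?bform0l // dvdp_mulr.
- by move=> a b Ia Ib y; rewrite mulrDl linearD /= mulmxDl bformDl Ia Ib addr0.
- by move=> a b Ia y; rewrite -mulrA mulrCA Ia.
- move=> a Ia y; have := Ia (star y) => /eqP; rewrite -oppr_eq0 -skew_funct starM => /eqP <-.
  congr (bform _ _); apply: (act_eqmod H).
  by rewrite -mulrBr dvdp_mull // -opprB dvdpNr starK.
- by move=> y; rewrite mulrC poly_actM -mulmxA fv mulmx0 bform0l.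
Qed.

Lemma cyc_block_cycl h v : pact h v = 0 ->
  (forall p, (forall y, bform (pact (p * y) v) v = 0) -> h %| p) ->
  cyc_block J U (cycl U e v) h v.
Proof. by move=> hv hp; split=> // x; apply: (mem_cycl H). Qed.

Lemma cyc_block_nondeg W h v : cyc_block J U W h v -> nondeg J W.
Proof.
case=> WE hv hp x /WE[p ->] px.
suff : h %| p by move/dvdp_act; apply.
apply: hp => y; have := px (pact (star y) v); rewrite bform_actA => <-; last first.
  by apply/WE; exists (star y).
by congr (bform _ _); apply: (act_eqmod H); rewrite -mulrBr dvdp_mull // -opprB dvdpNr starK.
Qed.

Lemma cyc_block_stable W h v : cyc_block J U W h v -> stable U W.
Proof.
case=> WE _ _ x /WE[p ->]; apply/WE; exists ('X * p).
by rewrite poly_actM poly_actX mulmxA.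
Qed.

Lemma cyc_block_ann W h v p : cyc_block J U W h v -> pact p v = 0 <-> h %| p.
Proof.
case=> _ hv hp; split=> [pv|/dvdp_act]; last exact.
by apply: hp => y; rewrite mulrC poly_actM -mulmxA pv mulmx0 bform0l.
Qed.

(** Pairing with the copy of w detects the v-component p; for the w-component
    q, pairing with the copy of v detects star q. *)
Lemma hyp_block_nondeg W h v w : h %| star h -> hyp_block J U W h v w -> nondeg J W.
Proof.
move=> hs [WE [hv hw] [vv ww] hp] x /WE[p [q ->]] px.
have Wv a : pact a v \in W by apply/WE; exists a, 0; rewrite linear0 mul0mx addr0.
have Ww a : pact a w \in W by apply/WE; exists 0, a; rewrite linear0 mul0mx add0r.
have /dvdp_act -> // : h %| p.
  apply: hp => y; have := px _ (Ww (star y)).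
  rewrite bformDl !bform_actA ww addr0 => <-.
  by congr (bform _ _); apply: (act_eqmod H); rewrite -mulrBr dvdp_mull // -opprB dvdpNr starK.
have hsq : h %| star q.
  apply: hp => y; have := px _ (Wv y); rewrite bformDl bform_actA vv add0r.
  by rewrite (bform_skew H) bform_actA mulrC => /eqP; rewrite oppr_eq0 => /eqP.
have /dvdp_act -> // : h %| q; last by rewrite addr0.
apply: hp => y; have /dvdpP[z zE] := hsq.
have : pact (star (star q)) v = 0.
  rewrite zE starM; apply: (@dvdp_act _ _ _ h) => //; exact: dvdp_mull.
by rewrite (act_starK H) mulrC poly_actM -mulmxA => ->; rewrite mulmx0 bform0l.
Qed.

Section InW.
Variables (W : {vspace 'cV[F]_N}) (f : {poly F}) (r : nat).
Hypotheses (nW : nondeg J W) (sW : stable U W) (fP : is_Phi_s f) (r0 : (0 < r)%N).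
Hypothesis fW : forall x, x \in W -> pact (f ^+ r) x = 0.
Hypothesis f'W : exists2 x, x \in W & pact (f ^+ r.-1) x != 0.

Lemma unit_act_inj k (x : 'cV_N) : pact 'X^k x = 0 -> x = 0.
Proof.
move=> E; have := act_cyclo H x (cyclo_dvd F e k).
rewrite linearB /= mulmxBl poly_act1 mul1mx mulSn exprD mulrC poly_actM -mulmxA E mulmx0 sub0r => /eqP.
by rewrite oppr_eq0 => /eqP.
Qed.

(** On f^(r-1) W the variable t acts as the scalar c, where the adjoint t^-1 -
    c of t - c is -c t^-1 (t - c), that is -(t - c) on the socle. Consequently
    the form Q(f^(r-1) v, w) is symmetric for r even and alternating for r odd.
    *)
Lemma star_socle c v : c ^+ 2 = 1 -> f = 'X - c%:P -> v \in W ->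
  pact (star (f ^+ r.-1)) v = (-1) ^+ r.-1 *: pact (f ^+ r.-1) v.
Proof.
move=> c2 fE vW; apply/eqP; rewrite -subr_eq0; apply/eqP.
apply: (@unit_act_inj r.-1); rewrite mulmxBr mulmxA -poly_actM.
have -> : pact ('X^(r.-1) * star (f ^+ r.-1)) v = (- c) ^+ r.-1 *: pact (f ^+ r.-1) v.
  rewrite scalemxAl -linearZ /=; apply: (act_eqmod H).
  rewrite starXp -exprMn -mul_polyC polyC_exp -exprMn.
  rewrite subrXX dvdp_mulr // fE linearB /= starX starC mulrBr -exprS polyCN.
  have -> : 'X^(e.+1) - 'X * c%:P - - c%:P * ('X - c%:P) = cyclo F e - (c ^+ 2 - 1)%:P.
    by rewrite /cyclo polyCB expr2 polyCM; ring.
  by rewrite c2 subrr subr0.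
have XA : pact 'X (pact (f ^+ r.-1) v) = c *: pact (f ^+ r.-1) v.
  apply/eqP; rewrite -subr_eq0 scalemxAl -linearZ /= mulmxA -poly_actM -mulmxBl -linearB /=.
  by rewrite -mul_polyC -mulrBl -fE -exprS prednK // fW.
have XnA a : pact 'X^a (pact (f ^+ r.-1) v) = c ^+ a *: pact (f ^+ r.-1) v.
  elim: a => [|a IHa]; first by rewrite poly_act1 mul1mx scale1r.
  by rewrite !exprSr poly_actM -mulmxA XA -scalemxAr IHa scalerA mulrC.
by rewrite -scalemxAr XnA scalerA -exprNn subrr.
Qed.

(** If the values at x = 1 and x = X all vanish, polarisation makes f^(r-1) * x
    equal to its adjoint on W. For f prime to X^2 - 1, combining the two
    equalities shows that f^(r-1) * (X^2 - 1) kills W; for f = t - 1 or t + 1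
    and r even, star_socle gives 2 f^(r-1) = 0 on W. Either way f^(r-1) would
    kill W. *)
Lemma cyc_exists : (forall c : F, c ^+ 2 = 1 -> f = 'X - c%:P -> ~~ odd r) ->
  exists v x, v \in W /\ bform (pact (f ^+ r.-1 * x) v) v != 0.
Proof.
move=> ev.
case: (boolP [exists v, (v \in W) && ((bform (pact (f ^+ r.-1 * 1) v) v != 0)
                               || (bform (pact (f ^+ r.-1 * 'X) v) v != 0))]).
  by case/existsP => v /andP[vW /orP[]]; [exists v, 1|exists v, 'X].
rewrite negb_exists => /forallP Z.
(* Skew-symmetry turns the sum of the two cross terms of Q(p v, v) into the
   form of p - star p. *)
have polar x : x \in [:: 1; 'X] -> forall v, v \in W ->
    pact (f ^+ r.-1 * x - star (f ^+ r.-1 * x)) v = 0.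
  move=> x1X v vW; set p := f ^+ r.-1 * x.
  have Zp u : u \in W -> bform (pact p u) u = 0.
    move=> uW; have := Z u; rewrite uW /= negb_or !negbK => /andP[/eqP Z1 /eqP ZX].
    by move: x1X; rewrite !inE => /orP[] /eqP xE; rewrite /p xE.
  apply: nW; first exact: stable_act.
  move=> w wW; rewrite linearB mulmxBl bformDl bformNl (bform_act H (star p)) (act_starK H).
  rewrite [bform v _](bform_skew H) opprK.
  have := Zp _ (memvD vW wW); rewrite mulmxDr bformDl !bformDr !Zp //.
  by rewrite add0r addr0.
have z1 := polar 1; have zX := polar 'X; rewrite !inE !eqxx ?orbT in z1 zX.
have {}z1 := z1 isT; have {}zX := zX isT.
have kills : exists2 p, (forall v, v \in W -> pact (f ^+ r.-1 * p) v = 0) & coprimep f p.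
  case: (boolP ((f == 'X - 1%:P) || (f == 'X - (-1)%:P))) => fu; last first.
    exists ('X^2 - 1); last first.
      apply: Phi_s_coprime_sqr1 => // -[c /sqr1_cases[] -> fE];
        by move: fu; rewrite fE eqxx ?orbT.
    move=> v vW.
    have -> : f ^+ r.-1 * ('X^2 - 1) = 'X * (f ^+ r.-1 * 'X - star (f ^+ r.-1 * 'X))
       + star (f ^+ r.-1) * cyclo F e - (f ^+ r.-1 * 1 - star (f ^+ r.-1 * 1)).
      by rewrite !starM star1 starX /cyclo ['X^(e.+1)]exprS; ring.
    rewrite linearB linearD /= mulmxBl mulmxDl z1 // subr0 poly_actM -mulmxA zX // mulmx0 add0r.
    by rewrite (act_cyclo H) // dvdp_mull.
  have [c c2 fE] : exists2 c : F, c ^+ 2 = 1 & f = 'X - c%:P.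
    case/orP: fu => /eqP ->; first by exists 1; rewrite ?expr1n.
    by exists (-1); rewrite ?sqrrN ?expr1n.
  exists 2%:R%:P.
    move=> v vW; rewrite mulrC mul_polyC linearZ /= -scalemxAl.
    have := z1 v vW; rewrite !mulr1 linearB mulmxBl (star_socle c2 fE) //.
    have := ev c c2 fE; rewrite -{1}(prednK r0) /= negbK => or.
    by rewrite -signr_odd or expr1 scaleN1r opprK -mulr2n scaler_nat.
  by rewrite -alg_polyC coprimepZr ?coprimep1 // two_neq0.
have [p pW cfp] := kills; have [x xW] := f'W; case/eqP.
apply: (@coprimep_act _ _ U _ _ _ cfp); rewrite mulmxA.
  by rewrite -poly_actM -exprS prednK // fW.
by rewrite -poly_actM mulrC pW.
Qed.

(** Start from v and w with Q(f^(r-1) v, w) nonzero; this condition makes Q(p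
    v, w) a nondegenerate functional psi of p. As r is odd, Q(p v, v) vanishes
    on the ideal (f^(r-1)). If it vanishes on (f^(m+1)), write -Q(p v, v) / 2
    as psi (p * u); then v + (star u) w cancels it up to a term in u * star u,
    which is divisible by a high power of f, and the new functional vanishes on
    (f^m). Once v is isotropic, a single such correction, w + u v, makes w
    isotropic. *)
Lemma hyp_exists c : c ^+ 2 = 1 -> f = 'X - c%:P -> odd r ->
  exists v w, [/\ v \in W, w \in W & hyp_block J U (cycl U e v + cycl U e w)%VS (f ^+ r) v w].
Proof.
move=> c2 fE ro; have two := two_neq0 oF.
have fi : irreducible_poly f by rewrite fE; apply: irredp_XsubC.
have hm : f ^+ r \is monic by rewrite monic_exp // Phi_s_monic.
have [w [v0 [wW v0W v0w]]] : exists w v, [/\ w \in W, v \in W & bform (pact (f ^+ r.-1) v) w != 0].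
  have [x xW fx] := f'W.
  case: (boolP [exists w, (w \in W) && (bform (pact (f ^+ r.-1) x) w != 0)]).
    by case/existsP => w /andP[wW xw]; exists w, x.
  rewrite negb_exists => /forallP Z; case/eqP: fx; apply: nW; first exact: stable_act.
  by move=> y yW; have := Z y; rewrite yW /= negbK => /eqP.
have hv v x : v \in W -> pact (x * f ^+ r) v = 0.
  by move=> vW; rewrite poly_actM -mulmxA fW // mulmx0.
have psi_nd v : v \in W -> bform (pact (f ^+ r.-1) v) w != 0 ->
    forall p, (forall y, bform (pact (p * y) v) w = 0) -> f ^+ r %| p.
  move=> vW vw p pv; apply: contraNT vw => /(irreducible_Bezout fi)[a [b ->]].
  by rewrite linearD mulmxDl hv // addr0 mulrC pv.
have he : f ^+ r %| cyclo F e.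
  by apply: psi_nd v0W v0w _ _ => y; rewrite (act_cyclo H) ?bform0l // dvdp_mulr.
have hs k x : (k <= r)%N -> f ^+ k %| x -> f ^+ k %| star x.
  move=> kr /dvdpP[y ->]; rewrite starM starXp; apply: dvdp_mull; apply: dvdp_exp2r.
  apply: star_dual_dvd; rewrite ?Phi_s_monic ?Phi_s_coef0 ?Phi_s_dual //.
  by apply: dvdp_trans he; rewrite -(prednK r0) exprS dvdp_mulr.
have sK p v : pact (star (star p)) v = pact p v by apply: act_starK H _ _.
(* For r odd the form Q(f^(r-1) v, w) is alternating. *)
have socle v x : v \in W -> bform (pact (f ^+ r.-1 * x) v) v = 0.
  move=> vW; have Ev : bform (pact (f ^+ r.-1) v) v = 0.
    have := bform_act H (f ^+ r.-1) v v; rewrite (star_socle c2 fE) //.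
    have := ro; rewrite -{1}(prednK r0) /= => er.
    rewrite -signr_odd (negPf er) scale1r [bform v _](bform_skew H) => /eqP.
    by rewrite -subr_eq0 opprK -mulr2n -mulr_natl mulf_eq0 (negPf two) => /eqP.
  have /dvdpP[y yE] : f %| x - (x.[c])%:P by rewrite fE dvdp_XsubCl rootE !hornerE subrr.
  have -> : x = y * f + (x.[c])%:P by rewrite -yE subrK.
  rewrite mulrDr linearD mulmxDl mulrCA -exprSr prednK // hv // add0r.
  by rewrite mulrC mul_polyC linearZ /= -scalemxAl bformZl Ev mulr0.
have improve m : (m < r)%N -> forall v, v \in W -> bform (pact (f ^+ r.-1) v) w != 0 ->
    (forall x, bform (pact (f ^+ m * x) v) v = 0) ->
    exists v', [/\ v' \in W, bform (pact (f ^+ r.-1) v') w != 0 & forall x, bform (pact x v') v' = 0].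
  elim: m => [|m IHm] mr v vW vw vm.
    by exists v; split=> // x; have := vm x; rewrite expr0 mul1r.
  have := @functional_rep F (f ^+ r) hm (funct J U v w) (funct J U v (- (2%:R^-1) *: v)).
  case=> [p|p|p ph|u uE].
  - by rewrite /= functE hv // bform0l.
  - by rewrite /= functE hv // bform0l.
  - by apply: psi_nd vW vw _ _ => y; have := ph y; rewrite /= functE.
  have {}uE x : bform (pact (x * u) v) w = - (2%:R^-1) * bform (pact x v) v.
    by rewrite -[LHS](uE x) /= functE bformZr.
  pose y := star u; pose v' := v + pact y w.
  have fu : f ^+ (r - m.+1) %| u.
    have : f ^+ r %| f ^+ m.+1 * u.
      apply: psi_nd vW vw _ _ => x; rewrite mulrAC uE vm mulr0 //.
    have -> : f ^+ r = f ^+ m.+1 * f ^+ (r - m.+1) by rewrite -exprD subnKC // ltnW.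
    by rewrite dvdp_mul2l // expf_neq0 // irredp_neq0.
  have fy : f ^+ (r - m.+1) %| y by apply: hs; rewrite ?leq_subr.
  have fsy : f ^+ (r - m.+1) %| star y by apply: hs; rewrite ?leq_subr.
  (* The terms linear in y cancel Q(x v, v) by the choice of u. *)
  have v'E x : bform (pact x v') v' = bform (pact (x * y * star y) w) w.
    rewrite /v' mulmxDr bformDl !bformDr [pact x (pact y w)]mulmxA -poly_actM.
    rewrite !bform_actA.
    have -> : bform (pact (x * star y) v) w = - (2%:R^-1) * bform (pact x v) v.
      by rewrite -uE; congr (bform _ _); rewrite !poly_actM -!mulmxA sK.
    rewrite [bform (pact (x * y) w) v](bform_skew H) (bform_actr H) starM.
    have -> : bform (pact (star x * star y) v) w = 2%:R^-1 * bform (pact x v) v.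
      rewrite poly_actM -mulmxA sK mulmxA -poly_actM uE (bform_act H) sK.
      by rewrite (bform_skew H) mulNr mulrN opprK.
    by field.
  have v'W : v' \in W by rewrite memvD // stable_act.
  have v'w : bform (pact (f ^+ r.-1) v') w != 0.
    rewrite /v' mulmxDr bformDl mulmxA -poly_actM.
    have /dvdpP[z ->] : f %| y.
      by apply: dvdp_trans fy; rewrite -{1}[f]expr1 dvdp_exp2l // subn_gt0.
    by rewrite mulrCA -exprSr prednK // hv // bform0l addr0.
  apply: (IHm (ltnW mr) v') => // x; rewrite v'E.
  have /dvdpP[z zE] : f ^+ r %| f ^+ m * x * y * star y.
    apply: (@dvdp_trans _ (f ^+ (m + (r - m.+1) + (r - m.+1)))).
      by apply: dvdp_exp2l; clear -mr; lia.
    by rewrite !exprD dvdp_mul // dvdp_mul // dvdp_mulr.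
  by rewrite zE hv // bform0l.
have [v [vW vw vv]] : exists v, [/\ v \in W, bform (pact (f ^+ r.-1) v) w != 0 & forall x, bform (pact x v) v = 0].
  by apply: (improve r.-1 _ v0 v0W v0w) => [|x]; [rewrite prednK|apply: socle].
have := @functional_rep F (f ^+ r) hm (funct J U v w) (funct J U w (- (2%:R^-1) *: w)).
case=> [p|p|p ph|u uE].
- by rewrite /= functE hv // bform0l.
- by rewrite /= functE hv // bform0l.
- by apply: psi_nd vW vw _ _ => y; have := ph y; rewrite /= functE.
have {}uE x : bform (pact (x * u) v) w = - (2%:R^-1) * bform (pact x w) w.
  by rewrite -[LHS](uE x) /= functE bformZr.
pose w' := w + pact u v.
have w'W : w' \in W by rewrite memvD // stable_act.
have vw' x : bform (pact x v) w' = bform (pact x v) w.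
  by rewrite /w' bformDr bform_actA vv addr0.
exists v, w'; split=> //; split.
- move=> x; split=> [/memv_addP[a /(mem_cycl H)[p ->] [b /(mem_cycl H)[q ->] ->]]|[p [q ->]]].
    by exists p, q.
  by apply: memv_add; apply/(mem_cycl H); [exists p|exists q].
- by rewrite !fW.
- split=> // x; rewrite {1}/w' mulmxDr bformDl mulmxA -poly_actM vw' uE.
  rewrite /w' bformDr bform_actA.
  have -> : bform (pact (x * star u) w) v = 2%:R^-1 * - bform (pact x w) w.
    rewrite (bform_skew H) (bform_actr H) starM poly_actM -mulmxA sK mulmxA -poly_actM uE.
    by rewrite (bform_act H) sK [bform w _](bform_skew H) !mulNr !mulrN !opprK.
  by field.
- by move=> p pw; apply: psi_nd vW vw _ _ => y; rewrite -vw'.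
Qed.

End InW.
End Steps.

(** * Squares, and orthogonal decompositions into blocks *)

Section Squares.
Variable F : finFieldType.
Hypothesis oF : odd #|F|.

Definition squares : {set F} := [set x ^+ 2 | x : F].

Lemma card_squares : (#|F| < 2 * #|squares|)%N.
Proof.
rewrite ltn_neqAle; apply/andP; split.
  by apply: contraTneq oF => ->; rewrite oddM.
rewrite -[X in (X <= _)%N]sum1_card (partition_big (fun x => x ^+ 2) (mem squares)) /=; last first.
  by move=> x _; apply: imset_f.
rewrite mulnC -sum_nat_const; apply: leq_sum => _ /imsetP[x _ ->].
rewrite sum1_card; apply: leq_trans (_ : #|[set x; - x]| <= 2)%N; last by rewrite cards2; case: eqP.
apply: subset_leq_card; apply/subsetP => y; rewrite !inE unfold_in /=.
by rewrite -eqf_sqr.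
Qed.

(** Pigeonhole: a * squares and 1 - b * squares have more than #|F| elements
    together, so they meet. *)
Lemma binary_form (a b : F) : a != 0 -> b != 0 -> exists x y, a * x ^+ 2 + b * y ^+ 2 = 1.
Proof.
move=> a0 b0; pose A := [set a * z | z in squares]; pose B := [set 1 - b * z | z in squares].
have cA : #|A| = #|squares| by apply: card_imset; apply: mulfI.
have cB : #|B| = #|squares|.
  by apply: card_imset => u v /(addrI 1) /oppr_inj /(mulfI b0).
have : A :&: B != set0.
  apply: contraTneq card_squares => AB; rewrite -leqNgt mul2n -addnn -{1}cA -cB.
  by rewrite -cardsUI AB cards0 addn0 max_card.
case/set0Pn => z; rewrite inE => /andP[/imsetP[_ /imsetP[x _ ->] ->]].
by case/imsetP => _ /imsetP[y _ ->] E; exists x, y; rewrite E subrK.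
Qed.

Lemma nonzero_squareP (x : F) : reflect (exists2 y, y != 0 & x = y ^+ 2) (nonzero_square x).
Proof.
apply: (iffP existsP) => [[y /andP[y0 /eqP ->]]|[y y0 ->]]; exists y => //.
by rewrite y0 eqxx.
Qed.

Lemma nonzero_squareM (x y : F) : nonzero_square x -> nonzero_square (x * y) = nonzero_square y.
Proof.
case/nonzero_squareP => z z0 ->; apply/nonzero_squareP/nonzero_squareP => -[t t0 E].
  exists (t / z); first by rewrite mulf_neq0 ?invr_eq0.
  by rewrite expr_div_n -E [_ * y]mulrC mulfK // expf_neq0.
by exists (z * t); rewrite ?mulf_neq0 // exprMn E.
Qed.

(** The nonzero squares have index 2. For a nonsquare y, the sets y * squares
    and squares meet only in 0, so by counting they cover F. *)
Lemma square_ratio (x y : F) : x != 0 -> y != 0 -> nonzero_square x = nonzero_square y ->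
  exists2 z, z != 0 & x = y * z ^+ 2.
Proof.
move=> x0 y0; case: (boolP (nonzero_square y)) => [/nonzero_squareP[b b0 ->]|ny] xs.
  case/nonzero_squareP: xs => a a0 ->; exists (a / b).
    by rewrite mulf_neq0 ?invr_eq0.
  by rewrite expr_div_n mulrCA mulfV ?mulr1 // expf_neq0.
pose A := [set y * z | z in squares].
have cA : #|A| = #|squares| by apply: card_imset; apply: mulfI.
have AS : A :&: squares \subset [set 0].
  apply/subsetP => z; rewrite !inE => /andP[/imsetP[_ /imsetP[s _ ->] ->]].
  case/imsetP => t _ E; apply: contraR ny => z0; apply/nonzero_squareP.
  have s0 : s != 0 by apply: contraNneq z0 => ->; rewrite expr0n mulr0.
  exists (t / s); last by rewrite expr_div_n -E mulfK // expf_neq0.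
  rewrite mulf_neq0 ?invr_eq0 //; apply: contraNneq z0 => t0.
  by rewrite E t0 expr0n.
have : A :|: squares == setT.
  rewrite eqEcard subsetT cardsT /=; have := cardsUI A squares.
  have := subset_leq_card AS; rewrite cards1 cA; have := card_squares.
  move: #|A :|: squares| #|A :&: squares| #|squares| #|F| => a b c d; lia.
move/eqP/setP/(_ x); rewrite !inE => /orP[/imsetP[_ /imsetP[z _ ->] E]|/imsetP[z _ E]].
  by exists z => //; apply: contraNneq x0 => z0; rewrite E z0 expr0n mulr0.
case/negP: (negbT xs); apply/nonzero_squareP; exists z => //.
by apply: contraNneq x0 => z0; rewrite E z0 expr0n.
Qed.

Lemma nonsquare_exists : exists2 x : F, x != 0 & ~~ nonzero_square x.
Proof.
have /set0Pn[x xS] : ~: squares != set0.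
  apply/negP => /eqP/setP S; suff : (1 : F) = -1.
    by move/eqP; rewrite -subr_eq0 opprK (negPf (two_neq0 oF)).
  have /imset_injP inj : #|[set x ^+ 2 | x in [set: F]]| == #|[set: F]|.
    rewrite cardsT -cardsT; apply/eqP/eq_card => x; rewrite !inE.
    have := S x; rewrite !inE => /negbFE/imsetP[y _ ->]; exact: imset_f.
  by apply: inj; rewrite ?inE // sqrrN.
exists x; first by apply: contraTneq xS => ->; rewrite inE negbK; apply/imsetP; exists 0; rewrite ?expr0n.
move: xS; rewrite inE; apply: contra => /nonzero_squareP[y _ ->]; exact: imset_f.
Qed.
End Squares.

Section DecDefs.
Variables (F : finFieldType).
Definition unitb (f : {poly F}) := (f == 'X - 1%:P) || (f == 'X - (-1)%:P).
Lemma unitbP f : reflect (unit_poly f) (unitb f).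
Proof.
apply: (iffP orP) => [[] /eqP ->|[c /sqr1_cases[] -> ->]]; try by [left|right].
  by exists 1; rewrite ?expr1n.
by exists (-1); rewrite ?sqrrN ?expr1n.
Qed.

(** (f, r, b): the block is F[t]/(f^r), or two copies of it for f = t - 1, t +
    1 and r odd; b is the sign of the block. By convention b is true when no
    sign is attached. *)
Definition label : eqType := ({poly F} * nat * bool)%type.
Implicit Types (l : label) (s : seq label).

Section Sp.
Variables (N : nat) (J U : 'M[F]_N).
Implicit Types (W : {vspace 'cV[F]_N}).
(** The value at the class of v of the quadratic form whose Gram determinant
    defines the signs. *)
Definition beta r v := bform J ((U - invmx U) ^+ r.-1 *m v) v.

Definition block_on W l : Prop :=
  [/\ is_Phi_s l.1.1, (0 < l.1.2)%N &
  if unitb l.1.1 then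
    if odd l.1.2 then l.2 = true /\ exists v w, hyp_block J U W (l.1.1 ^+ l.1.2) v w
    else exists2 v, cyc_block J U W (l.1.1 ^+ l.1.2) v & nonzero_square (beta l.1.2 v) = l.2
  else l.2 = true /\ exists v, cyc_block J U W (l.1.1 ^+ l.1.2) v].

Definition orth (W1 W2 : {vspace 'cV[F]_N}) :=
  forall x y, x \in W1 -> y \in W2 -> bform J x y = 0.

Fixpoint dec W s : Prop := match s with
  | [::] => W = 0%VS
  | l :: s' => exists W1 W2, [/\ W = (W1 + W2)%VS, orth W1 W2, block_on W1 l & dec W2 s']
  end.
End Sp.

(** Two blocks with nonsquare values of beta can be replaced by two with square
    values, so normal lists suffice; only for them does the list depend on the
    isometry alone. *)
Definition sign_normal s := forall f r, unitb f -> (count_mem (f, r, false) s <= 1)%N.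
End DecDefs.
Arguments label : clear implicits.

Section Dec.
Variables (F : finFieldType) (N : nat) (J U : 'M[F]_N) (e : nat).
Hypothesis (oF : odd #|F|) (H : symp J U e).
Implicit Types (p q f : {poly F}) (v w : 'cV[F]_N) (W : {vspace 'cV[F]_N}).
Implicit Types (l : label F) (s : seq (label F)).
Local Notation bform := (bform J).
Local Notation pact p v := (pact U p v).
Local Notation star := (star e).
Local Notation orth := (orth J).
Local Notation dec := (dec J U).
Local Notation block_on := (block_on J U).
Local Notation beta := (beta J U).

Lemma orthC W1 W2 : orth W1 W2 -> orth W2 W1.
Proof. by move=> o x y xW yW; rewrite (bform_skew H) o // oppr0. Qed.

Lemma nondeg_add W1 W2 : orth W1 W2 -> nondeg J W1 -> nondeg J W2 -> nondeg J (W1 + W2).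
Proof.
move=> o n1 n2 _ /memv_addP[x1 x1W [x2 x2W ->]] E.
have -> : x1 = 0.
  apply: n1 => // y yW; have := E y (subvP (addvSl _ _) _ yW).
  by rewrite bformDl (orthC o x2W yW) addr0.
rewrite add0r; apply: n2 => // y yW; have := E y (subvP (addvSr _ _) _ yW).
by rewrite bformDl o // add0r.
Qed.

Lemma nondeg_orth_cap W1 W2 : orth W1 W2 -> nondeg J W1 -> (W1 :&: W2 = 0)%VS.
Proof.
move=> o n1; apply/eqP; rewrite -subv0; apply/subvP => x; rewrite memv_cap memv0.
by case/andP => xW xW2; apply/eqP/n1 => // y yW; rewrite (orthC o).
Qed.

Lemma stable_add W1 W2 : stable U W1 -> stable U W2 -> stable U (W1 + W2).
Proof.
move=> s1 s2 _ /memv_addP[x1 x1W [x2 x2W ->]].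
by rewrite mulmxDr memv_add ?s1 ?s2.
Qed.

(** The kernel of f^k is star-stable, as f is self-dual up to a unit. *)
Lemma star_kill f k (x : 'cV_N) : is_Phi_s f -> pact (f ^+ k) x = 0 -> pact (star (f ^+ k)) x = 0.
Proof.
move=> fP fx; have f0 := Phi_s_coef0 fP.
have fk0 : (f ^+ k)`_0 != 0 by rewrite -horner_coef0 horner_exp horner_coef0 expf_neq0.
apply: (@unit_act_inj _ _ _ _ _ H (size (f ^+ k)).-1).
rewrite mulmxA -poly_actM (act_eqmod H _ (star_dual e fk0)).
by rewrite dualXp // Phi_s_dual // linearZ /= -scalemxAl fx scaler0.
Qed.

Lemma block_stable W l : block_on W l -> stable U W.
Proof.
have hyp v w h : hyp_block J U W h v w -> stable U W.
  case=> WE _ _ _ x /WE[p [y ->]]; apply/WE; exists ('X * p), ('X * y).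
  by rewrite mulmxDr !poly_actM !poly_actX !mulmxA.
case=> _ _; case: ifP => _; last by case=> _ [v /cyc_block_stable].
case: ifP => _; first by case=> _ [v [w /hyp]].
by case=> v /cyc_block_stable.
Qed.

Lemma star_hyp f k v w W : is_Phi_s f -> hyp_block J U W (f ^+ k) v w -> f ^+ k %| star (f ^+ k).
Proof.
move=> fP [_ [fv _] _ hp]; apply: hp => y.
by rewrite mulrC poly_actM -mulmxA (star_kill fP fv) mulmx0 bform0l.
Qed.

Lemma block_nondeg W l : block_on W l -> nondeg J W.
Proof.
case=> fP _; case: ifP => _; last by case=> _ [v /(cyc_block_nondeg H)].
case: ifP => _; last by case=> v /(cyc_block_nondeg H).
case=> _ [v [w hb]]; apply: (hyp_block_nondeg H _ hb); exact: star_hyp hb.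
Qed.

Lemma block_kill W l x : block_on W l -> x \in W -> pact (l.1.1 ^+ l.1.2) x = 0.
Proof.
have cy v h : cyc_block J U W h v -> x \in W -> pact h x = 0.
  by case=> WE hv _ /WE[p ->]; rewrite mulmxA poly_actMC -mulmxA hv mulmx0.
case=> _ _; case: ifP => _; last by case=> _ [v /cy].
case: ifP => _; last by case=> v /cy.
case=> _ [v [w [WE [hv hw] _ _]]] /WE[p [q ->]].
by rewrite mulmxDr !mulmxA ![poly_act U (_ ^+ _) *m _]poly_actMC -!mulmxA hv hw !mulmx0 addr0.
Qed.

(** The annihilator of a block of label (f, r, b) is exactly (f^r). *)
Lemma block_min W l p : block_on W l -> (forall x, x \in W -> pact p x = 0) ->
  l.1.1 ^+ l.1.2 %| p.
Proof.
have cy v h : cyc_block J U W h v -> (forall x, x \in W -> pact p x = 0) -> h %| p.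
  move=> cb pW; apply/(cyc_block_ann p cb)/pW; have [WE _ _] := cb.
  by apply/WE; exists 1; rewrite poly_act1 mul1mx.
case=> _ _; case: ifP => _; last by case=> _ [v /cy].
case: ifP => _; last by case=> v /cy.
case=> _ [v [w [WE _ _ hp]]] pW; apply: hp => y.
rewrite mulrC poly_actM -mulmxA pW ?mulmx0 ?bform0l //.
by apply/WE; exists 1, 0; rewrite poly_act1 mul1mx linear0 mul0mx addr0.
Qed.

Lemma dec_stable W s : dec W s -> stable U W.
Proof.
elim: s W => [|l s IHs] W /=.
  by move=> -> x; rewrite !memv0 => /eqP ->; rewrite mulmx0.
by case=> W1 [W2 [-> _ /block_stable s1 /IHs s2]]; apply: stable_add.
Qed.

Lemma dec_nondeg W s : dec W s -> nondeg J W.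
Proof.
elim: s W => [|l s IHs] W /=; first by move=> -> x; rewrite memv0 => /eqP.
by case=> W1 [W2 [-> o /block_nondeg s1 /IHs s2]]; apply: nondeg_add.
Qed.

Lemma dec_mem W s l : dec W s -> l \in s -> exists2 W', (W' <= W)%VS & block_on W' l.
Proof.
elim: s W => [|l' s IHs] W //= [W1 [W2 [-> _ b1 d2]]]; rewrite inE => /orP[/eqP ->|ls].
  by exists W1; rewrite // addvSl.
have [W' sW b'] := IHs _ d2 ls; exists W' => //.
by apply: subv_trans sW _; apply: addvSr.
Qed.

Lemma dec_min W s l p : dec W s -> l \in s -> (forall x, x \in W -> pact p x = 0) ->
  l.1.1 ^+ l.1.2 %| p.
Proof.
move=> d ls pW; have [W' /subvP sW b'] := dec_mem d ls.
by apply: block_min b' _ => x /sW; apply: pW.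
Qed.

Lemma orthS W1 W2 W1' W2' : (W1' <= W1)%VS -> (W2' <= W2)%VS -> orth W1 W2 -> orth W1' W2'.
Proof. by move=> /subvP s1 /subvP s2 o x y /s1 xW /s2; apply: o. Qed.

Lemma orthD W1 W2 W : orth W1 W -> orth W2 W -> orth (W1 + W2) W.
Proof.
move=> o1 o2 _ y /memv_addP[x1 x1W [x2 x2W ->]] yW.
by rewrite bformDl o1 // o2 // addr0.
Qed.

Lemma dec_cat W s1 s2 : dec W (s1 ++ s2) <->
  exists W1 W2, [/\ W = (W1 + W2)%VS, orth W1 W2, dec W1 s1 & dec W2 s2].
Proof.
split.
  elim: s1 W => [|l s1 IHs] W /=.
    move=> d; exists 0%VS, W; rewrite add0v; split=> // x y.
    by rewrite memv0 => /eqP ->; rewrite bform0l.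
  case=> W1 [W2 [-> o b /IHs[W3 [W4 [E o34 d3 d4]]]]].
  exists (W1 + W3)%VS, W4; split=> //; first by rewrite E addvA.
    apply: orthD => //; apply: orthS (subvv _) _ o; rewrite E; exact: addvSr.
  exists W1, W3; split=> //; apply: orthS (subvv _) _ o; rewrite E; exact: addvSl.
elim: s1 W => [|l s1 IHs] W /=.
  by case=> W1 [W2 [-> _ -> d2]]; rewrite add0v.
case=> W1 [W2 [-> o [W3 [W4 [E o34 b d4]]] d2]].
exists W3, (W4 + W2)%VS; split=> //.
- by rewrite E addvA.
- apply: orthC; apply: orthD; first exact: orthC.
  by apply: orthC; apply: orthS _ (subvv _) o; rewrite E addvSl.
apply: IHs; exists W4, W2; split=> //.
by apply: orthS _ (subvv _) o; rewrite E addvSr.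
Qed.

Lemma dec_perm W s1 s2 : perm_eq s1 s2 -> dec W s1 -> dec W s2.
Proof.
move: s1 s2; apply: (catCA_perm_ind (P := dec W)) => s1 s2 s3.
case/dec_cat => W1 [W2 [-> o1 d1 /dec_cat[W3 [W4 [E o2 d3 d4]]]]]; rewrite {}E in o1 *.
apply/dec_cat; exists W3, (W1 + W4)%VS; split=> //.
- by rewrite addvA [(W1 + W3)%VS]addvC -addvA.
- apply/orthC/orthD; last exact: orthC.
  by apply: orthS (subvv _) _ o1; apply: addvSl.
apply/dec_cat; exists W1, W4; split=> //.
by apply: orthS (subvv _) _ o1; apply: addvSr.
Qed.

Lemma sub_invE : U - invmx U = poly_act U ('X - 'X^e).
Proof.
have Uu : U \in unitmx.
  have [_ _ _ Ue] := H; case: (@mulmx1_unit _ _ U (U ^+ e)) => //.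
  by rewrite -[_ *m _]/(U * U ^+ e) -exprS.
rewrite linearB /= poly_actX poly_actXn; congr (_ - _).
have [_ _ _ Ue] := H; rewrite -[RHS](mulKmx Uu) -[U *m _]/(U * U ^+ e) -exprS Ue.
by rewrite mulmx1.
Qed.

(** On f^(r-1) v the variable acts as c, and t - t^-1 is t^-1 (t + c) f, where
    t + c acts as 2c and c * c = 1. *)
Lemma unit_skew_power c r v : c ^+ 2 = 1 -> (0 < r)%N -> pact (('X - c%:P) ^+ r) v = 0 ->
  (U - invmx U) ^+ r.-1 *m v = 2%:R ^+ r.-1 *: pact (('X - c%:P) ^+ r.-1) v.
Proof.
move=> c2 r0 fv; set f := 'X - c%:P in fv *.
rewrite sub_invE.
rewrite -poly_actXp; set A := pact (f ^+ r.-1) v.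
have XA : pact 'X A = c *: A.
  apply/eqP; rewrite -subr_eq0 scalemxAl -linearZ /= mulmxA -poly_actM -mulmxBl -linearB /=.
  by rewrite -mul_polyC -mulrBl -exprS prednK // fv.
have XnA a : pact 'X^a A = c ^+ a *: A.
  elim: a => [|a IHa]; first by rewrite poly_act1 mul1mx scale1r.
  by rewrite !exprSr poly_actM -mulmxA XA -scalemxAr IHa scalerA mulrC.
apply/eqP; rewrite -subr_eq0; apply/eqP; apply: (@unit_act_inj _ _ _ _ _ H r.-1).
rewrite mulmxBr mulmxA -poly_actM -scalemxAr XnA scalerA -exprMn.
have -> : pact (('X * ('X - 'X^e)) ^+ r.-1) v = pact (('X + c%:P) ^+ r.-1) A.
  rewrite /A mulmxA -poly_actM; apply: (act_eqmod H); rewrite -exprMn subrXX dvdp_mulr //.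
  have -> : 'X * ('X - 'X^e) - ('X + c%:P) * f = (c ^+ 2 - 1)%:P - cyclo F e.
    by rewrite /f /cyclo polyCB expr2 polyCM ['X^(e.+1)]exprS; ring.
  by rewrite c2 subrr sub0r dvdpNr.
have XcA a : pact (('X + c%:P) ^+ a) A = (2%:R * c) ^+ a *: A.
  elim: a => [|a IHa]; first by rewrite poly_act1 mul1mx scale1r.
  rewrite !exprSr poly_actM -mulmxA linearD /= mulmxDl XA poly_actC mul_scalar_mx -scalerDl.
  by rewrite -scalemxAr IHa scalerA; congr (_ *: _); rewrite exprMn; ring.
by rewrite XcA exprMn subrr.
Qed.

Lemma betaE c r v : c ^+ 2 = 1 -> (0 < r)%N -> pact (('X - c%:P) ^+ r) v = 0 ->
  beta r v = 2%:R ^+ r.-1 * bform (pact (('X - c%:P) ^+ r.-1) v) v.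
Proof. by move=> c2 r0 fv; rewrite /beta (unit_skew_power c2 r0 fv) bformZl. Qed.

(** Modulo f only the value x(c) matters in f^(r-1) x v. *)
Lemma beta_neq0 c r v x : c ^+ 2 = 1 -> (0 < r)%N -> pact (('X - c%:P) ^+ r) v = 0 ->
  bform (pact (('X - c%:P) ^+ r.-1 * x) v) v != 0 -> beta r v != 0.
Proof.
move=> c2 r0 fv; rewrite (betaE c2 r0 fv) mulf_eq0 expf_eq0 (negPf (two_neq0 oF)) andbF /=.
apply: contraNN; set f := 'X - c%:P in fv *.
have /dvdpP[y yE] : f %| x - (x.[c])%:P by rewrite dvdp_XsubCl rootE !hornerE subrr.
have -> : x = y * f + (x.[c])%:P by rewrite -yE subrK.
rewrite mulrDr linearD /= mulmxDl mulrCA -exprSr prednK // poly_actM -mulmxA fv mulmx0 add0r.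
by rewrite mulrC mul_polyC linearZ /= -scalemxAl bformZl => /eqP ->; rewrite mulr0.
Qed.

Lemma Phi_unit (c : F) : c ^+ 2 = 1 -> is_Phi_s ('X - c%:P).
Proof.
move=> c2; left; rewrite dual_Xsub //; split=> //; apply: Phi_XsubC.
by apply/eqP => c0; move: c2; rewrite c0 expr0n /= => /eqP; rewrite eq_sym oner_eq0.
Qed.

Lemma beta_gen c r v : c ^+ 2 = 1 -> (0 < r)%N -> pact (('X - c%:P) ^+ r) v = 0 ->
  beta r v != 0 ->
  forall p, (forall y, bform (pact (p * y) v) v = 0) -> ('X - c%:P) ^+ r %| p.
Proof.
move=> c2 r0 fv b0; apply: (nondeg_gen H (x := 1) (Phi_unit c2) r0 fv).
apply: contraNneq b0; rewrite mulr1 (betaE c2 r0 fv) => ->; by rewrite mulr0.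
Qed.

Lemma cyc_beta c r v W : c ^+ 2 = 1 -> (0 < r)%N -> cyc_block J U W (('X - c%:P) ^+ r) v ->
  beta r v != 0.
Proof.
move=> c2 r0 [_ fv hp]; apply/negP => /eqP b0.
have /dvdp_leq : ('X - c%:P) ^+ r %| ('X - c%:P) ^+ r.-1.
  apply: hp => y; apply/eqP/negPn/negP => /(beta_neq0 c2 r0 fv); by rewrite b0 eqxx.
rewrite expf_neq0 ?polyXsubC_eq0 // => /(_ isT); rewrite !size_exp_XsubC prednK //.
by rewrite ltnn.
Qed.

(** Removes one block; the induction of dec_primary is on the dimension of what
    remains. *)
Lemma dec_step W W1 l : stable U W -> nondeg J W -> W1 != 0%VS -> (W1 <= W)%VS -> block_on W1 l ->
  exists W2, [/\ W = (W1 + W2)%VS, orth W1 W2, stable U W2, nondeg J W2 & (\dim W2 < \dim W)%N].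
Proof.
move=> sW nW W10 sW1 b1; have s1 := block_stable b1; have n1 := block_nondeg b1.
have [E n2 o] := orth_split H nW n1 sW1.
exists (W :&: perp J W1)%VS; split=> //.
  by apply: stable_cap => //; apply: (stable_perp H).
rewrite {2}E dimv_disjoint_sum; last exact: nondeg_orth_cap o n1.
by rewrite -[X in (X < _)%N]add0n ltn_add2r lt0n dimv_eq0.
Qed.

(** Take r minimal with f^r W = 0 and split off a block of label (f, r, b).
    When a sign is attached, a generator with square beta is taken if there is
    one. If there is none, the complement contains no block (f, r, false)
    either: with its generator v3, some combination a v + b v3 would have beta
    equal to 1, because beta(v) a^2 + beta(v3) b^2 represents 1. *)
Lemma dec_primary n W f m : (\dim W <= n)%N -> stable U W -> nondeg J W -> is_Phi_s f ->
  (forall x, x \in W -> pact (f ^+ m) x = 0) ->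
  exists s, [/\ sign_normal s, dec W s & forall l, l \in s -> l.1.1 = f].
Proof.
elim: n W => [|n IHn] W dW sW nW fP fW; have [W0|W0] := eqVneq W 0%VS; try by exists [::].
  by move: dW; rewrite leqn0 dimv_eq0 (negPf W0).
pose K r := [forall x in W, pact (f ^+ r) x == 0].
have KP r : reflect (forall x, x \in W -> pact (f ^+ r) x = 0) (K r).
  by apply: (iffP forall_inP) => h x /h /eqP.
have exK : exists r, K r by exists m; apply/KP.
have [r /KP fr rmin] := find_ex_minn exK.
have r0 : (0 < r)%N.
  rewrite lt0n; apply: contraNneq W0 => r0; rewrite -subv0; apply/subvP => x /fr.
  by rewrite r0 poly_act1 mul1mx => ->; rewrite mem0v.
have f'W : exists2 x, x \in W & pact (f ^+ r.-1) x != 0.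
  have : ~~ K r.-1 by apply/negP => /rmin; rewrite leqNgt ltn_predL r0.
  by rewrite negb_forall => /existsP[x]; rewrite negb_imply => /andP[xW fx]; exists x.
have step W1 d : W1 != 0%VS -> (W1 <= W)%VS -> block_on W1 (f, r, d) ->
    (forall W2 s, W = (W1 + W2)%VS -> orth W1 W2 -> dec W2 s -> unitb f -> d = false ->
        (f, r, false) \notin s) ->
    exists s, [/\ sign_normal s, dec W s & forall l, l \in s -> l.1.1 = f].
  move=> W10 sW1 b1 hd; have [W2 [E o s2 n2 d2]] := dec_step sW nW W10 sW1 b1.
  have sW2 : (W2 <= W)%VS by rewrite E addvSr.
  have [||s [ns ds sf]] := IHn W2 _ s2 n2 fP.
  - by rewrite -ltnS (leq_trans d2).
  - by move=> x /(subvP sW2); apply: fW.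
  exists ((f, r, d) :: s); split.
  - move=> f' r' uf /=; case: eqP => [[ff rr dd]|_]; last exact: ns.
    rewrite -ff -rr (count_memPn _) //; apply: hd E o ds _ dd; by rewrite ff.
  - by exists W1, W2.
  by move=> l; rewrite inE => /orP[/eqP ->|/sf].
have cnz v : v \in W -> v != 0 -> cycl U e v != 0%VS.
  by move=> vW; apply: contraNneq => c0; rewrite -memv0 -c0 (cycl_id H).
have nz v p : bform (pact p v) v != 0 -> v != 0.
  by apply: contraNneq => ->; rewrite mulmx0 bform0l.
case: (boolP (unitb f)) => uf; last first.
  have [|v [x [vW vx]]] := cyc_exists oF H nW sW fP r0 fr f'W.
    move=> c c2 fE; move: uf; case: unitbP => // -[]; by exists c.
  apply: (step (cycl U e v) true) => //; first exact: cnz (nz _ _ vx).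
    exact: (cycl_sub H).
  split=> //=; rewrite (negPf uf); split=> //; exists v.
  by apply: (cyc_block_cycl H); [exact: fr|apply: (nondeg_gen H fP r0 (fr _ vW) vx)].
have [c c2 fE] : unit_poly f by apply/unitbP.
case: (boolP (odd r)) => ro.
  have [v [w [vW wW hb]]] := hyp_exists oF H nW sW fP r0 fr f'W c2 fE ro.
  apply: (step (cycl U e v + cycl U e w)%VS true) => //.
  - have [x xW] := f'W; apply: contraNneq => c0.
    have [_ _ _ hp] := hb; have v0 : v = 0.
      by apply/eqP; rewrite -memv0 -c0; apply: (subvP (addvSl _ _)); exact: (cycl_id H).
    have /dvdp_leq : f ^+ r %| 1 by apply: hp => y; rewrite v0 mulmx0 bform0l.
    rewrite oner_eq0 size_poly1 fE size_exp_XsubC => /(_ isT).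
    by case: (r) r0.
  - by rewrite subv_add !(cycl_sub H).
  by split=> //=; rewrite uf ro; split=> //; exists v, w.
case: (boolP [exists v in W, nonzero_square (beta r v)]) => [/exists_inP[v vW vs]|nsq].
  have b0 : beta r v != 0 by apply: contraTneq vs => ->; apply/nonzero_squareP => -[y y0 /eqP];
    rewrite eq_sym expf_eq0 (negPf y0).
  apply: (step (cycl U e v) true) => //.
  - by apply: cnz => //; apply: contraNneq b0 => ->; rewrite /beta mulmx0 bform0l.
  - exact: (cycl_sub H).
  split=> //=; rewrite uf (negPf ro); exists v => //.
  apply: (cyc_block_cycl H); first exact: fr.
  by have fv := fr _ vW; rewrite fE in fv *; apply: beta_gen.
have [|v [x [vW vx]]] := cyc_exists oF H nW sW fP r0 fr f'W.
  by move=> c' _ _; exact: ro.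
have b0 : beta r v != 0.
  by have fv := fr _ vW; rewrite fE in fv vx; apply: beta_neq0 vx.
have ns v' : v' \in W -> ~~ nonzero_square (beta r v').
  by move=> vW'; apply: contra nsq => vs; apply/exists_inP; exists v'.
apply: (step (cycl U e v) false) => //.
- exact: cnz (nz _ _ vx).
- exact: (cycl_sub H).
- split=> //=; rewrite uf (negPf ro); exists v; last exact/negbTE/ns.
  by apply: (cyc_block_cycl H); [exact: fr|apply: (nondeg_gen H fP r0 (fr _ vW) vx)].
move=> W2 s E o ds _ _; apply/negP => fs.
have [W3 sW3 [_ _ /=]] := dec_mem ds fs; rewrite uf (negPf ro) => -[v3 cb _].
have v3W : v3 \in W2.
  have [WE _ _] := cb; apply: (subvP sW3); apply/WE; exists 1.
  by rewrite poly_act1 mul1mx.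
have b3 : beta r v3 != 0 by rewrite fE in cb; apply: cyc_beta cb.
have [a [b ab]] := binary_form oF b0 b3.
have : nonzero_square (beta r (a *: v + b *: v3)).
  apply/nonzero_squareP; exists 1; rewrite ?oner_eq0 // expr1n -ab.
  have v3W' : v3 \in W by rewrite E; apply: (subvP (addvSr _ _)).
  rewrite /beta; set M := _ ^+ _.
  have Mp : exists p, M = poly_act U p.
    by exists (('X - 'X^e) ^+ r.-1); rewrite poly_actXp -sub_invE.
  have [p ->] := Mp; rewrite mulmxDr -!scalemxAr bformDl !bformDr !bformZl !bformZr.
  have cv := stable_act p (@stable_cycl _ _ _ _ _ H v) (cycl_id H v).
  rewrite (o _ v3 cv v3W) [bform (pact p v3) v](bform_skew H).
  rewrite (o v) ?(cycl_id H) ?(stable_act p (dec_stable ds)) //; ring.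
by apply/negP/ns; rewrite memvD ?memvZ // E; apply: (subvP (addvSr _ _)).
Qed.

Definition keract p : {vspace 'cV[F]_N} := lker (linfun (mulmx (poly_act U p))).

Lemma mem_keract p x : (x \in keract p) = (pact p x == 0).
Proof. by rewrite memv_ker lfunE. Qed.

Lemma stable_keract p : stable U (keract p).
Proof.
move=> x; rewrite !mem_keract => /eqP px.
have -> : U *m x = pact 'X x by rewrite poly_actX.
by rewrite mulmxA poly_actMC -mulmxA px mulmx0.
Qed.

Lemma coprime_factor (c f : {poly F}) : c != 0 -> exists m mu, coprimep f mu /\ c %| f ^+ m * mu.
Proof.
move: {2}(size c) (leqnn (size c)) => n; elim: n c => [|n IHn] c.
  by rewrite leqn0 size_poly_eq0 => /eqP ->; rewrite eqxx.
move=> sc c0; case: (boolP (coprimep f c)) => [fc|fc].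
  by exists 0%N, c; rewrite expr0 mul1r dvdpp.
have /dvdpP[c' cE] := dvdp_gcdr f c.
have [c'0 g0] : c' != 0 /\ gcdp f c != 0.
  by split; apply: contraNneq c0 => z; rewrite cE z ?mul0r ?mulr0.
have sg : (1 < size (gcdp f c))%N.
  by rewrite ltn_neqAle eq_sym fc size_poly_gt0.
have [|//|m [mu [fmu cd]]] := IHn c'.
  rewrite -ltnS; apply: leq_trans sc; have := congr1 (fun p : {poly F} => size p) cE.
  rewrite size_mul // => ->; move: sg; case: (size (gcdp f c)) => [|[|k]] // _.
  by rewrite !addnS /= ltnS leq_addr.
exists m.+1, mu; split=> //; rewrite cE mulrC exprS -mulrA dvdp_mul //.
exact: dvdp_gcdl.
Qed.

(** A nonzero polynomial of minimal degree killing some nonzero vector of W is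
    irreducible. *)
Lemma irreducible_kill W : W != 0%VS -> stable U W -> exists g v, [/\ is_Phi g, v \in W, v != 0 & pact g v = 0].
Proof.
move=> W0 sW; pose K n := [exists p : {poly_n F}, (val p != 0) &&
  [exists v in W, (v != 0) && (pact (val p) v == 0)]].
have KP n : reflect (exists p v, [/\ (size p <= n)%N, p != 0, v \in W, v != 0 & pact p v = 0]) (K n).
  apply: (iffP existsP) => [[p /andP[p0 /exists_inP[v vW /andP[v0 /eqP pv]]]]|[p [v [sp p0 vW v0 pv]]]].
    by exists (val p), v; split=> //; apply: size_npoly.
  exists (NPoly sp); rewrite /= p0; apply/exists_inP; exists v => //.
  by rewrite v0 pv eqxx.
have exK : exists n, K n.
  exists (size (char_poly U)); apply/KP; exists (char_poly U), (vpick W).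
  rewrite memv_pick vpick0 W0 char_poly_act mul0mx; split=> //.
  exact/monic_neq0/char_poly_monic.
have [n /KP[p [v [sp p0 vW v0 pv]]] nmin] := find_ex_minn exK.
have nE : size p = n.
  by apply/eqP; rewrite eqn_leq sp; apply: nmin; apply/KP; exists p, v.
have lp0 : (lead_coef p)^-1 != 0 by rewrite invr_eq0 lead_coef_eq0.
pose g := (lead_coef p)^-1 *: p.
have gv : pact g v = 0 by rewrite linearZ /= -scalemxAl pv scaler0.
have gm : g \is monic by rewrite monicE lead_coefZ mulVf // lead_coef_eq0.
exists g, v; split=> //; split=> //.
  have gp : g %= p by apply: eqp_scale.
  split.
    rewrite (eqp_size gp) ltnNge; apply/negP => /size1_polyC pC.
    move: p0 pv; rewrite pC poly_actC mul_scalar_mx polyC_eq0 => c0 /eqP.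
    by rewrite scaler_eq0 (negPf c0) (negPf v0).
  move=> q sq; rewrite (eqp_dvdr _ gp) => qp; apply: eqp_trans (_ : p %= g); last by rewrite eqp_sym.
  have /dvdpP[z zE] := qp; have [z0 q0] : z != 0 /\ q != 0.
    by split; apply: contraNneq p0 => w; rewrite zE w ?mul0r ?mulr0.
  rewrite -dvdp_size_eqp // eqn_leq dvdp_leq //= nE.
  have [qv|qv] := eqVneq (pact q v) 0.
    by apply: nmin; apply/KP; exists q, v.
  have : (n <= size z)%N.
    apply: nmin; apply/KP; exists z, (pact q v); split=> //; first exact: stable_act.
    by rewrite mulmxA -poly_actM -zE.
  rewrite -nE {1}zE size_mul //; move: sq; rewrite -size_poly_gt0 in q0.
  case: (size q) q0 => [|[|k]] // _ _; rewrite !addnS /= => /(leq_trans _).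
  by move/(_ _ (leqnn _)); rewrite -ltn_subRL subnn.
apply: contraNneq v0 => gX; apply/eqP; apply: (@unit_act_inj _ _ _ _ _ H 1).
by rewrite expr1 -gX.
Qed.

(** Split off the f-primary part, where f in Phi^s contains an irreducible
    annihilator g of some vector: with f^m * mu killing the space and mu prime
    to f, the kernels of f^m and mu are orthogonal because star (f^m) kills the
    first one. *)
Lemma dec_exists W : stable U W -> nondeg J W -> exists2 s, sign_normal s & dec W s.
Proof.
move: {2}(\dim W) (leqnn (\dim W)) => n; elim: n W => [|n IHn] W dW sW nW.
  by exists [::] => //; apply/eqP; rewrite -dimv_eq0 -leqn0.
have [W0|W0] := eqVneq W 0%VS; first by exists [::].
have [g [v [gP vW v0 gv]]] := irreducible_kill W0 sW.
pose f := if g == dual g then g else g * dual g.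
have gf : g %| f by rewrite /f; case: ifP => _; rewrite ?dvdpp ?dvdp_mulr.
have fP : is_Phi_s f.
  by rewrite /f; case: eqP => gd; [left|right; exists g].
have fv := dvdp_act gf gv.
have c0 : char_poly U != 0 by apply/monic_neq0/char_poly_monic.
have [m [mu [fmu cd]]] := coprime_factor f c0.
have kill (x : 'cV_N) : pact (f ^+ m * mu) x = 0.
  by apply: dvdp_act cd _; rewrite char_poly_act mul0mx.
have fmc : coprimep (f ^+ m) mu by apply: coprimep_expl.
have [[a b] /= ab] := Bezout_eq1_coprimepP _ _ fmc.
pose W1 := (W :&: keract (f ^+ m))%VS; pose W2 := (W :&: keract mu)%VS.
have split12 x : x = pact (b * mu) x + pact (a * f ^+ m) x.
  by rewrite -mulmxDl -linearD /= addrC ab poly_act1 mul1mx.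
have E : W = (W1 + W2)%VS.
  apply/eqP; rewrite eqEsubv; apply/andP; split; last by rewrite subv_add !capvSl.
  apply/subvP => x xW; rewrite [x]split12 memv_add // memv_cap stable_act //= mem_keract;
    rewrite mulmxA -poly_actM.
    by rewrite mulrCA poly_actM -mulmxA kill mulmx0.
  by rewrite mulrCA [mu * _]mulrC poly_actM -mulmxA kill mulmx0.
have o : orth W1 W2.
  move=> x y; rewrite !memv_cap !mem_keract => /andP[_ /eqP fx] /andP[_ /eqP my].
  rewrite [y]split12 poly_actM -mulmxA my mulmx0 add0r (bform_actr H) starM.
  by rewrite poly_actM -mulmxA (star_kill fP fx) mulmx0 bform0l.
have n1 : nondeg J W1.
  move=> x xW x0; apply: nW; first by move: xW; rewrite memv_cap => /andP[].
  move=> y; rewrite E => /memv_addP[y1 y1W [y2 y2W ->]].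
  by rewrite bformDr x0 // o // addr0.
have n2 : nondeg J W2.
  move=> x xW x0; apply: nW; first by move: xW; rewrite memv_cap => /andP[].
  move=> y; rewrite E => /memv_addP[y1 y1W [y2 y2W ->]].
  by rewrite bformDr (x0 y2) // (orthC o) // addr0.
have s1 : stable U W1 by apply: stable_cap => //; apply: stable_keract.
have s2 : stable U W2 by apply: stable_cap => //; apply: stable_keract.
have m0 : (0 < m)%N.
  rewrite lt0n; apply: contraNneq v0 => m0; apply/eqP/(coprimep_act fmu fv).
  by have := kill v; rewrite m0 mul1r.
have W10 : W1 != 0%VS.
  apply: contraNneq v0 => z; rewrite -memv0 -z memv_cap vW mem_keract; apply/eqP.
  by apply: dvdp_act fv; rewrite -{1}[f]expr1 dvdp_exp2l.
have [t1 [nt1 dt1 ft1]] : exists s, [/\ sign_normal s, dec W1 s & forall l, l \in s -> l.1.1 = f].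
  apply: (@dec_primary (\dim W1) _ _ m) => // x.
  by rewrite memv_cap mem_keract => /andP[_ /eqP].
have [||//|t2 nt2 dt2] := IHn W2; last 1 first.
  exists (t1 ++ t2); last by apply/dec_cat; exists W1, W2.
  have ft2 r d : (f, r, d) \notin t2.
    apply/negP => ft; have [W' _ [_ /= r0 _]] := dec_mem dt2 ft.
    have /= : f ^+ r %| mu.
      apply: (dec_min dt2 ft) => x; by rewrite memv_cap mem_keract => /andP[_ /eqP].
    have ff : f %| f ^+ r by rewrite -{1}[f]expr1 dvdp_exp2l.
    move/(dvdp_trans ff) => fm.
    move: fmu; rewrite /coprimep (eqp_size (dvdp_gcd_idl fm)).
    by rewrite (gtn_eqF (Phi_s_size fP)).
  move=> f' r uf; rewrite count_cat; have [ff|nf] := eqVneq f' f.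
    by rewrite ff in uf *; rewrite (count_memPn (ft2 r false)) addn0; apply: nt1.
  rewrite (count_memPn (_ : _ \notin t1)) ?add0n; first exact: nt2.
  by apply: contra nf => /ft1 /= ->.
- rewrite -ltnS; apply: leq_trans dW; rewrite E dimv_disjoint_sum; last exact: nondeg_orth_cap o n1.
  by rewrite -[X in (X < _)%N]add0n ltn_add2r lt0n dimv_eq0.
- exact: s2.
Qed.

End Dec.

(** * Blocks with the same label are isometric *)

Section Iso.
Variables (F : finFieldType) (N N' : nat) (J U : 'M[F]_N) (J' U' : 'M[F]_N').

Definition spans n (I : finType) (x : I -> 'cV[F]_n) (W : {vspace 'cV[F]_n}) :=
  forall y, y \in W <-> exists c : I -> F, y = \sum_i c i *: x i.

(** An isometry commuting with the actions, given by two families with equal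
    Gram matrices for Q(x, y) and for Q(U x, y). Families may be linearly
    dependent: nondegeneracy makes the correspondence a well defined map in
    iso_matrix. *)
Definition isoW (W : {vspace 'cV[F]_N}) (W' : {vspace 'cV[F]_N'}) : Prop :=
  exists (I : finType) (x : I -> 'cV[F]_N) (x' : I -> 'cV[F]_N'),
  [/\ spans x W, spans x' W',
      forall i j, bform J (x i) (x j) = bform J' (x' i) (x' j)
    & forall i j, bform J (U *m x i) (x j) = bform J' (U' *m x' i) (x' j)].

Lemma spans_mem n (I : finType) (x : I -> 'cV[F]_n) (W : {vspace 'cV[F]_n}) i : spans x W -> x i \in W.
Proof.
move=> /(_ (x i))[_]; apply; exists (fun j => (i == j)%:R).
by rewrite (bigD1 i) //= eqxx scale1r big1 ?addr0 // => j; rewrite eq_sym => /negPf->; rewrite scale0r.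
Qed.

Lemma spans_sum n (I1 I2 : finType) (x1 : I1 -> 'cV[F]_n) (x2 : I2 -> 'cV[F]_n) W1 W2 :
  spans x1 W1 -> spans x2 W2 ->
  spans (fun i : I1 + I2 => match i with inl a => x1 a | inr b => x2 b end) (W1 + W2)%VS.
Proof.
move=> s1 s2 y; split=> [/memv_addP[y1 /s1[c1 ->] [y2 /s2[c2 ->] ->]]|[c ->]].
  exists (fun i => match i with inl a => c1 a | inr b => c2 b end).
  by rewrite big_sumType.
rewrite big_sumType memv_add //; first by apply/s1; exists (fun i => c (inl i)).
by apply/s2; exists (fun i => c (inr i)).
Qed.

Lemma iso_add W1 W2 W1' W2' : stable U W1 -> stable U W2 -> stable U' W1' -> stable U' W2' ->
  orth J W1 W2 -> orth J W2 W1 -> orth J' W1' W2' -> orth J' W2' W1' ->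
  isoW W1 W1' -> isoW W2 W2' -> isoW (W1 + W2)%VS (W1' + W2')%VS.
Proof.
move=> s1 s2 s1' s2' o12 o21 o12' o21' [I1 [x1 [x1' [p1 p1' g1 h1]]]] [I2 [x2 [x2' [p2 p2' g2 h2]]]].
exists (I1 + I2)%type, (fun i => match i with inl a => x1 a | inr b => x2 b end),
  (fun i => match i with inl a => x1' a | inr b => x2' b end).
have m1 i := spans_mem i p1; have m2 i := spans_mem i p2.
have m1' i := spans_mem i p1'; have m2' i := spans_mem i p2'.
split; [exact: spans_sum|exact: spans_sum| |] => -[i|i] [j|j] //.
- by rewrite o12 // o12'.
- by rewrite o21 // o21'.
- by rewrite o12 ?s1 // o12' ?s1'.
- by rewrite o21 ?s2 // o21' ?s2'.
Qed.
End Iso.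

Section BlockIso.
Variables (F : finFieldType) (N N' : nat) (J U : 'M[F]_N) (J' U' : 'M[F]_N') (e : nat).
Hypotheses (oF : odd #|F|) (H : symp J U e) (H' : symp J' U' e).
Implicit Types (p q f h : {poly F}).
Local Notation star := (star e).

(** The finite family of the U^i v, with i up to the order of U, spans the
    cyclic module. *)
Lemma cycl_spans n (A B : 'M[F]_n) (HA : symp A B e) v (W : {vspace 'cV[F]_n}) :
  (forall x, x \in W <-> exists p, x = pact B p v) ->
  spans (fun i : 'I_e.+1 => B ^+ i *m v) W.
Proof.
move=> WE x; rewrite WE; split=> [[p ->]|[c ->]]; last first.
  exists (\sum_i c i *: 'X^i); rewrite linear_sum mulmx_suml.
  by apply: eq_bigr => i _; rewrite linearZ /= poly_actXn scalemxAl.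
exists (fun i : 'I_e.+1 => (p %% cyclo F e)`_i).
have -> : pact B p v = pact B (p %% cyclo F e) v.
  by rewrite {1}(divp_eq p (cyclo F e)) linearD /= mulmxDl (act_cyclo HA) ?dvdp_mull ?add0r.
rewrite (@poly_act_widen _ _ _ _ e.+1); last first.
  rewrite -ltnS -[X in (_ < X)%N](size_cyclo F e) ltn_modp -size_poly_gt0 size_cyclo //.
by rewrite mulmx_suml; apply: eq_bigr => i _; rewrite scalemxAl.
Qed.

Lemma cyc_iso W W' h v v' : cyc_block J U W h v -> cyc_block J' U' W' h v' ->
  (forall p, bform J (pact U p v) v = bform J' (pact U' p v') v') -> isoW J U J' U' W W'.
Proof.
case=> WE _ _ [WE' _ _] E.
exists ('I_e.+1 : finType), (fun i : 'I_e.+1 => U ^+ i *m v), (fun i : 'I_e.+1 => U' ^+ i *m v').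
split; first exact: (cycl_spans H).
- exact: (cycl_spans H').
- by move=> i j; rewrite -!poly_actXn (bform_actA H) (bform_actA H').
by move=> i j; rewrite !mulmxA -[U *m _]exprS -[U' *m _]exprS -!poly_actXn (bform_actA H) (bform_actA H').
Qed.

Lemma hyp_iso W W' h v v' w w' : hyp_block J U W h v w -> hyp_block J' U' W' h v' w' ->
  (forall p, bform J (pact U p v) w = bform J' (pact U' p v') w') -> isoW J U J' U' W W'.
Proof.
case=> WE _ [vv ww] _ [WE' _ [vv' ww'] _] E.
exists ('I_e.+1 + 'I_e.+1 : finType)%type,
 (fun i : 'I_e.+1 + 'I_e.+1 => match i with inl a => U ^+ a *m v | inr b => U ^+ b *m w end),
 (fun i : 'I_e.+1 + 'I_e.+1 => match i with inl a => U' ^+ a *m v' | inr b => U' ^+ b *m w' end).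
have sp n (A B : 'M[F]_n) (HA : symp A B e) (x y : 'cV[F]_n) (S : {vspace 'cV[F]_n}) :
    (forall z, z \in S <-> exists p q, z = pact B p x + pact B q y) ->
    spans (fun i : 'I_e.+1 + 'I_e.+1 => match i with inl a => B ^+ a *m x | inr b => B ^+ b *m y end) S.
  move=> SE; have -> : S = (cycl B e x + cycl B e y)%VS.
    apply/vspaceP => z; apply/idP/idP.
      by case/SE => p [q ->]; apply: memv_add; apply/(mem_cycl HA); [exists p|exists q].
    case/memv_addP => a /(mem_cycl HA)[p ->] [b /(mem_cycl HA)[q ->] ->].
    by apply/SE; exists p, q.
  apply: (@spans_sum _ _ 'I_e.+1 'I_e.+1 (fun a : 'I_e.+1 => B ^+ a *m x) (fun b : 'I_e.+1 => B ^+ b *m y)).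
    by apply: (cycl_spans HA) => z; apply: (mem_cycl HA).
  by apply: (cycl_spans HA) => z; apply: (mem_cycl HA).
have E' p : bform J (pact U p w) v = bform J' (pact U' p w') v'.
  rewrite (bform_skew H) (bform_actr H) E (bform_skew H') -(bform_act H') (bform_skew H').
  by rewrite opprK.
split; [exact: (sp _ _ _ H)|exact: (sp _ _ _ H')| |] => -[i|i] [j|j];
  rewrite ?[U *m _]mulmxA ?[U' *m _]mulmxA -?[U *m U ^+ _]exprS -?[U' *m U' ^+ _]exprS -!poly_actXn;
  by rewrite (bform_actA H) (bform_actA H') ?vv ?vv' ?ww ?ww' ?E ?E'.
Qed.

(** By functional_rep one functional is the other composed with multiplication
    by some u; u is a unit because the first one is nondegenerate as well. *)
Lemma functional_unit n (A B : 'M[F]_n) v w n' (A' B' : 'M[F]_n') v' w' h : h \is monic ->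
  pact B h v = 0 -> pact B' h v' = 0 ->
  (forall p, (forall y, bform A (pact B (p * y) v) w = 0) -> h %| p) ->
  (forall p, (forall y, bform A' (pact B' (p * y) v') w' = 0) -> h %| p) ->
  exists2 u, coprimep h u & forall x, bform A' (pact B' x v') w' = bform A (pact B (x * u) v) w.
Proof.
move=> hm hv hv' nd nd'.
have kz m (C D : 'M[F]_m) x y p : pact D h x = 0 -> bform C (pact D (p * h) x) y = 0.
  by move=> hx; rewrite poly_actM -mulmxA hx mulmx0 bform0l.
have [p|p|p ph|u uE] := @functional_rep F h hm (funct A B v w) (funct A' B' v' w').
- by rewrite /= functE kz.
- by rewrite /= functE kz.
- by apply: nd => y; have := ph y; rewrite /= functE.
exists u => //; pose d := gcdp h u.
have /dvdpP[z zE] : d %| h by apply: dvdp_gcdl.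
have /dvdpP[y yE] : d %| u by apply: dvdp_gcdr.
have h0 := monic_neq0 hm.
have hz : h %| z.
  apply: nd' => x; have := uE (z * x); rewrite /= !functE => ->.
  have -> : z * x * u = (x * y) * h by rewrite yE zE; ring.
  exact: kz.
have [z0 d0] : z != 0 /\ d != 0.
  by split; apply: contraNneq h0 => t; rewrite zE t ?mul0r ?mulr0.
have := dvdp_leq z0 hz; rewrite {1}zE size_mul // /coprimep -/d.
move: d0; rewrite -size_poly_gt0; case: (size d) => [|[|k]] // _.
by rewrite addnS /= addnS => /(leq_ltn_trans (leq_addr k _)); rewrite ltnn.
Qed.

Lemma coprimep_gen h y n (B : 'M[F]_n) (v : 'cV[F]_n) : coprimep h y -> pact B h v = 0 ->
  exists z, v = pact B z (pact B y v).
Proof.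
move=> hy hv; have [[a b] /= ab] := Bezout_eq1_coprimepP _ _ hy.
exists b; rewrite mulmxA -poly_actM.
have -> : b * y = 1 - a * h by rewrite -ab [RHS]addrAC subrr add0r.
by rewrite linearB /= mulmxBl poly_act1 mul1mx poly_actM -mulmxA hv mulmx0 subr0.
Qed.

(** The functional of the generator y v is that of v multiplied by the norm y *
    star y. *)
Lemma cyc_iso_norm W W' f r v v' u y : is_Phi_s f -> (0 < r)%N ->
  cyc_block J U W (f ^+ r) v -> cyc_block J' U' W' (f ^+ r) v' ->
  (forall x, bform J' (pact U' x v') v' = bform J (pact U (x * u) v) v) ->
  coprimep (f ^+ r) y -> f ^+ r %| y * star y - u -> isoW J U J' U' W W'.
Proof.
move=> fP r0 cb cb' uE cy yE; have [WE hv hp] := cb; have [WE' hv' hp'] := cb'.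
have [z zE] := coprimep_gen cy hv.
have E p : bform J (pact U p (pact U y v)) (pact U y v) = bform J' (pact U' p v') v'.
  rewrite uE mulmxA -poly_actM (bform_actA H) -mulrA; congr (bform _ _ _).
  have /dvdpP[t tE] := yE.
  have -> : y * star y = t * f ^+ r + u by rewrite -tE subrK.
  by rewrite mulrDr mulrA linearD /= mulmxDl poly_actM -mulmxA hv mulmx0 add0r.
apply: (cyc_iso (h := f ^+ r) (v := pact U y v) _ cb' E); split.
- move=> x; rewrite WE; split=> [[p ->]|[p ->]].
    by exists (p * z); rewrite poly_actM -mulmxA -zE.
  by exists (p * y); rewrite poly_actM mulmxA.
- by rewrite mulmxA poly_actMC -mulmxA hv mulmx0.
by move=> p pv; apply: hp' => t; rewrite -E.
Qed.

(** In characteristic p the power p^r of u - 1 is u^(p^r) - 1. The exponent is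
    odd since #|F| is. *)
Lemma Frobenius_unipotent (f u : {poly F}) r : f %| u - 1 -> exists2 M, odd M & f ^+ r %| u ^+ M - 1.
Proof.
move=> fu; have [p pr_p pcharFp] := finPcharP F.
have op : odd p.
  have := card_pprimeChar pcharFp; move: (logn _ _) => k E; move: oF; rewrite E oddX.
  case: k E => [|k] E //.
  by have := card_finRing_gt1 F; rewrite E expn0 ltnn.
exists (p ^ r)%N; first by rewrite oddX op orbT.
have pp : p \in [pchar {poly F}] by rewrite (pchar_poly F).
have -> : u ^+ (p ^ r) - 1 = (u - 1) ^+ (p ^ r).
  rewrite -{1}[u](subrK 1) exprDn_pchar ?expr1n ?addrK //.
  by rewrite (eq_pnat _ (pcharf_eq pp)) pnatX pnat_id.
apply: dvdp_trans (dvdp_exp2r _ fu); rewrite dvdp_exp2l //.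
by apply/ltnW/ltn_expl/prime_gt1.
Qed.

(** The functionals of two generators differ by a unit u. For a hyperbolic
    block u is absorbed by replacing w with (star u) w. For a cyclic block u is
    fixed by star, and it must be shown to be a norm: norm_mod does this for f
    other than t - 1 and t + 1. For f = t - c with equal signs, u(c) is a
    square t^2; the unipotent factor u / u(c) has an odd power M equal to 1, so
    it is the square, and the norm, of its power (M + 1) / 2. *)
Lemma block_iso W W' l : block_on J U W l -> block_on J' U' W' l -> isoW J U J' U' W W'.
Proof.
case: l => [[f r] d] [/= fP r0 b] [/= _ _ b'].
have hm : f ^+ r \is monic by rewrite monic_exp // Phi_s_monic.
have h0 : (f ^+ r)`_0 != 0 by rewrite -horner_coef0 horner_exp horner_coef0 expf_neq0 // Phi_s_coef0.
have hd : dual (f ^+ r) = f ^+ r by rewrite dualXp ?Phi_s_dual // Phi_s_coef0.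
have cyc v v' : cyc_block J U W (f ^+ r) v -> cyc_block J' U' W' (f ^+ r) v' ->
  exists u, [/\ f ^+ r %| cyclo F e, coprimep (f ^+ r) u, f ^+ r %| star u - u &
     forall x, bform J' (pact U' x v') v' = bform J (pact U (x * u) v) v].
  move=> cb cb'; have [WE hv hp] := cb; have [WE' hv' hp'] := cb'.
  have [u cu uE] := functional_unit hm hv hv' hp hp'.
  exists u; split=> //.
    by apply: hp => y; rewrite (act_cyclo H) ?bform0l // dvdp_mulr.
  apply: hp => x; rewrite mulrC mulrBr linearB /= mulmxBl bformDl bformNl.
  rewrite -(bform_actA H) (bform_skew H) (bform_actA H) mulrC -uE.
  by rewrite (skew_funct H') opprK uE subrr.
move: b b'; case: (boolP (unitb f)) => uf; last first.
  case=> _ [v cb] [_ [v' cb']]; have [u [he cu su uE]] := cyc v v' cb cb'.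
  have nu : ~ unit_poly f by apply/unitbP.
  have [|y cy yE] := norm_mod fP nu r0 he _ su; first by rewrite -(coprimep_pexpl _ _ r0).
  apply: (cyc_iso_norm fP r0 cb cb' uE (y := y)) yE.
  by rewrite coprimep_pexpl.
have [c c2 fE] : unit_poly f by apply/unitbP.
case: ifP => ro.
  case=> _ [v [w hb]] [_ [v' [w' hb']]].
  have [WE [hv hw] [vv ww] hp] := hb; have [WE' [hv' hw'] [vv' ww'] hp'] := hb'.
  have [u cu uE] := functional_unit hm hv hv' hp hp'.
  have he : f ^+ r %| cyclo F e.
    by apply: hp => y; rewrite (act_cyclo H) ?bform0l // dvdp_mulr.
  have hs := star_dual_dvd hm h0 he hd.
  have csu : coprimep (f ^+ r) (star u).
    have [[a b] /= ab] := Bezout_eq1_coprimepP _ _ cu.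
    have /dvdpP[t tE] := hs; apply/Bezout_eq1_coprimepP; exists (star a * t, star b) => /=.
    by rewrite -mulrA -tE -!starM -linearD /= ab star1.
  have [z zE] := coprimep_gen csu hw.
  have E p : bform J (pact U p v) (pact U (star u) w) = bform J' (pact U' p v') w'.
    by rewrite uE (bform_actr H) (act_starK H) mulmxA -poly_actM mulrC.
  apply: (hyp_iso (h := f ^+ r) (v := v) (w := pact U (star u) w) _ hb' E); split.
  - move=> x; rewrite WE; split=> -[p [q ->]].
      by exists p, (q * z); rewrite [poly_act U (q * z)]poly_actM -mulmxA -zE.
    by exists p, (q * star u); rewrite [poly_act U (q * star u)]poly_actM mulmxA.
  - by split=> //; rewrite mulmxA poly_actMC -mulmxA hw mulmx0.
  - by split=> // p; rewrite mulmxA -poly_actM (bform_actA H) ww.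
  - by move=> p pv; apply: hp' => t; rewrite -E.
case=> v cb bd [v' cb' bd']; have [u [he cu su uE]] := cyc v v' cb cb'.
have [_ fv _] := cb; have [_ fv' _] := cb'.
have b0 : beta J U r v != 0 by rewrite fE in cb; apply: (cyc_beta oF H c2 r0 cb).
have b0' : beta J' U' r v' != 0 by rewrite fE in cb'; apply: (cyc_beta oF H' c2 r0 cb').
(* Only u(c) matters, as beta is evaluated on the socle. *)
have bE : beta J' U' r v' = u.[c] * beta J U r v.
  rewrite fE in fv fv'; rewrite (betaE H c2 r0 fv) (betaE H' c2 r0 fv') uE mulrCA; congr (_ * _).
  have /dvdpP[y yE] : 'X - c%:P %| u - (u.[c])%:P by rewrite dvdp_XsubCl rootE !hornerE subrr.
  rewrite -{1}[u](subrK (u.[c])%:P) yE mulrDr linearD /= mulmxDl mulrCA -exprSr prednK //.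
  rewrite [poly_act U (y * _)]poly_actM -mulmxA fv mulmx0 add0r.
  by rewrite mulrC mul_polyC linearZ /= -scalemxAl bformZl.
have [|t t0 tE] := square_ratio oF b0' b0; first by rewrite bd bd'.
have uc : u.[c] = t ^+ 2 by apply: (mulIf b0); rewrite -bE tE mulrC.
have uc0 : u.[c] != 0 by rewrite uc expf_neq0.
pose u1 := (u.[c])^-1 *: u.
have fu1 : f %| u1 - 1 by rewrite fE dvdp_XsubCl rootE /u1 !hornerE mulVf // subrr.
have [M oM fM] := Frobenius_unipotent r fu1.
pose y := t *: u1 ^+ (M.+1)./2.
have su1 : f ^+ r %| star u1 - u1.
  by rewrite /u1 linearZ /= -scalerBr -mul_polyC dvdp_mull.
have su1k k : f ^+ r %| star (u1 ^+ k) - u1 ^+ k.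
  by rewrite starXp subrXX dvdp_mulr.
have uE1 : u = t ^+ 2 *: u1 by rewrite /u1 -uc scalerA mulfV // scale1r.
have cop : coprimep (f ^+ r) u1.
  by rewrite /u1 coprimepZr // invr_eq0.
apply: (cyc_iso_norm fP r0 cb cb' uE (y := y)).
  by rewrite /y coprimepZr // coprimep_expr.
rewrite /y linearZ /= -scalerAl -scalerAr scalerA -expr2 uE1 -scalerBr -mul_polyC dvdp_mull //.
set k := (M.+1)./2; have kk : (k + k = M.+1)%N.
  by rewrite addnn /k -[RHS]odd_double_half /= oM.
have -> : u1 ^+ k * star (u1 ^+ k) - u1 = u1 ^+ k * (star (u1 ^+ k) - u1 ^+ k) + u1 * (u1 ^+ M - 1).
  by rewrite mulrBr -exprD kk mulrBr mulr1 -exprS addrA subrK.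
by apply: dvdp_add; apply: dvdp_mull.
Qed.

Lemma dec_iso W W' s : dec J U W s -> dec J' U' W' s -> isoW J U J' U' W W'.
Proof.
elim: s W W' => [|l s IHs] W W' /=.
  move=> -> ->; exists 'I_0, (fun=> 0), (fun=> 0); split=> [x|x|[]|[]] //;
    rewrite memv0; split=> [/eqP ->|[c ->]]; try exists (fun=> 0); by rewrite big_ord0.
move=> [W1 [W2 [-> o b d]]] [W1' [W2' [-> o' b' d']]].
apply: iso_add; [exact: block_stable b|exact: dec_stable d|exact: block_stable b'
  |exact: dec_stable d'|exact: o|exact: (orthC H)|exact: o'|exact: (orthC H')|exact: block_iso b b'|].
exact: IHs.
Qed.
End BlockIso.

(** * Isometries as matrices, and transport of decompositions *)

Lemma bform_ext (F : finFieldType) n (A B : 'M[F]_n) :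
  (forall x y, bform A x y = bform B x y) -> A = B.
Proof.
move=> E; apply/matrixP => i j; have := E (delta_mx i 0) (delta_mx j 0).
by rewrite /bform -!mulmxA -!colE !trmx_delta -!rowE !mxE.
Qed.

Section IsoMatrix.
Variables (F : finFieldType) (N N' : nat) (J U : 'M[F]_N) (J' U' : 'M[F]_N') (e e' : nat).
Hypotheses (H : symp J U e) (H' : symp J' U' e').
Variable (W : {vspace 'cV[F]_N}).
Hypotheses (sW : stable U W) (nW : nondeg J W).

Lemma nondeg_full : nondeg J' fullv.
Proof.
case: H' => _ Ju _ _ x _ E; apply: trmx_inj; rewrite trmx0.
apply: (can_inj (mulmxK Ju)); rewrite mul0mx; apply/rowP => j.
have := E (delta_mx j 0) (memvf _); by rewrite /bform -colE !mxE.
Qed.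

(** A relation between the vectors x' i holds between the x i as well, since
    the resulting vector is orthogonal to all of W; so x' i |-> x i is a well
    defined linear map. *)
Lemma iso_matrix : isoW J U J' U' W fullv -> exists B : 'M[F]_(N, N'),
  [/\ forall y : 'cV[F]_N', B *m y \in W, forall x, x \in W -> exists y : 'cV[F]_N', x = B *m y,
      forall y z : 'cV[F]_N', bform J (B *m y) (B *m z) = bform J' y z
    & forall y : 'cV[F]_N', U *m (B *m y) = B *m (U' *m y)].
Proof.
case=> I [x [x' [sp sp' g g']]].
(* Equal Gram matrices carry a relation over, by nondegeneracy of W. *)
have key (d : I -> F) : \sum_i d i *: x' i = 0 -> \sum_i d i *: x i = 0.
  move=> d0; have dW : \sum_i d i *: x i \in W by apply/sp; exists d.
  apply: nW => // y /sp[c ->]; rewrite linear_sum big1 // => j _.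
  rewrite linearZ /= bform_suml.
  have -> : \sum_i bform J (d i *: x i) (x j) = bform J' (\sum_i d i *: x' i) (x' j).
    by rewrite bform_suml; apply: eq_bigr => i _; rewrite !bformZl g.
  by rewrite d0 bform0l mulr0.
have ex k : exists c : {ffun I -> F}, delta_mx k 0 = \sum_i c i *: x' i :> 'cV[F]_N'.
  have [/(_ (memvf _))[c cE] _] := sp' (delta_mx k 0).
  by exists [ffun i => c i]; rewrite cE; apply: eq_bigr => i _; rewrite ffunE.
have [c cE] := fin_all_exists ex.
pose B : 'M[F]_(N, N') := \matrix_(i, k) (\sum_j c k j *: x j) i 0.
have BE y : B *m y = \sum_k y k 0 *: \sum_j c k j *: x j.
  apply/colP => i; rewrite !mxE summxE; apply: eq_bigr => k _.
  by rewrite !mxE mulrC.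
have colE' (y : 'cV[F]_N') : y = \sum_k y k 0 *: delta_mx k 0.
  by rewrite {1}[y]matrix_sum_delta; apply: eq_bigr => k _; rewrite big_ord1.
have Bx d : B *m (\sum_i d i *: x' i) = \sum_i d i *: x i.
  set y := \sum_i _; rewrite BE; apply/eqP; rewrite -subr_eq0; apply/eqP.
  pose d' j := \sum_k y k 0 * c k j - d j.
  have E1 m (z : I -> 'cV[F]_m) : \sum_k y k 0 *: (\sum_j c k j *: z j) - \sum_i d i *: z i = \sum_j d' j *: z j.
    rewrite /d'; under [in RHS]eq_bigr do rewrite scalerBl scaler_suml.
    rewrite sumrB exchange_big /=; congr (_ - _); apply: eq_bigr => k _.
    by rewrite scaler_sumr; apply: eq_bigr => j _; rewrite scalerA.
  rewrite E1; apply: key; rewrite -E1 -/y {2}[y]colE'.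
  by rewrite -sumrB big1 // => k _; rewrite -cE subrr.
have yE y : exists d, y = \sum_i d i *: x' i.
  by have [/(_ (memvf _))[d dE] _] := sp' y; exists d.
have Bform y z : bform J (B *m y) (B *m z) = bform J' y z.
  have [d ->] := yE y; have [d' ->] := yE z; rewrite !Bx !bform_suml.
  apply: eq_bigr => i _; rewrite !linear_sum; apply: eq_bigr => j _.
  by rewrite !linearZ /= !bformZl g.
have BW y : B *m y \in W by have [d ->] := yE y; rewrite Bx; apply/sp; exists d.
exists B; split=> //.
  by move=> z /sp[d ->]; exists (\sum_i d i *: x' i); rewrite Bx.
move=> y; apply/eqP; rewrite -subr_eq0; apply/eqP; apply: nW.
  by apply: memvB; [apply: sW; apply: BW|apply: BW].
move=> z /sp[d' ->]; have [d ->] := yE y.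
rewrite -Bx bformDl bformNl Bform !Bx.
rewrite !mulmx_sumr !bform_suml -sumrB big1 // => i _.
rewrite !linear_sum -sumrB big1 // => j _.
by rewrite -!scalemxAr !linearZ_LR /= !bformZl g' subrr.
Qed.
End IsoMatrix.

Section Transport.
Variables (F : finFieldType) (N N' : nat) (J U : 'M[F]_N) (J' U' : 'M[F]_N') (e : nat).
Hypotheses (H : symp J U e) (H' : symp J' U' e).
Variable C : 'M[F]_(N', N).

Definition mximg (W : {vspace 'cV[F]_N}) : {vspace 'cV[F]_N'} := (linfun (mulmx C) @: W)%VS.

Lemma mem_mximg W y : y \in mximg W <-> exists2 x, x \in W & y = C *m x.
Proof.
split=> [/memv_imgP[x xW ->]|[x xW ->]]; first by exists x; rewrite ?lfunE.
by apply/memv_imgP; exists x; rewrite ?lfunE.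
Qed.

Lemma mximg_pact W p x : stable U W -> (forall x, x \in W -> U' *m (C *m x) = C *m (U *m x)) ->
  x \in W -> pact U' p (C *m x) = C *m pact U p x.
Proof.
move=> sW eqv; elim/poly_ind: p x => [|p c IHp] x xW; first by rewrite !linear0 !mul0mx mulmx0.
rewrite !linearD /= !poly_actM !poly_actX !poly_actC !mulmxDl !mul_scalar_mx -!mulmxA.
by rewrite eqv // IHp ?sW // mulmxDr -scalemxAr.
Qed.

(** Labels are invariant under equivariant isometric embeddings. *)
Lemma dec_transport W s : dec J U W s ->
  (forall x y, x \in W -> y \in W -> bform J' (C *m x) (C *m y) = bform J x y) ->
  (forall x, x \in W -> U' *m (C *m x) = C *m (U *m x)) ->
  dec J' U' (mximg W) s.
Proof.
elim: s W => [|l s IHs] W /=; first by move=> -> _ _; rewrite /mximg limg0.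
case=> W1 [W2 [E o b d]] iso eqv.
have s1 : (W1 <= W)%VS by rewrite E addvSl.
have s2 : (W2 <= W)%VS by rewrite E addvSr.
exists (mximg W1), (mximg W2); split.
- by rewrite E /mximg limgD.
- move=> _ _ /mem_mximg[x xW ->] /mem_mximg[y yW ->].
  by rewrite iso; [exact: o|exact: (subvP s1)|exact: (subvP s2)].
- have st1 := block_stable b.
  have actC p x : x \in W1 -> pact U' p (C *m x) = C *m pact U p x.
    by move=> xW; apply: (mximg_pact _ st1) => // y yW; rewrite eqv // (subvP s1).
  have isoC x y : x \in W1 -> y \in W1 -> bform J' (C *m x) (C *m y) = bform J x y.
    by move=> xW yW; rewrite iso // (subvP s1).
  have cyc h v : cyc_block J U W1 h v -> cyc_block J' U' (mximg W1) h (C *m v) /\ v \in W1.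
    case=> WE hv hp; have vW : v \in W1 by apply/WE; exists 1; rewrite poly_act1 mul1mx.
    split=> //; split.
    + move=> x; rewrite mem_mximg; split=> [[y /WE[p ->] ->]|[p ->]].
        by exists p; rewrite actC.
      by exists (pact U p v); rewrite ?actC ?stable_act.
    + by rewrite actC // hv mulmx0.
    move=> p pv; apply: hp => y; rewrite -isoC ?stable_act // -actC //; exact: pv.
  case: b => fP r0 b; split=> //; move: b; case: ifP => _; last first.
    by case=> dt [v /cyc[cb _]]; split=> //; exists (C *m v).
  case: ifP => _; last first.
    case=> v /cyc[cb vW] bE; exists (C *m v) => //; rewrite -bE; congr nonzero_square.
    rewrite /beta (sub_invE H) (sub_invE H') -!poly_actXp actC // isoC // stable_act //.
  case=> dt [v [w [WE [hv hw] [vv ww] hp]]]; split=> //; exists (C *m v), (C *m w).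
  have vW : v \in W1 by apply/WE; exists 1, 0; rewrite poly_act1 mul1mx linear0 mul0mx addr0.
  have wW : w \in W1 by apply/WE; exists 0, 1; rewrite poly_act1 mul1mx linear0 mul0mx add0r.
  split.
  + move=> x; rewrite mem_mximg; split=> [[y /WE[p [q ->]] ->]|[p [q ->]]].
      by exists p, q; rewrite !actC // mulmxDr.
    by exists (pact U p v + pact U q w); rewrite ?memvD ?stable_act // !actC // mulmxDr.
  + by rewrite !actC // hv hw !mulmx0.
  + by split=> p; rewrite actC // isoC ?stable_act.
  by move=> p pv; apply: hp => y; rewrite -isoC ?stable_act // -actC //; exact: pv.
by apply: IHs d _ _ => [x y xW yW|x xW]; [apply: iso|apply: eqv]; apply: (subvP s2).
Qed.
End Transport.

Section FormMx.
Variable F : finFieldType.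

Lemma form_mx_skew N : (form_mx F N)^T = - form_mx F N.
Proof. by apply/matrixP => i j; rewrite !mxE opprB. Qed.

Lemma form_mx_unit n : form_mx F n.*2 \in unitmx.
Proof.
elim: n => [|n IHn]; first by rewrite unitmxE [\det _]det_mx00 unitr1.
rewrite doubleS -[n.*2.+2]/(2 + n.*2)%N form_mx_block // unitmxE det_ublock unitrM.
rewrite -!unitmxE IHn andbT; suff /mulmx1_unit[] : form_mx F 2 *m - form_mx F 2 = 1%:M by [].
apply/matrixP => -[[|[|//]] ?] [[|[|//]] ?]; rewrite !mxE !big_ord_recl big_ord0 !mxE /=;
  by rewrite !(subr0, sub0r, subrr, oppr0, mulr0, mul0r, mul1r, addr0, add0r, opprK, mulN1r).
Qed.
End FormMx.

(** * Realisation of labels in the standard symplectic space *)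

Section SympLemmas.
Variable F : finFieldType.

Lemma symp_order N (J U : 'M[F]_N) e k : symp J U e -> symp J U (e.+1 * k.+1).-1.
Proof.
move=> H; have [JT Ju UJ Ue] := H; split=> //; rewrite prednK ?muln_gt0 //.
exact: (expU H).
Qed.

(** A common multiple of the two orders lets a single star serve both
    isometries. *)
Lemma symp_common N (J U : 'M[F]_N) e N' (J' U' : 'M[F]_N') e' :
  symp J U e -> symp J' U' e' -> exists e0, symp J U e0 /\ symp J' U' e0.
Proof.
move=> H H'; exists (e.+1 * e'.+1).-1; split; first exact: symp_order.
by rewrite mulnC; apply: symp_order.
Qed.

Lemma symp_unit N (J U : 'M[F]_N) e : symp J U e -> U \in unitmx.
Proof.
case=> _ _ _ Ue; case: (@mulmx1_unit _ _ U (U ^+ e)) => //.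
by rewrite -[_ *m _]/(U * U ^+ e) -exprS.
Qed.

Lemma sympI N (J U : 'M[F]_N) : J^T = - J -> J \in unitmx ->
  (forall x y, bform J (U *m x) (U *m y) = bform J x y) -> exists e, symp J U e.
Proof.
move=> JT Ju iso.
have UJ : U^T *m J *m U = J.
  by apply: bform_ext => x y; rewrite -[RHS]iso /bform trmx_mul !mulmxA.
have [|e Ue] := @finite_order _ _ U; last by exists e.
by move: Ju; rewrite -{1}UJ unitmx_mul => /andP[].
Qed.

Lemma even_form_unit N : ~~ odd N -> form_mx F N \in unitmx.
Proof. by move/negPf=> Ne; rewrite -[N]odd_double_half Ne add0n form_mx_unit. Qed.

Lemma isometryE N (U : 'M[F]_N) : ~~ odd N ->
  reflect (forall x y, bform (form_mx F N) (U *m x) (U *m y) = bform (form_mx F N) x y) (Defs.isometry U).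
Proof.
move=> Ne; apply: (iffP (isometryP U)) => [[]//|iso]; split=> //.
have [e] := sympI (form_mx_skew F N) (even_form_unit Ne) iso; exact: symp_unit.
Qed.

(** An isometry over a finite field has finite order, which turns membership in
    Sp into the data of symp. *)
Lemma symp_isometry N (U : 'M[F]_N) : ~~ odd N -> Defs.isometry U -> exists e, symp (form_mx F N) U e.
Proof.
by move=> Ne /(isometryE _ Ne); apply: sympI; rewrite ?form_mx_skew ?even_form_unit.
Qed.

Lemma isometry_symp N (U : 'M[F]_N) e : ~~ odd N -> symp (form_mx F N) U e -> Defs.isometry U.
Proof. by move=> Ne H; apply/(isometryE _ Ne) => x y; rewrite (bform_U H). Qed.

Lemma symp_sum N (J U : 'M[F]_N) N' (J' U' : 'M[F]_N') e : symp J U e -> symp J' U' e ->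
  symp (block_mx J 0 0 J') (block_mx U 0 0 U') e.
Proof.
case=> JT Ju UJ Ue [JT' Ju' UJ' Ue']; split.
- by rewrite tr_block_mx !trmx0 JT JT' opp_block_mx !oppr0.
- by rewrite unitmxE det_ublock unitrM -!unitmxE Ju.
- by rewrite tr_block_mx !trmx0 !mulmx_block !(mulmx0, mul0mx, addr0, add0r) UJ UJ'.
have -> k : block_mx U 0 0 U' ^+ k = block_mx (U ^+ k) 0 0 (U' ^+ k).
  elim: k => [|k IHk]; first by rewrite !expr0 -scalar_mx_block.
  rewrite !exprS IHk -[LHS]/(_ *m _) mulmx_block.
  by rewrite !(mulmx0, mul0mx, addr0, add0r).
by rewrite Ue Ue' -scalar_mx_block.
Qed.

Lemma bform_block N (J : 'M[F]_N) N' (J' : 'M[F]_N') x x' y y' :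
  bform (block_mx J 0 0 J') (col_mx x x') (col_mx y y') = bform J x y + bform J' x' y'.
Proof.
rewrite /bform tr_col_mx mul_row_block !mulmx0 addr0 add0r mul_row_col mxE //.
Qed.

Lemma dec_sum N (J U : 'M[F]_N) N' (J' U' : 'M[F]_N') e s s' : symp J U e -> symp J' U' e ->
  dec J U fullv s -> dec J' U' fullv s' ->
  dec (block_mx J 0 0 J') (block_mx U 0 0 U') fullv (s ++ s').
Proof.
move=> H H' d d'; have Hs := symp_sum H H'.
pose E : 'M[F]_(N + N', N) := col_mx 1%:M 0.
pose E' : 'M[F]_(N + N', N') := col_mx 0 1%:M.
have Ex (x : 'cV_N) : E *m x = col_mx x 0 by rewrite mul_col_mx mul1mx mul0mx.
have Ex' (x : 'cV_N') : E' *m x = col_mx 0 x by rewrite mul_col_mx mul1mx mul0mx.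
apply/(dec_cat Hs); exists (mximg E fullv), (mximg E' fullv); split.
- apply/eqP; rewrite eq_sym eqEsubv subvf /=; apply/subvP => x _.
  rewrite -[x]vsubmxK -[usubmx x]addr0 -[X in col_mx _ X]add0r -add_col_mx.
  apply: memv_add; apply/mem_mximg; [exists (usubmx x)|exists (dsubmx x)] => //; exact: memvf.
- move=> _ _ /mem_mximg[x _ ->] /mem_mximg[y _ ->].
  by rewrite Ex Ex' bform_block bform0l bform0r addr0.
- apply: (dec_transport H Hs d) => [x y _ _|x _]; rewrite !Ex.
    by rewrite bform_block bform0l addr0.
  by rewrite mul_block_col !(mulmx0, mul0mx, addr0).
apply: (dec_transport H' Hs d') => [x y _ _|x _]; rewrite !Ex'.
  by rewrite bform_block bform0l add0r.
by rewrite mul_block_col !(mulmx0, mul0mx, addr0, add0r).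
Qed.
End SympLemmas.

Section Darboux.
Variable F : finFieldType.
Hypothesis oF : odd #|F|.
(** A hyperbolic plane on which U acts trivially. *)
Definition one_label : label F := ('X - 1%:P, 1%N, true).

Lemma symp_id N (J : 'M[F]_N) : J^T = - J -> J \in unitmx -> symp J 1%:M 0.
Proof. by move=> JT Ju; split; rewrite // ?trmx1 ?mul1mx ?mulmx1. Qed.

Lemma pact_id N p (x : 'cV[F]_N) : pact 1%:M p x = p.[1] *: x.
Proof.
elim/poly_ind: p => [|p c IHp]; first by rewrite linear0 mul0mx horner0 scale0r.
rewrite linearD /= poly_actM poly_actX poly_actC mulmx1 mulmxDl IHp mul_scalar_mx.
by rewrite !hornerE -scalerDl.
Qed.

Lemma dec_plane : dec (form_mx F 2) 1%:M fullv [:: one_label].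
Proof.
have H : symp (form_mx F 2) 1%:M 0.
  by apply: symp_id; [apply: form_mx_skew|apply: (form_mx_unit F 1)].
exists fullv, 0%VS; split=> //; first by rewrite addv0.
  by move=> x y _; rewrite memv0 => /eqP ->; rewrite linear0.
split=> //=; first by apply: Phi_unit; rewrite expr1n.
rewrite /unitb eqxx /=; split=> //.
pose v : 'cV[F]_2 := delta_mx 0 0; pose w : 'cV[F]_2 := delta_mx 1 0.
have fE i j : bform (form_mx F 2) (delta_mx i 0) (delta_mx j 0) = form_mx F 2 i j.
  by rewrite /bform -!mulmxA -!colE !trmx_delta -!rowE !mxE.
exists v, w; split.
- move=> x; split=> [_|_]; last exact: memvf.
  exists (x 0 0)%:P, (x 1 0)%:P; rewrite !poly_actC !mul_scalar_mx.
  by rewrite {1}[x]matrix_sum_delta !big_ord_recl !big_ord0 !addr0; congr (_ *: delta_mx _ _ + x _ _ *: delta_mx _ _); apply: val_inj.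
- by rewrite expr1 !pact_id !hornerE subrr !scale0r.
- by split=> p; rewrite pact_id bformZl fE mxE /= subrr mulr0.
move=> p /(_ 1); rewrite mulr1 pact_id bformZl fE !mxE /= subr0 mulr1 => p1.
by rewrite expr1 dvdp_XsubCl rootE p1.
Qed.

Lemma dec_form n : dec (form_mx F n.*2) 1%:M fullv (nseq n one_label).
Proof.
have H k : symp (form_mx F k.*2) 1%:M 0.
  by apply: symp_id; [apply: form_mx_skew|apply: form_mx_unit].
elim: n => [|n IHn] /=.
  by apply/eqP; rewrite -dimv_eq0 dimvf /dim /= muln1.
have := dec_sum (H 1%N) (H n) dec_plane IHn.
by rewrite -form_mx_block // -scalar_mx_block.
Qed.

(** t - 1 kills the identity, so by minimality every f^r divides t - 1. *)
Lemma dec_id N (J : 'M[F]_N) W s : J^T = - J -> J \in unitmx ->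
  dec J 1%:M W s -> s = nseq (size s) one_label.
Proof.
move=> JT Ju d; have H := symp_id JT Ju; apply/all_pred1P/allP => l ls /=.
have [W' _ [fP r0 b]] := dec_mem d ls; have := dec_min (p := 'X - 1%:P) d ls.
case: l fP r0 b {ls} => [[f r] b'] /= fP r0 b dv.
have {}dv : f ^+ r %| 'X - 1%:P by apply: dv => x _; rewrite pact_id !hornerE subrr scale0r.
have sf := Phi_s_size fP.
have := dvdp_leq (monic_neq0 (monicXsubC _)) dv; rewrite size_XsubC => sfr.
have r1 : r = 1%N.
  have := size_exp f r; case: r r0 sfr {dv b} => [|[|r]] // _ sfr.
  case: (size f) sf (size (f ^+ r.+2)) sfr => [|[|k]] // _ [|[|[|?]]] //=.
subst r; rewrite expr1 in dv sfr.
have fE : f = 'X - 1%:P.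
  apply/eqP; rewrite -eqp_monic ?monicXsubC ?Phi_s_monic // -dvdp_size_eqp //.
  by rewrite size_XsubC eqn_leq sfr sf.
move: b; rewrite fE /unitb eqxx /= => -[-> _]; exact: eqxx.
Qed.

(** The identity decomposes any nondegenerate space into blocks of label
    one_label, like the standard space of the same dimension; so the two are
    isometric by dec_iso, and U is transported to an isometry of the standard
    form. *)
Lemma darboux N (J U : 'M[F]_N) e W s : symp J U e -> dec J U W s ->
  exists2 M, ~~ odd M & exists2 U' : 'M[F]_M, Defs.isometry U' & dec (form_mx F M) U' fullv s.
Proof.
move=> H d; have [JT Ju _ Ue] := H; have H1 := symp_id JT Ju.
have sW := dec_stable d; have nW := dec_nondeg H d.
have s1 : stable 1%:M W by move=> x; rewrite mul1mx.
have [t _ dt] := dec_exists oF H1 s1 nW.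
have tE := dec_id JT Ju dt; rewrite tE in dt; set n := size t in dt.
pose J' := form_mx F n.*2; have J'u : J' \in unitmx by apply: form_mx_unit.
have H1' : symp J' 1%:M 0 by apply: symp_id => //; apply: form_mx_skew.
have [B [BW Bs Bf _]] := iso_matrix s1 nW (dec_iso oF H1 H1' dt (dec_form n)).
pose L := invmx J' *m B^T *m J.
have LB : L *m B = 1%:M.
  have BJ : B^T *m J *m B = J'.
    by apply: bform_ext => x y; rewrite -Bf /bform trmx_mul !mulmxA.
  by rewrite /L -!mulmxA [B^T *m _]mulmxA BJ mulVmx.
have LBx (x : 'cV_(n.*2)) : L *m (B *m x) = x by rewrite mulmxA LB mul1mx.
have BL x : x \in W -> B *m (L *m x) = x by case/Bs => y ->; rewrite LBx.
have Lf x y : x \in W -> y \in W -> bform J' (L *m x) (L *m y) = bform J x y.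
  by move=> xW yW; rewrite -Bf !BL.
pose U' := L *m (U *m B).
have U'E y : U' *m y = L *m (U *m (B *m y)) by rewrite /U' -!mulmxA.
have LU x : x \in W -> U' *m (L *m x) = L *m (U *m x).
  by move=> xW; rewrite U'E BL.
have iU : Defs.isometry U'.
  apply/isometryE; first by rewrite odd_double.
  by move=> x y; rewrite !U'E Lf ?sW // (bform_U H) Bf.
exists n.*2; rewrite ?odd_double //; exists U' => //.
have [e' H'] := symp_isometry (negbT (odd_double n)) iU.
have [e0 [He He']] := symp_common H H'.
have := dec_transport He He' d Lf LU; congr (dec _ _ _ _).
by apply/eqP; rewrite eqEsubv subvf; apply/subvP => y _; apply/mem_mximg; exists (B *m y).
Qed.
End Darboux.

Section Realize.
Variable F : finFieldType.
Hypothesis oF : odd #|F|.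

(** The first basis vector is cyclic for the companion matrix: its images under
    the first powers are the other basis vectors. *)
Lemma companion_act (h p : {poly F}) : (size p <= (size h).-1)%N -> p != 0 ->
  poly_act (companionmx h) p != 0.
Proof.
set d := (size h).-1 => sp p0.
have d0 : (0 < d)%N by apply: leq_trans sp; rewrite size_poly_gt0 p0.
apply: contraNneq p0 => E.
pose i0 : 'I_d := Ordinal d0.
have pw k (kd : (k < d)%N) : delta_mx 0 i0 *m companionmx h ^+ k = delta_mx 0 (Ordinal kd) :> 'rV_d.
  elim: k kd => [|k IHk] kd.
    by rewrite expr0 mulmx1; congr delta_mx; apply: val_inj.
  have kd' := ltnW kd; rewrite exprSr -[X in _ *m X]/(_ *m _) mulmxA IHk.
  by rewrite mulmx_delta_companion; congr delta_mx; apply: val_inj.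
have {}E : delta_mx 0 i0 *m poly_act (companionmx h) p = 0 :> 'rV_d by rewrite E mulmx0.
rewrite (poly_act_widen _ sp) mulmx_sumr in E.
apply/eqP/polyP => i; rewrite coef0; case: (ltnP i d) => [id|di]; last first.
  by rewrite nth_default // (leq_trans sp).
have := congr1 (fun A : 'rV[F]_d => A 0 (Ordinal id)) E; rewrite [RHS]mxE summxE.
rewrite (bigD1 (Ordinal id)) //= big1 ?addr0 => [|j ji].
  by rewrite -scalemxAr mxE pw mxE !eqxx mulr1.
rewrite -scalemxAr mxE; case: j ji => j jd ji; rewrite pw mxE eqxx /=.
by rewrite eq_sym (negPf ji) mulr0.
Qed.

Lemma size_pred_pow (a b c r : nat) : (0 < r)%N -> (0 < b)%N -> (1 < a)%N ->
  c.-1 = (a.-1 * r)%N -> b.-1 = (a.-1 * r.-1)%N -> (b <= c.-1)%N.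
Proof.
case: r => // r _ b0 a1 cE bE.
rewrite -(prednK b0) bE cE mulnS; case: a a1 {bE cE} => [|[|a]] //= _.
by rewrite addSn ltnS leq_addl.
Qed.

(** A companion matrix C of f^r on a space and its contragredient on the dual
    space preserve the hyperbolic form of their sum. Self-duality of f makes
    f^r kill the dual part too. *)
Lemma hyperbolic_space (f : {poly F}) r : is_Phi_s f -> (0 < r)%N ->
  exists N (J U : 'M[F]_N) e, [/\ symp J U e, forall x : 'cV[F]_N, pact U (f ^+ r) x = 0
    & exists x : 'cV[F]_N, pact U (f ^+ r.-1) x != 0].
Proof.
move=> fP r0; set h := f ^+ r; pose d := (size h).-1.
have hm : h \is monic by rewrite monic_exp // Phi_s_monic.
have h0 : h`_0 != 0 by rewrite -horner_coef0 horner_exp horner_coef0 expf_neq0 // Phi_s_coef0.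
pose C : 'M[F]_d := companionmx h.
have Cu : C \in unitmx.
  rewrite unitmxE unitfE; apply: contraNneq h0 => dC.
  by rewrite -(companionmxK hm) char_poly_det -/C dC mulr0.
have hC : poly_act C h = 0 by rewrite -[in LHS](companionmxK hm) char_poly_act.
pose U := block_mx C 0 0 (invmx C^T); pose J : 'M[F]_(d + d) := block_mx 0 1%:M (- 1%:M) 0.
have JT : J^T = - J by rewrite tr_block_mx !trmx0 linearN /= !trmx1 opp_block_mx !oppr0 opprK.
have Ju : J \in unitmx.
  suff /mulmx1_unit[] : J *m - J = 1%:M by [].
  rewrite /J opp_block_mx mulmx_block !oppr0 !(mulmx0, mul0mx, addr0, add0r).
  by rewrite opprK !mulmx1 mulNmx mulmxN mulmx1 opprK -scalar_mx_block.
have UJ : U^T *m J *m U = J.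
  rewrite /U /J tr_block_mx !trmx0 !mulmx_block !(mulmx0, mul0mx, addr0, add0r, mulmx1).
  by rewrite mulmxV ?unitmx_tr // trmx_inv trmxK mulmxN mulmx1 mulNmx mulVmx.
have [e H] : exists e, symp J U e.
  by apply: sympI => // x y; rewrite /bform trmx_mul -{2}UJ !mulmxA.
pose E : 'M[F]_(d + d, d) := col_mx 1%:M 0.
have Ex (x : 'cV_d) : E *m x = col_mx x 0 by rewrite mul_col_mx mul1mx mul0mx.
have EU p (x : 'cV_d) : pact U p (E *m x) = E *m pact C p x.
  have sf : stable C fullv by move=> y _; apply: memvf.
  apply: (mximg_pact _ sf) (memvf _) => y _.
  by rewrite !Ex mul_block_col !(mulmx0, mul0mx, addr0).
have hE (x : 'cV_d) : pact U h (E *m x) = 0 by rewrite EU hC mul0mx mulmx0.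
exists (d + d)%N, J, U, e; split=> //.
  pose E' : 'M[F]_(d + d, d) := col_mx 0 1%:M.
  have Ex' (x : 'cV_d) : E' *m x = col_mx 0 x by rewrite mul_col_mx mul1mx mul0mx.
  have EU' p (x : 'cV_d) : pact U p (E' *m x) = E' *m pact (invmx C^T) p x.
    have sf : stable (invmx C^T) fullv by move=> y _; apply: memvf.
    apply: (mximg_pact _ sf) (memvf _) => y _.
    by rewrite !Ex' mul_block_col !(mulmx0, mul0mx, addr0, add0r).
  move=> x; have -> : x = E *m usubmx x + E' *m dsubmx x.
    by rewrite Ex Ex' add_col_mx addr0 add0r vsubmxK.
  rewrite mulmxDr hE add0r; apply: (nondeg_full H) (memvf _) _ => y _.
  have -> : y = E *m usubmx y + E' *m dsubmx y.
    by rewrite Ex Ex' add_col_mx addr0 add0r vsubmxK.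
  rewrite bformDr (bform_act H) (star_kill H fP (hE _)) bform0r add0r EU' !Ex' /bform.
  rewrite tr_col_mx /J mul_row_block !(mulmx0, mul0mx, addr0, add0r, trmx0).
  by rewrite mul_row_col mul0mx mulmx0 addr0 mxE.
have : poly_act C (f ^+ r.-1) != 0.
  apply: companion_act; last by rewrite expf_neq0 // monic_neq0 // Phi_s_monic.
  apply: (size_pred_pow r0 _ (Phi_s_size fP) (size_exp f r) (size_exp f r.-1)).
  by rewrite size_poly_gt0 expf_neq0 // monic_neq0 // Phi_s_monic.
move=> nz; have [j cj] : exists j, col j (poly_act C (f ^+ r.-1)) != 0.
  apply/existsP; apply: contraNT nz; rewrite negb_exists => /forallP c0.
  by apply/eqP/matrixP => i j; have /eqP/colP/(_ i) := negPn (c0 j); rewrite !mxE.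
exists (E *m delta_mx j 0); rewrite EU -colE Ex; apply: contra cj => /eqP E0.
by have [-> _] := eq_col_mx (etrans E0 (esym (col_mx0 _ _ _ _))).
Qed.

Definition valid_label (l : label F) : Prop := [/\ is_Phi_s l.1.1, (0 < l.1.2)%N
  & ~~ (unitb l.1.1 && ~~ odd l.1.2) -> l.2].

Lemma block_dec N (J U : 'M[F]_N) W l : block_on J U W l -> dec J U W [:: l].
Proof.
move=> b; exists W, 0%VS; split=> //; first by rewrite addv0.
by move=> x y _; rewrite memv0 => /eqP ->; rewrite bform0r.
Qed.

Lemma dec_label N (J U : 'M[F]_N) W s l : dec J U W s -> l \in s -> valid_label l.
Proof.
move=> d /(dec_mem d)[W' _ [fP r0 b]]; split=> //.
by move: b; case: (unitb _); [case: (odd _) => //= -[]|case].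
Qed.

Lemma bform_scale N (J : 'M[F]_N) a x y : bform (a *: J) x y = a * bform J x y.
Proof. by rewrite /bform -scalemxAr -scalemxAl mxE. Qed.

(** The hyperbolic space has a block killed by f^r and not by f^(r-1). If its
    sign is the wrong one, multiplying the form by a nonsquare changes it. *)
Lemma realize_label l : valid_label l -> exists N (J U : 'M[F]_N) e W, symp J U e /\ dec J U W [:: l].
Proof.
case: l => [[f r] d] [/= fP r0 vd].
have [N [J [U [e [H fU [x0 fx0]]]]]] := hyperbolic_space fP r0.
have sf : stable U fullv by move=> ? _; apply: memvf.
have fU' (x : 'cV[F]_N) : x \in fullv -> pact U (f ^+ r) x = 0 by move=> _; exact: (fU x).
have fx' : exists2 x : 'cV[F]_N, x \in fullv & pact U (f ^+ r.-1) x != 0 by exists x0; rewrite ?memvf.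
have nf := nondeg_full H.
have [/andP[uf ro]|nuf] := boolP (unitb f && odd r).
  have [c c2 fE] := unitbP _ uf.
  have [v [w [_ _ hb]]] := hyp_exists oF H nf sf fP r0 fU' fx' c2 fE ro.
  exists N, J, U, e, (cycl U e v + cycl U e w)%VS; split=> //; apply: block_dec; split=> //=.
  by rewrite uf ro /=; split; [apply: vd; rewrite uf ro|exists v, w].
have [|v [x [_ fx]]] := cyc_exists oF H nf sf fP r0 fU' fx'.
  move=> c c2 fE; apply: contra nuf => ->; rewrite andbT; apply/unitbP; by exists c.
have hp := nondeg_gen H fP r0 (fU v) fx.
have cb := cyc_block_cycl H (fU v) hp.
have [uf|uf] := boolP (unitb f); last first.
  exists N, J, U, e, (cycl U e v); split=> //; apply: block_dec; split=> //=.
  by rewrite (negPf uf); split; [apply: vd; rewrite (negPf uf)|exists v].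
rewrite uf /= in nuf; have [c c2 fE] := unitbP _ uf.
have b0 : beta J U r v != 0.
  by apply: (beta_neq0 oF H c2 r0 (x := x)); rewrite -fE.
have [bd|bd] := eqVneq (nonzero_square (beta J U r v)) d.
  exists N, J, U, e, (cycl U e v); split=> //; apply: block_dec; split=> //=.
  by rewrite uf (negPf nuf); exists v.
have [a a0 na] := nonsquare_exists oF.
exists N, (a *: J), U, e, (cycl U e v); split.
  have [JT Ju UJ Ue] := H; split=> //.
  - by rewrite linearZ /= JT scalerN.
  - by rewrite unitmxZ // unitfE.
  - by rewrite -scalemxAr -scalemxAl UJ.
apply: block_dec; split=> //=; rewrite uf (negPf nuf); exists v.
  case: cb => WE hv _; split=> // p pv; apply: hp => y; apply: (mulfI a0).
  by rewrite -bform_scale pv mulr0.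
have -> : beta (a *: J) U r v = a * beta J U r v by rewrite /beta bform_scale.
suff -> : nonzero_square (a * beta J U r v) = ~~ nonzero_square (beta J U r v).
  by move: bd; case: (nonzero_square _); case: d {vd}.
have [sb|nb] /= := boolP (nonzero_square (beta J U r v)).
  by rewrite mulrC nonzero_squareM // (negPf na).
have [|z z0 ->] := square_ratio oF a0 b0; first by rewrite (negPf na) (negPf nb).
apply/nonzero_squareP; exists (beta J U r v * z); first by rewrite mulf_neq0.
by rewrite exprMn mulrAC -expr2.
Qed.

Lemma realize_even s : (forall l, l \in s -> valid_label l) ->
  exists2 M, ~~ odd M & exists2 U : 'M[F]_M, Defs.isometry U & dec (form_mx F M) U fullv s.
Proof.
elim: s => [|l s IHs] vs.
  exists 0%N => //; exists 1%:M; first exact: isometry1.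
  by apply/eqP; rewrite -dimv_eq0 dimvf.
have [|M Me [U iU dU]] := IHs; first by move=> k ks; apply: vs; rewrite inE ks orbT.
have [|N [J [V [e [W [HV dV]]]]]] := @realize_label l; first by apply: vs; rewrite mem_head.
have [K Ke [X iX dX]] := darboux oF HV dV.
have [e1 H1] := symp_isometry Me iU; have [e2 H2] := symp_isometry Ke iX.
have [e0 [H2' H1']] := symp_common H2 H1.
have Ne : ~~ odd (K + M) by rewrite oddD (negPf Ke).
exists (K + M)%N => //; exists (block_mx X 0 0 U).
  by apply: (isometry_symp Ne (e := e0)); rewrite form_mx_block //; apply: symp_sum.
by rewrite form_mx_block //; apply: (dec_sum H2' H1' dX dU).
Qed.

Lemma realize s : (forall l, l \in s -> valid_label l) ->
  exists n (U : Sp F n), dec (form_mx F n.*2) (val U) fullv s.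
Proof.
case/realize_even => M Me; rewrite -(even_halfK Me) => -[U iU d].
by exists M./2, (MkSp iU).
Qed.
End Realize.

(** * Conjugacy and label lists *)

Section Conj.
Variable F : finFieldType.
Hypothesis oF : odd #|F|.
Local Notation Jn n := (form_mx F n.*2).

Lemma Sp_symp n (U : Sp F n) : exists e, symp (Jn n) (val U) e.
Proof. by apply: symp_isometry (valP U); rewrite odd_double. Qed.

Lemma Sp_dec n (U : Sp F n) : exists2 s, sign_normal s & dec (Jn n) (val U) fullv s.
Proof.
have [e H] := Sp_symp U; apply: (dec_exists oF H); last exact: nondeg_full H.
by move=> x _; apply: memvf.
Qed.

Lemma dec_conj n (U U' : Sp F n) s :
  dec (Jn n) (val U) fullv s -> dec (Jn n) (val U') fullv s -> are_conjugate U U'.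
Proof.
move=> d d'; have [e1 H1] := Sp_symp U; have [e2 H2] := Sp_symp U'.
have [e [H H']] := symp_common H1 H2.
have [B [_ _ Bf BU]] := iso_matrix (dec_stable d) (dec_nondeg H d) (dec_iso oF H H' d d').
have iB : Defs.isometry B by apply/isometryE => //; rewrite odd_double.
exists (MkSp iB); apply: val_inj; rewrite /= -[LHS](mulKmx (proj1 (isometryP _ iB))).
congr (_ *m _); apply/matrixP => i j.
have := BU (delta_mx j 0); rewrite !mulmxA -!colE => /colP/(_ i); by rewrite !mxE.
Qed.

Lemma conj_dec n (U U' : Sp F n) s :
  are_conjugate U U' -> dec (Jn n) (val U) fullv s -> dec (Jn n) (val U') fullv s.
Proof.
case=> g UE d; have [e1 H1] := Sp_symp U; have [e2 H2] := Sp_symp U'.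
have [e [H H']] := symp_common H1 H2.
have [gu gQ] := isometryP _ (valP g).
have gi := isometryP _ (valP (g^-1)%g).
have := dec_transport H H' d (C := invmx (val g)) _ _.
have -> : mximg (invmx (val g)) fullv = fullv.
  apply/eqP; rewrite eqEsubv subvf; apply/subvP => y _; apply/mem_mximg.
  by exists (val g *m y); rewrite ?memvf // mulKmx.
apply=> [x y _ _|x _]; first by have [_ /(_ x y)] := gi; rewrite !Q_form.
by rewrite UE /= -!mulmxA mulKVmx.
Qed.

(** The added coordinates carry the trivial action on n - m hyperbolic planes.
    *)
Lemma dec_up m n (U : Sp F m) s : (m <= n)%N -> dec (Jn m) (val U) fullv s ->
  dec (Jn n) (val (Sp_up n U)) fullv (s ++ nseq (n - m) (one_label F)).
Proof.
move=> mn d; have [e1 H1] := Sp_symp U.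
have H2 : symp (Jn (n - m)%N) 1%:M 0.
  by apply: symp_id; [apply: form_mx_skew|apply: form_mx_unit].
have [e [H H']] := symp_common H1 H2.
have := dec_sum H H' d (dec_form F (n - m)).
rewrite -form_mx_block ?odd_double // -up_mxE -doubleD subnKC //.
Qed.
End Conj.

(** * From label lists to symplectic functions *)

Section Gen.
Lemma fnd_sgn_map p s i : fnd (sgn_map p s) i = if i \in p then Some (s i) else None.
Proof.
have E : (i \in domf (sgn_map p s)) = (i \in p) by exact: seq_fsetE.
case: fndP => [ip|]; rewrite -E; last by move/negPf ->.
by rewrite ip /sgn_map ffunE.
Qed.

Lemma sorted_count_eq (p p' : seq nat) : sorted geq p -> sorted geq p' ->
  (forall r, count_mem r p = count_mem r p') -> p = p'.
Proof.
move=> sp sp' E; apply: (@sorted_eq _ geq) => //.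
- by move=> a b c /= ba ac; apply: leq_trans ba.
- by move=> a b /=; rewrite andbC -eqn_leq => /eqP.
by apply/allP => x _ /=; rewrite E.
Qed.

Lemma geq_total : total geq. Proof. by move=> a b /=; apply: leq_total. Qed.
Lemma geq_trans : transitive geq. Proof. by move=> a b c /= ba ac; apply: leq_trans ba. Qed.

Lemma count_flatten_nseq (T : eqType) (m : T -> nat) (D : seq T) x : uniq D ->
  count_mem x (flatten [seq nseq (m y) y | y <- D]) = if x \in D then m x else 0%N.
Proof.
elim: D => [|y D IHD] //= /andP[yD uD]; rewrite count_cat count_nseq IHD // inE /=.
have [<-|_] := eqVneq y x; rewrite ?eqxx ?mul1n ?mul0n //=.
by rewrite (negPf yD) addn0.
Qed.
Lemma mem_count (T : eqType) (x : T) s : (x \in s) = (0 < count_mem x s)%N.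
Proof. by rewrite -has_count has_pred1. Qed.
Lemma count_mem_cons (T : eqType) (x y : T) s : count_mem x (y :: s) = ((y == x) + count_mem x s)%N.
Proof. by []. Qed.
End Gen.

Section TypeOf.
Variable F : finFieldType.
Hypothesis oF : odd #|F|.
Implicit Types (f : {poly F}) (l : label F) (t : seq (label F)).
Local Notation Lm := ('X - 1 : {poly F}).
Local Notation Lp := ('X + 1 : {poly F}).
Local Notation one_label := (one_label F).

Lemma LmE : 'X - 1%:P = Lm. Proof. by rewrite polyC1. Qed.
Lemma LpE : 'X - (-1)%:P = Lp. Proof. by rewrite polyCN polyC1 opprK. Qed.
Lemma unitbE f : unitb f = (f == Lm) || (f == Lp).
Proof. by rewrite /unitb LmE LpE. Qed.

Lemma sp_ext (L L' : sp_data F) : (forall f, parts L f = parts L' f) ->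
  (forall i, fnd (sgn_plus L) i = fnd (sgn_plus L') i) ->
  (forall i, fnd (sgn_minus L) i = fnd (sgn_minus L') i) -> L = L'.
Proof.
by case: L L' => [p a b] [p' a' b'] /= /fsfunP -> /fmapP -> /fmapP ->.
Qed.

Definition hyperb l := unitb l.1.1 && odd l.1.2.
(** The primary cyclic summands, where a hyperbolic block counts for two. *)
Definition pairs t := flatten [seq nseq (hyperb l).+1 l.1 | l <- t].
Definition parts_of t f := sort geq (exponents (pairs t) f).
(** For a normal list the product of the signs of the blocks (f, i, b) is -1
    exactly when (f, i, false) occurs. Odd parts have sign -1 by definition. *)
Definition sign_of t f i := ~~ odd i && ((f, i, false) \notin t).
Definition type_of t : sp_data F :=
  SpData [fsfun f in seq_fset tt [seq x.1 | x <- pairs t] => parts_of t f]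
    (sgn_map (parts_of t Lp) (sign_of t Lp)) (sgn_map (parts_of t Lm) (sign_of t Lm)).

Lemma mem_exponents (P : seq ({poly F} * nat)) f r : (r \in exponents P f) = ((f, r) \in P).
Proof.
apply/mapP/idP => [[[g k]]|fr]; last by exists (f, r); rewrite // mem_filter eqxx.
by rewrite mem_filter /= => /andP[/eqP -> gP] ->.
Qed.

Lemma count_exponents (P : seq ({poly F} * nat)) f r : count_mem r (exponents P f) = count_mem (f, r) P.
Proof.
rewrite count_map count_filter; apply: eq_count => -[g k] /=.
by rewrite xpair_eqE andbC.
Qed.

Lemma parts_type t f : parts (type_of t) f = parts_of t f.
Proof.
cbn [parts type_of]; rewrite fsfunE seq_fsetE; case: ifP => // /negP nf; apply/esym.
rewrite /parts_of; suff -> : exponents (pairs t) f = [::] by [].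
rewrite /exponents; apply/eqP; rewrite -size_eq0 size_map size_filter -leqn0 leqNgt -has_count.
apply/negP => /hasP[x xp /eqP xf]; apply: nf; rewrite -xf; exact: map_f.
Qed.

Lemma count_parts t f r : count_mem r (parts_of t f) = count_mem (f, r) (pairs t).
Proof. by rewrite -count_exponents; apply/seq.permP; rewrite perm_sort. Qed.

Lemma mem_parts t f r : (r \in parts_of t f) = ((f, r) \in pairs t).
Proof. by rewrite mem_sort mem_exponents. Qed.

Lemma pairs_cons l t : pairs (l :: t) = nseq (hyperb l).+1 l.1 ++ pairs t.
Proof. by []. Qed.

Lemma mem_pairs t x : (x \in pairs t) = (x \in [seq l.1 | l <- t]).
Proof.
apply/flattenP/mapP => [[_ /mapP[l lt ->]]|[l lt ->]].
  by rewrite mem_nseq => /andP[_ /eqP ->]; exists l.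
exists (nseq (hyperb l).+1 l.1); first exact: map_f.
by rewrite mem_nseq eqxx.
Qed.

Lemma sorted_parts t f : sorted geq (parts_of t f).
Proof. exact: sort_sorted geq_total _. Qed.

Lemma count_pairs t f r : count_mem (f, r) (pairs t) =
  ((unitb f && odd r).+1 * (count_mem (f, r, true) t + count_mem (f, r, false) t))%N.
Proof.
elim: t => [|[[g k] b] t IHt]; first by rewrite muln0.
rewrite pairs_cons count_cat IHt count_nseq.
rewrite !count_mem_cons (xpair_eqE (g, k) (f, r) b true) (xpair_eqE (g, k) (f, r) b false) /=.
have [[-> ->]|_] := eqVneq (g, k) (f, r); last by rewrite mul0n.
have b1 : ((b == true) + (b == false))%N = 1%N by case: b.
by rewrite mul1n addnACA b1 [RHS]mulnDr muln1 /hyperb.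
Qed.

Definition valid t := forall l, l \in t -> valid_label l.

Lemma valid_false t f r : valid t -> ~~ (unitb f && ~~ odd r) -> (f, r, false) \notin t.
Proof. by move=> vt n; apply/negP => /vt[_ _ /(_ n)]. Qed.

Lemma valid_sub t t' : {subset t <= t'} -> valid t' -> valid t.
Proof. by move=> s v l /s /v. Qed.

Lemma part_parts t f : valid t -> is_partition (parts_of t f).
Proof.
move=> vt; rewrite /is_partition sorted_parts mem_parts mem_pairs.
by apply/mapP => -[l /vt[_ l0 _] E]; rewrite -E in l0.
Qed.

Lemma sign_at_type t f : f = Lm \/ f = Lp -> valid t ->
  symplectic_partition (parts_of t f) (sgn_map (parts_of t f) (sign_of t f)).
Proof.
move=> fE vt; have uf : unitb f by rewrite unitbE; case: fE => ->; rewrite eqxx ?orbT.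
split; first by split=> [|i]; [apply: part_parts|rewrite seq_fsetE].
move=> i ip io; rewrite fnd_sgn_map ip count_parts count_pairs uf io /=.
by rewrite mul2n odd_double /sign_of io.
Qed.

Lemma type_symplectic t : valid t -> symplectic_function (type_of t).
Proof.
move=> vt; split; first 1 last.
- by rewrite parts_type; apply: sign_at_type => //; left.
- by rewrite parts_type; apply: sign_at_type => //; right.
split=> f; rewrite parts_type; first exact: part_parts.
case E: (parts_of t f) => [|r p] // _.
have : r \in parts_of t f by rewrite E mem_head.
by rewrite mem_parts mem_pairs => /mapP[[[g k] b] /vt[lP _ _] [-> _]].
Qed.

Lemma sign_of_inj t t' f i : f = Lm \/ f = Lp -> type_of t = type_of t' -> ~~ odd i ->
  (f, i) \in pairs t -> ((f, i, false) \in t) = ((f, i, false) \in t').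
Proof.
move=> fE E io ip; have pE : parts_of t f = parts_of t' f by rewrite -!parts_type E.
have ip' : i \in parts_of t f by rewrite mem_parts.
suff : sign_of t f i = sign_of t' f i by rewrite /sign_of io /= => /negb_inj.
case: fE pE ip' => -> pE ip'.
  have := congr1 (fun L => fnd (sgn_minus L) i) E.
  by rewrite /= !fnd_sgn_map -pE ip' => -[].
have := congr1 (fun L => fnd (sgn_plus L) i) E.
by rewrite /= !fnd_sgn_map -pE ip' => -[].
Qed.

(** Multiplicities determine the number of blocks for each (f, r), and for a
    normal list the sign tells whether one of them has b = false. *)
Lemma type_inj t t' : valid t -> valid t' -> sign_normal t -> sign_normal t' ->
  type_of t = type_of t' -> perm_eq t t'.
Proof.
move=> vt vt' nt nt' E.
have cE f r : count_mem (f, r) (pairs t) = count_mem (f, r) (pairs t').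
  by rewrite -!count_parts -!parts_type E.
have fE f r : count_mem (f, r, false) t = count_mem (f, r, false) t'.
  have [/andP[uf nr]|nu] := boolP (unitb f && ~~ odd r); last first.
    by rewrite !(count_memPn _) // valid_false.
  have [fr|fr] := boolP ((f, r) \in pairs t); last first.
    have fr' : (f, r) \notin pairs t' by rewrite -has_pred1 has_count -cE -has_count has_pred1.
    rewrite mem_pairs in fr; rewrite mem_pairs in fr'.
    by rewrite !(count_memPn _) //; [move: fr'|move: fr]; apply: contra => /(map_f fst).
  have fu : f = Lm \/ f = Lp by move: uf; rewrite unitbE => /orP[]/eqP ->; [left|right].
  have m := sign_of_inj fu E nr fr.
  have nE u (nu : sign_normal u) : count_mem (f, r, false) u = ((f, r, false) \in u).
    by have := nu _ r uf; rewrite -has_pred1 has_count; case: (count _ _) => [|[|?]].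
  by rewrite !nE // m.
apply/allP => -[[f r] []] _ /=; apply/eqP; last exact: fE.
apply/eqP; rewrite -(eqn_add2r (count_mem (f, r, false) t)) {2}fE.
by rewrite -(@eqn_pmul2l (unitb f && odd r).+1) // -!count_pairs cE.
Qed.

(** Hyperbolic labels are used half as often as the odd parts at t - 1 and t +
    1, whose multiplicity is even; an even part of sign -1 uses one label with
    b = false. *)
Lemma type_exists L : symplectic_function L ->
  exists t, [/\ valid t, sign_normal t & type_of t = L].
Proof.
case=> [[ptL PhiL] sm sp].
pose sg f := if f == Lm then sgn_at (sgn_minus L) else sgn_at (sgn_plus L).
pose c f r := count_mem r (parts L f).
(* The multiplicity of each label in the list to be built. *)
pose m l := let: (f, r, b) := l in
  if unitb f then
    if odd r then if b then (c f r)./2 else 0%N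
    else if b then (c f r - ~~ sg f r)%N else (~~ sg f r : nat)
  else if b then c f r else 0%N.
pose D : seq (label F) := [seq (x, b) | x <- [seq (f, r) | f <- finsupp (parts L), r <- undup (parts L f)], b <- [:: true; false]].
have uD : uniq D.
  apply: allpairs_uniq => //; last by move=> [? ?] [? ?] _ _ /= [-> ->].
  apply: allpairs_uniq_dep => [|f _|[f r] [f' r'] _ _ [-> ->]] //; last exact: undup_uniq.
  exact: fset_uniq.
have mD f r b : ((f, r, b) \in D) = (r \in parts L f).
  apply/allpairsP/idP => [[[x b'] [/= /allpairsPdep[f' [r' [_ rf ->]]] _ [-> -> _]]]|rf].
    by rewrite mem_undup in rf.
  exists ((f, r), b); split=> //=; last by case: b.
  apply/allpairsPdep; exists f, r; rewrite mem_undup; split=> //.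
  by rewrite mem_finsupp; apply: contraTneq rf => ->.
pose t := flatten [seq nseq (m l) l | l <- D].
have ct f r b : count_mem (f, r, b) t = if r \in parts L f then m (f, r, b) else 0%N.
  by rewrite /t count_flatten_nseq // mD.
have c0 f r : r \in parts L f -> (0 < c f r)%N by rewrite /c -has_count has_pred1.
have ev f r : unitb f -> odd r -> r \in parts L f -> ~~ odd (c f r).
  rewrite unitbE => /orP[]/eqP -> ro rf.
    by have [_ /(_ _ rf ro)[]] := sm.
  by have [_ /(_ _ rf ro)[]] := sp.
have cp f r : count_mem (f, r) (pairs t) = c f r.
  rewrite count_pairs !ct; case: ifP => rf; last first.
    by rewrite muln0 /c (count_memPn _) ?rf.
  rewrite /m; case: ifP => uf /=; last by rewrite mul1n addn0.
  case: ifP => ro /=.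
    by rewrite addn0 mul2n even_halfK ?ev.
  by rewrite mul1n; case: (sg f r) => /=; rewrite ?subn0 ?addn0 // subn1 addn1 prednK // c0.
have mt f r b : (f, r, b) \in t -> r \in parts L f /\ (0 < m (f, r, b))%N.
  have -> : ((f, r, b) \in t) = (0 < if r \in parts L f then m (f, r, b) else 0)%N.
    by rewrite -(ct f r b); apply: mem_count.
  by case: ifP.
have pE f : parts_of t f = parts L f.
  apply: sorted_count_eq; first exact: sorted_parts.
    by have /andP[] := ptL f.
  by move=> r; rewrite count_parts cp.
have gE f r : unitb f -> r \in parts L f -> sign_of t f r = if odd r then false else sg f r.
  move=> uf rf; rewrite /sign_of; case: (boolP (odd r)) => //= ro.
  have -> : ((f, r, false) \in t) = (0 < if r \in parts L f then m (f, r, false) else 0)%N.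
    by rewrite -(ct f r false); apply: mem_count.
  by rewrite rf /m uf (negPf ro); case: (sg f r).
have ft f r : (f, r, false) \in t -> unitb f && ~~ odd r.
  by case/mt => _; rewrite /m; case: ifP => //; case: ifP.
exists t; split.
- move=> [[f r] b] lt; have [rf _] := mt _ _ _ lt; split=> /=.
  + by apply: PhiL; apply: contraTneq rf => ->.
  + by rewrite lt0n; apply: contraTneq rf => ->; have /andP[] := ptL f.
  + by apply: contraNT => /negPf b0; move: lt; rewrite b0 => /ft.
- move=> f r uf; rewrite ct; case: ifP => // _; rewrite /m uf; case: ifP => //.
  by case: (sg f r).
apply: sp_ext => [f|i|i]; first by rewrite parts_type.
- rewrite /= fnd_sgn_map pE; have [[_ dom] od] := sp; case: ifP => ip; last first.
    by rewrite not_fnd // dom ip.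
  have uf : unitb Lp by rewrite unitbE eqxx orbT.
  rewrite gE //; case: ifP => io; first by have [_ ->] := od i ip io.
  have nLm : Lp != Lm.
    rewrite -subr_eq0 opprD addrACA subrr add0r opprK -polyC1 -polyCD polyC_eq0.
    exact: (two_neq0 oF).
  rewrite /sg (negPf nLm) /sgn_at; case: fndP => //=; by rewrite dom ip.
rewrite /= fnd_sgn_map pE; have [[_ dom] od] := sm; case: ifP => ip; last first.
  by rewrite not_fnd // dom ip.
have uf : unitb Lm by rewrite unitbE eqxx.
rewrite gE //; case: ifP => io; first by have [_ ->] := od i ip io.
rewrite /sg eqxx /sgn_at; case: fndP => //=; by rewrite dom ip.
Qed.

End TypeOf.

(** * Weights, modification and completion *)

Section Weights.
Variable F : finFieldType.
Hypothesis oF : odd #|F|.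
Implicit Types (f : {poly F}) (l : label F) (t : seq (label F)) (L : sp_data F).
Local Notation Lm := ('X - 1 : {poly F}).
Local Notation Lp := ('X + 1 : {poly F}).
Local Notation one_label := (one_label F).

Lemma Lp_neq_Lm : Lp != Lm.
Proof.
rewrite -subr_eq0 opprD addrACA subrr add0r opprK -polyC1 -polyCD polyC_eq0.
exact: (two_neq0 oF).
Qed.

Lemma weight_supp L (S : seq {poly F}) : uniq S -> {subset finsupp (parts L) <= S} ->
  weight L = (\sum_(f <- S) (size f).-1 * sumn (parts L f))%N.
Proof.
move=> uS sub; rewrite /weight (bigID (mem (finsupp (parts L))) predT) /=.
rewrite [X in _ = X](bigID (mem (finsupp (parts L))) predT) /=.
rewrite [X in (_ + X)%N]big1_seq ?[X in _ = (_ + X)%N]big1_seq ?addn0 => [|f|f].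
- rewrite -big_filter -[RHS]big_filter; apply: perm_big; apply: uniq_perm.
  + exact/filter_uniq/fset_uniq.
  + exact/filter_uniq.
  move=> f; rewrite !mem_filter; case: (boolP (f \in finsupp _)) => //= fs.
  by rewrite sub.
- by move=> /andP[/fsfun_dflt -> _]; rewrite muln0.
by move=> /andP[/fsfun_dflt -> _]; rewrite muln0.
Qed.

Definition pair_weight (x : {poly F} * nat) := ((size x.1).-1 * x.2)%N.
Definition label_weight l := ((hyperb l).+1 * pair_weight l.1)%N.
Definition weight_of t := (\sum_(l <- t) label_weight l)%N.

Lemma weight_pairs t : weight_of t = (\sum_(x <- pairs t) pair_weight x)%N.
Proof.
rewrite /pairs big_flatten big_map; apply: eq_bigr => l _.
by rewrite big_nseq iter_addn_0 mulnC.
Qed.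

Lemma sumn_exponents (P : seq ({poly F} * nat)) f : sumn (exponents P f) = (\sum_(x <- P | f == x.1) x.2)%N.
Proof. by rewrite sumnE big_map big_filter; apply: eq_bigl => x; rewrite eq_sym. Qed.

Lemma weight_type t : weight (type_of t) = weight_of t.
Proof.
rewrite weight_pairs (@weight_supp _ (undup [seq x.1 | x <- pairs t])) ?undup_uniq //; last first.
  move=> f; rewrite mem_finsupp parts_type mem_undup => fp.
  case E : (parts_of t f) fp => [|r p] // _.
  have : r \in parts_of t f by rewrite E mem_head.
  by rewrite mem_parts => /(map_f fst).
under eq_bigr => f _ do
  rewrite parts_type (perm_sumn (permEl (perm_sort _ _))) sumn_exponents big_distrr /=.
rewrite (exchange_big_dep predT) //= big_seq [RHS]big_seq; apply: eq_bigr => x xp.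
have xu : x.1 \in undup [seq x.1 | x <- pairs t] by rewrite mem_undup map_f.
rewrite -big_filter filter_pred1_uniq ?undup_uniq // big_seq1 //.
Qed.

(** Erasing the trivial planes is modification at the level of label lists. *)
Definition core t := [seq l <- t | l.1 != one_label.1].

Lemma core_perm t : valid t -> perm_eq t (core t ++ nseq (count_mem one_label t) one_label).
Proof.
move=> vt; rewrite -(perm_filterC (fun l => l.1 != one_label.1) t) perm_cat2l.
suff -> : [seq l <- t | predC (fun l => l.1 != one_label.1) l] = [seq l <- t | pred1 one_label l].
  by rewrite -size_filter; have /all_pred1P <- : all (pred1 one_label) [seq l <- t | pred1 one_label l] by apply: filter_all.
apply: eq_in_filter => -[[f r] b] lt /=; rewrite negbK.
rewrite [RHS](xpair_eqE (f, r) ('X - 1%:P, 1%N) b true); case: b lt => lt; rewrite ?andbT // andbF.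
apply/negbTE/negP => /eqP[fE rE]; have := valid_false vt (f := f) (r := r).
by rewrite lt rE andbF => /(_ isT).
Qed.

Lemma core_valid t : valid t -> valid (core t).
Proof. by apply: valid_sub => l; rewrite mem_filter => /andP[]. Qed.

Lemma core_normal t : sign_normal t -> sign_normal (core t).
Proof.
move=> nt f r /(nt f r); apply: leq_trans.
by rewrite count_filter; apply: sub_count => l /andP[].
Qed.

Lemma pairs_core t : pairs (core t) = [seq x <- pairs t | x != one_label.1].
Proof.
elim: t => // l t IHt; rewrite pairs_cons filter_cat -IHt filter_nseq /core /=.
by case: (l.1 != _); rewrite ?mul1n ?pairs_cons.
Qed.

Lemma parts_core t f : parts_of (core t) f = [seq r <- parts_of t f | (f, r) != one_label.1].
Proof.
rewrite /parts_of (filter_sort geq_total geq_trans).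
congr sort; rewrite /exponents pairs_core -!filter_predI filter_map -filter_predI; congr map.
by apply: eq_in_filter => -[g r] _ /=; case: eqP => [->|]; rewrite ?andbT ?andbF.
Qed.

Lemma parts_core_m t : valid t -> parts_of (core t) Lm = [seq r <- parts_of t Lm | (1 < r)%N].
Proof.
move=> vt; rewrite parts_core; apply: eq_in_filter => r rt.
rewrite xpair_eqE LmE eqxx /=; have /andP[_] := part_parts Lm vt.
by case: r rt => [|[|r]] //= ->.
Qed.

Lemma parts_core_n t f : f != Lm -> parts_of (core t) f = parts_of t f.
Proof.
move=> fm; rewrite parts_core; apply/all_filterP/allP => r _.
by rewrite xpair_eqE LmE (negPf fm).
Qed.

Lemma sign_core t f r : ((f, r) != one_label.1) -> sign_of (core t) f r = sign_of t f r.
Proof. by move=> fr; rewrite /sign_of mem_filter fr. Qed.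

(** The parts of size 1 at t - 1 are those that modification drops. *)
Lemma modification_core t : valid t -> modification (type_of (core t)) = modification (type_of t).
Proof.
move=> vt; have pE : [seq i.-1 | i <- parts (type_of (core t)) Lm & (1 < i)%N]
     = [seq i.-1 | i <- parts (type_of t) Lm & (1 < i)%N].
  rewrite !parts_type parts_core_m // -filter_predI; congr map; apply: eq_filter => i /=.
  by rewrite andbb.
apply: sp_ext => [f|i|i].
- rewrite /modification pE; cbn [parts]; rewrite !fsfun_withE; case: eqP => // /eqP fm.
  by rewrite !parts_type parts_core_n.
- rewrite /modification /type_of; cbn [sgn_plus].
  rewrite !fnd_sgn_map parts_core_n ?Lp_neq_Lm // sign_core //.
  by rewrite xpair_eqE LmE (negPf Lp_neq_Lm).
rewrite /modification pE; cbn [sgn_minus]; rewrite !fnd_sgn_map; case: ifP => // ip.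
congr Some; rewrite /sgn_at /type_of; cbn [sgn_minus]; rewrite !fnd_sgn_map.
have [j] := mapP ip; rewrite mem_filter parts_type => /andP[j1 jp] iE.
have ij : i.+1 = j by rewrite iE prednK // ltnW.
by rewrite ij parts_core_m // mem_filter j1 jp sign_core // xpair_eqE (gtn_eqF j1) andbF.
Qed.

Lemma completion_modification t : valid t -> completion (modification (type_of t)) = type_of (core t).
Proof.
move=> vt; set M := modification _.
have pM : parts M Lm = [seq i.-1 | i <- parts_of t Lm & (1 < i)%N].
  by rewrite /M /modification; cbn [parts]; rewrite fsfun_with parts_type.
have pE : [seq i.+1 | i <- parts M Lm] = parts_of (core t) Lm.
  rewrite pM parts_core_m // -map_comp map_id_in // => i; rewrite mem_filter => /andP[i1 _] /=.
  by rewrite prednK // ltnW.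
apply: sp_ext => [f|i|i].
- rewrite /completion pE; cbn [parts]; rewrite fsfun_withE parts_type; case: eqP => [->//|/eqP fm].
  by rewrite /M /modification; cbn [parts]; rewrite fsfun_withE (negPf fm) parts_type parts_core_n.
- rewrite /completion /M /modification /type_of; cbn [sgn_plus].
  rewrite !fnd_sgn_map parts_core_n ?Lp_neq_Lm // sign_core //.
  by rewrite xpair_eqE LmE (negPf Lp_neq_Lm).
rewrite /completion pE; cbn [sgn_minus]; rewrite /type_of; cbn [sgn_minus]; rewrite !fnd_sgn_map; case: ifP => // ip.
move: (ip); rewrite parts_core_m // mem_filter => /andP[i1 it].
have i10 : i.-1.+1 = i by rewrite prednK // ltnW.
rewrite sign_core ?xpair_eqE ?(gtn_eqF i1) ?andbF //; congr Some.
rewrite /sgn_at /M /modification; cbn [sgn_minus]; rewrite fnd_sgn_map.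
have -> : i.-1 \in [seq j.-1 | j <- parts (type_of t) Lm & (1 < j)%N].
  by apply: map_f; rewrite mem_filter i1 parts_type it.
by rewrite /= i10 /sgn_at /type_of; cbn [sgn_minus]; rewrite fnd_sgn_map it.
Qed.

Lemma label_weight1 : label_weight one_label = 2%N.
Proof.
by rewrite /label_weight /hyperb /pair_weight /= unitbE LmE eqxx /= -LmE size_XsubC.
Qed.

Lemma weight_cat t t' : weight_of (t ++ t') = (weight_of t + weight_of t')%N.
Proof. by rewrite /weight_of big_cat. Qed.

Lemma weight_ones k : weight_of (nseq k one_label) = k.*2.
Proof. by rewrite /weight_of big_nseq label_weight1 iter_addn_0 mul2n. Qed.

Lemma weight_core t : valid t -> weight_of t = (weight_of (core t) + (count_mem one_label t).*2)%N.
Proof. move=> /core_perm E; rewrite -weight_ones -weight_cat; exact: perm_big. Qed.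

Lemma type_perm t t' : perm_eq t t' -> type_of t = type_of t'.
Proof.
move=> tt'; have pE f : parts_of t f = parts_of t' f.
  apply: sorted_count_eq; rewrite ?sorted_parts // => r.
  rewrite !count_parts !count_pairs; have /seq.permP p := tt'.
  by rewrite !p.
have sE f r : sign_of t f r = sign_of t' f r by rewrite /sign_of (perm_mem tt').
by apply: sp_ext => [f|i|i]; rewrite ?parts_type // /type_of;
  [cbn [sgn_plus]|cbn [sgn_minus]]; rewrite !fnd_sgn_map pE sE.
Qed.

Lemma pairs_cat t t' : pairs (t ++ t') = pairs t ++ pairs t'.
Proof. by rewrite /pairs map_cat flatten_cat. Qed.

Lemma pairs_ones k : pairs (nseq k one_label) = nseq k.*2 one_label.1.
Proof.
elim: k => // k IHk; rewrite pairs_cons IHk doubleS.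
by rewrite /hyperb unitbE /= LmE eqxx.
Qed.

(** Each trivial plane contributes two parts of size 1 at t - 1. *)
Lemma nth_completion_modification n t k : valid t -> n.*2 = (weight_of (core t) + k.*2)%N ->
  nth_completion n (modification (type_of t)) = type_of (core t ++ nseq k one_label).
Proof.
move=> vt nE; rewrite /nth_completion completion_modification // weight_type nE addKn.
have up : unitb Lm by rewrite unitbE eqxx.
have pE f : f != Lm -> parts_of (core t ++ nseq k one_label) f = parts_of (core t) f.
  move=> fm; rewrite -parts_core_n // -[in RHS](@parts_core_n (core t)) //.
  congr (parts_of _ f); rewrite /core filter_cat.
  by rewrite [X in _ ++ X](_ : _ = [::]) ?cats0 // filter_nseq /= eqxx.
have pm : parts (type_of (core t)) Lm ++ nseq k.*2 1%N = parts_of (core t ++ nseq k one_label) Lm.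
  rewrite parts_type; apply: sorted_count_eq; last first.
  + move=> r; rewrite count_cat !count_parts pairs_cat count_cat pairs_ones !count_nseq.
    by congr (_ + _ * _)%N; rewrite /= xpair_eqE LmE eqxx.
  + exact: sorted_parts.
  rewrite (sorted_pairwise geq_trans) pairwise_cat -!(sorted_pairwise geq_trans) sorted_parts /=.
  apply/andP; split; last first.
    by elim: (k.*2) => [|[|j]] //=.
  apply/allrelP => a b ac; rewrite mem_nseq => /andP[_ /eqP ->] /=.
  have /andP[_ z] := part_parts Lm (core_valid vt).
  by rewrite lt0n; apply: contraNneq z => <-.
apply: sp_ext => [f|i|i].
- rewrite [RHS]parts_type; cbn [parts]; rewrite fsfun_withE pm; case: eqP => [->//|/eqP fm].
  by rewrite parts_type pE.
- rewrite /type_of; cbn [sgn_plus]; rewrite !fnd_sgn_map pE ?Lp_neq_Lm //.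
  case: ifP => // _; rewrite /sign_of mem_cat mem_nseq /= xpair_eqE xpair_eqE LmE (negPf Lp_neq_Lm) /= andbF orbF.
  by [].
rewrite pm [type_of (_ ++ _)]/type_of; cbn [sgn_minus]; rewrite !fnd_sgn_map; case: ifP => // ip.
congr Some; rewrite /sign_of mem_cat mem_nseq xpair_eqE andbF andbF orbF.
case: eqP => [-> //|/eqP i1]; rewrite /sgn_at /type_of; cbn [sgn_minus]; rewrite fnd_sgn_map.
move: ip; rewrite -pm mem_cat mem_nseq (negPf i1) andbF orbF parts_type => ->.
by rewrite /= /sign_of.
Qed.

(** Modification takes 1 from each part at t - 1, a polynomial of degree 1. *)
Lemma weight_modification L : symplectic_function L ->
  (weight (modification L) + size (parts L Lm) = weight L)%N.
Proof.
case=> [[pt _] _ _].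
pose S := (Lm |` finsupp (parts L))%fset.
have mS : Lm \in S by rewrite !inE eqxx.
rewrite (@weight_supp L S) ?fset_uniq //; last by move=> f fs; rewrite !inE fs orbT.
rewrite (@weight_supp _ S) ?fset_uniq //; last first.
  move=> f; rewrite mem_finsupp /modification; cbn [parts]; rewrite fsfun_withE.
  case: (f =P Lm) => [->//|_]; rewrite -mem_finsupp => fs; by rewrite !inE fs orbT.
rewrite !(bigD1_seq Lm mS) ?fset_uniq //= addnAC; congr (_ + _)%N; last first.
  apply: eq_bigr => f fm; rewrite /modification; cbn [parts].
  by rewrite fsfun_withE (negPf fm).
rewrite /modification; cbn [parts]; rewrite fsfun_with -LmE size_XsubC !mul1n LmE.
have /andP[_] := pt Lm; elim: (parts L Lm) => //= i p IHp; rewrite inE negb_or => /andP[i0 /IHp <-].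
by case: i i0 => [|[|i]] //= _; rewrite ?addnS -?addnA.
Qed.
End Weights.

(** * Invariance of the exponents *)

Section CyclicSum.
Variables (F : finFieldType) (N : nat) (U : 'M[F]_N).
Implicit Types (W : {vspace 'cV[F]_N}) (p q : {poly F}).

Lemma cyclic_ext W k (a a' : 'I_k -> {poly F}) b : a =1 a' -> cyclic_sum U W a b -> cyclic_sum U W a' b.
Proof. by move=> E [c1 c2]; split=> // p; rewrite c2; split=> h j; rewrite ?E // -E. Qed.

(** Counting: remainders modulo the a j parametrise W bijectively, so the
    cardinal of W is the power of #|F| with the stated exponent. *)
Lemma cyc_dim W k (a : 'I_k -> {poly F}) b : (forall j, a j != 0) -> cyclic_sum U W a b ->
  \dim W = (\sum_j (size (a j)).-1)%N.
Proof.
move=> a0 [WE ker]; pose d j := (size (a j)).-1.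
have dE j : size (a j) = (d j).+1 by rewrite prednK ?size_poly_gt0.
pose T := {dffun forall j : 'I_k, {poly_(d j) F}}.
pose f (p : T) : 'cV[F]_N := \sum_j poly_act U (val (p j)) *m b j.
have f_inj : injective f.
  move=> p p' E; apply/ffunP => j; apply: val_inj.
  have : \sum_j poly_act U (val (p j) - val (p' j)) *m b j = 0.
    have := E; rewrite /f => /eqP; rewrite -subr_eq0 -sumrB => /eqP E'.
    rewrite -[RHS]E'; apply: eq_bigr => i _.
    by rewrite linearB /= mulmxBl.
  move/ker => /(_ j) dv; apply/eqP; rewrite -subr_eq0; apply/contraT => nz.
  have := dvdp_leq nz dv; rewrite leqNgt dE ltnS.
  rewrite (leq_trans (size_polyD _ _)) // size_polyN geq_max.
  by rewrite !size_npoly.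
have fW : [set f p | p in [set: T]] = [set w in W].
  apply/setP => w; rewrite inE; apply/imsetP/idP => [[p _ ->]|/WE[q ->]].
    by apply/WE; exists (fun j => val (p j)).
  have sz j : (size (q j %% a j)%R <= d j)%N by rewrite -ltnS -dE ltn_modp.
  exists [ffun j => NPoly (sz j)]; rewrite ?inE //.
  apply: eq_bigr => j _; rewrite ffunE /=.
  have h0 : poly_act U (a j) *m b j = 0.
    have := (ker (fun i => if i == j then a j else 0)).2.
    rewrite (bigD1 j) //= eqxx big1 ?addr0; first by apply=> i; case: eqP => [->|]; rewrite ?dvdp0.
    by move=> i /negPf ->; rewrite linear0 mul0mx.
  rewrite {1}(divp_eq (q j) (a j)) linearD /= mulmxDl poly_actM -mulmxA h0 mulmx0 add0r //.
have F1 : (1 < #|F|)%N by apply: card_finRing_gt1.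
apply/eqP; rewrite -(eqn_exp2l _ _ F1) -card_vspace.
have -> : #|W| = #|[set w in W]| by rewrite cardsE.
rewrite -fW card_imset // cardsT card_dep_ffun expn_sum foldrE big_map big_enum /=.
by apply/eqP; apply: eq_bigr => j _; rewrite card_npoly.
Qed.

(** q F[t]/(a) is F[t]/(a / gcd(a, q)). *)
Lemma cyc_image W k (a : 'I_k -> {poly F}) b q : (forall j, a j != 0) -> cyclic_sum U W a b ->
  cyclic_sum U (mximg (poly_act U q) W) (fun j => a j %/ gcdp (a j) q) (fun j => poly_act U q *m b j).
Proof.
move=> a0 [WE ker].
have E (p : 'I_k -> {poly F}) : \sum_j poly_act U (p j) *m (poly_act U q *m b j) = \sum_j poly_act U (p j * q) *m b j.
  by apply: eq_bigr => j _; rewrite mulmxA -poly_actM.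
have E' (p : 'I_k -> {poly F}) : \sum_j poly_act U (p j) *m (poly_act U q *m b j) = poly_act U q *m \sum_j poly_act U (p j) *m b j.
  by rewrite mulmx_sumr; apply: eq_bigr => j _; rewrite !mulmxA poly_actMC.
split=> [w|p].
  rewrite mem_mximg; split=> [[x /WE[p ->] ->]|[p ->]]; first by exists p; rewrite E'.
  by exists (\sum_j poly_act U (p j) *m b j); rewrite ?E' //; apply/WE; exists p.
rewrite E (ker (fun j => p j * q)); split=> h j; have := h j; set g := gcdp (a j) q.
  have g0 : g != 0 by rewrite gcdp_eq0 negb_and a0.
  have aE := divpK (dvdp_gcdl (a j) q); have qE := divpK (dvdp_gcdr (a j) q).
  rewrite -[X in X %| _ -> _]aE -[X in _ %| _ * X -> _]qE -/g mulrA dvdp_mul2r //.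
  rewrite Gauss_dvdpl //; apply: coprimep_div_gcd; by rewrite a0.
rewrite -[X in _ -> X %| _](divpK (dvdp_gcdl (a j) q)) -/g => dv.
by rewrite dvdp_mul ?dvdp_gcdr.
Qed.

Lemma cyc_kill W k (a : 'I_k -> {poly F}) b j : cyclic_sum U W a b -> poly_act U (a j) *m b j = 0.
Proof.
case=> _ ker; have := (ker (fun i => if i == j then a j else 0)).2.
rewrite (bigD1 j) //= eqxx big1 ?addr0; first by apply=> i; case: eqP => [->|]; rewrite ?dvdp0.
by move=> i /negPf ->; rewrite linear0 mul0mx.
Qed.
End CyclicSum.

Section Exponents.
Variables (F : finFieldType).
Implicit Types (s : seq ({poly F} * nat)).

Lemma gcdp_prime_pow (f g : {poly F}) r k : f \is monic -> irreducible_poly f -> g \is monic -> irreducible_poly g ->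
  (size (f ^+ r %/ gcdp (f ^+ r) (g ^+ k))).-1 = ((size f).-1 * (r - (if f == g then minn r k else 0)))%N.
Proof.
move=> fm fi gm gi.
have f0 : f != 0 by apply: monic_neq0.
have [->|fg] := eqVneq f g.
  have g0 : g != 0 by apply: monic_neq0.
  have [rk|kr] := leqP r k.
    rewrite subnn muln0; have dv : g ^+ r %| g ^+ k by apply: dvdp_exp2l.
    have e := dvdp_gcd_idl dv; rewrite (eqp_size (eqp_divr _ e)) divpp ?expf_neq0 // size_poly1 //.
  have dv : g ^+ k %| g ^+ r by apply: dvdp_exp2l; apply: ltnW.
  have e := dvdp_gcd_idr dv; rewrite (eqp_size (eqp_divr _ e)).
  by rewrite -(subnK (ltnW kr)) exprD mulpK ?expf_neq0 // size_exp addnK.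
have cop : coprimep (f ^+ r) (g ^+ k).
  apply: coprimep_expl; apply: coprimep_expr; apply: contraNT fg.
  rewrite (irreducible_poly_coprime _ fi) negbK => dv; have := gi.2 f _ dv.
  by rewrite eqp_monic //; apply; rewrite gtn_eqF //; case: fi.
rewrite subn0; have e : gcdp (f ^+ r) (g ^+ k) %= 1 by rewrite -size_poly_eq1.
by rewrite (eqp_size (eqp_divr _ e)) divp1 size_exp.
Qed.

(** The increments in k count the elements larger than k, and their increments
    count the elements equal to k. *)
Lemma minn_sum_inj (l l' : seq nat) : 0%N \notin l -> 0%N \notin l' ->
  (forall k, (\sum_(r <- l) minn r k = \sum_(r <- l') minn r k)%N) -> perm_eq l l'.
Proof.
move=> l0 l0' E; have step m k : (\sum_(r <- m) minn r k.+1 = \sum_(r <- m) minn r k + count (fun r => k < r) m)%N.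
  elim: m => [|r m IHm] /=; first by rewrite !big_nil.
  rewrite !big_cons IHm addnACA; congr (_ + _)%N.
  by clear; lia.
have gt k : count (fun r => k < r)%N l = count (fun r => k < r)%N l'.
  by have := E k.+1; rewrite !step E => /addnI.
have cnt m k : (count_mem k.+1 m + count (fun r => k.+1 < r) m = count (fun r => k < r) m)%N.
  by elim: m => [|r m IHm] //=; rewrite addnACA IHm; congr (_ + _)%N; case: (ltngtP k.+1 r).
apply/allP => -[|k] _ /=; first by rewrite !(count_memPn _).
have := gt k; rewrite -(cnt l) -(cnt l') gt => /addIn ->; exact: eqxx.
Qed.

Variables (N : nat) (U : 'M[F]_N).

(** Each summand F[t]/(g^r) loses deg(g) * min(r, k) dimensions under g^k, the
    summands at other primes lose none. So the ranks of the g(U)^k determine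
    the exponents. *)
Lemma primary_rank s g k : primary_decomposition U s -> g \is monic -> irreducible_poly g ->
  (\dim (mximg (poly_act U (g ^+ k)) fullv) + (size g).-1 * \sum_(r <- exponents s g) minn r k = N)%N.
Proof.
case=> sP [b cs] gm gi.
have sP' j := sP _ (mem_tnth j (in_tuple s)).
have a0 j : (tnth (in_tuple s) j).1 ^+ (tnth (in_tuple s) j).2 != 0.
  by have [m _ _] := sP' j; rewrite expf_neq0 // monic_neq0.
have dN := cyc_dim a0 cs; rewrite dimvf /dim /= muln1 in dN.
rewrite (cyc_dim _ (cyc_image (g ^+ k) a0 cs)); last first.
  by move=> j; rewrite divp_eq0 !negb_or a0 gcdp_eq0 negb_and a0 -leqNgt leq_gcdpl.
have -> : (\sum_(r <- exponents s g) minn r k = \sum_(j < size s) if (tnth (in_tuple s) j).1 == g then minn (tnth (in_tuple s) j).2 k else 0)%N.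
  rewrite /exponents big_map big_filter big_mkcond /=.
  by rewrite (big_tnth _ _ s).
rewrite big_distrr -big_split [RHS]dN; apply: eq_bigr => j _ /=.
have [m i _] := sP' j; rewrite gcdp_prime_pow // size_exp.
case: eqP => [<-|_]; last by rewrite muln0 addn0 subn0.
by rewrite -mulnDr subnK // geq_minl.
Qed.

Lemma exponents_uniq s s' g : primary_decomposition U s -> primary_decomposition U s' ->
  g \is monic -> irreducible_poly g -> perm_eq (exponents s g) (exponents s' g).
Proof.
move=> d d' gm gi.
have n0 t : primary_decomposition U t -> 0%N \notin exponents t g.
  case=> tP _; rewrite mem_exponents; apply/negP => /tP[] //.
apply: minn_sum_inj; [exact: n0|exact: n0|move=> k].
have /eqP := etrans (primary_rank k d gm gi) (esym (primary_rank k d' gm gi)).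
rewrite eqn_add2l eqn_pmul2l; first by move/eqP.
by case: gi; case: (size g) => [|[]].
Qed.

Lemma primary_bound s x : primary_decomposition U s -> x \in s -> (x.2 <= N)%N.
Proof.
move=> d xs; have [/(_ x xs)[xm xi x0] _] := d.
have <- := primary_rank x.2 d xm xi.
have x1 : (0 < (size x.1).-1)%N by case: xi; case: (size x.1) => [|[]].
apply: leq_trans (leq_addl _ _); apply: leq_trans (leq_pmull _ x1).
have xe : x.2 \in exponents s x.1 by rewrite mem_exponents -surjective_pairing.
by rewrite (big_rem _ xe) /= minnn leq_addr.
Qed.
End Exponents.

(** * Primary decomposition from blocks *)

Section Phis.
Variable F : finFieldType.
Implicit Types (f g : {poly F}).

(** The element of Phi^s at which the partition of an irreducible g is
    recorded. *)
Definition self_dual_part g := if g == dual g then g else g * dual g.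

Lemma Phi_dvd_eq f g : is_Phi f -> is_Phi g -> f %| g -> f = g.
Proof.
case=> [fm [sf _] _] [gm gi _] fg; have := gi.2 f _ fg; rewrite eqp_monic // => E.
by apply/eqP/E; rewrite gtn_eqF.
Qed.

Lemma Phi_dvdM f g h : is_Phi f -> is_Phi g -> is_Phi h -> f %| g * h -> f = g \/ f = h.
Proof.
move=> fP gP hP; have [->|fg] := eqVneq f g; first by left.
by rewrite Gauss_dvdpr ?Phi_coprime // => /(Phi_dvd_eq fP hP); right.
Qed.

Lemma self_dual_part_self f g : is_Phi f -> f = dual f -> is_Phi g -> (f == self_dual_part g) = (f == g).
Proof.
move=> fP fd gP; rewrite /self_dual_part; case: (g =P dual g) => // gd.
apply/eqP/eqP => [E|fg]; last by case: gd; rewrite -fg.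
have gf : g = f by apply: Phi_dvd_eq => //; rewrite E dvdp_mulr.
by rewrite gf in gd.
Qed.

Lemma self_dual_part_pair f g : is_Phi f -> f <> dual f -> is_Phi g ->
  (f * dual f == self_dual_part g) = (f == g) || (dual f == g).
Proof.
move=> fP fd gP; have dP := Phi_dual fP; have [fm fi _] := fP.
have fdd : dual (dual f) = f by apply: dualK => //; apply: Phi_neq0.
apply/eqP/idP => [E|/orP[]/eqP <-]; rewrite /self_dual_part; last 2 first.
- by case: (f =P dual f).
- by rewrite fdd; case: (dual f =P f) => [E|_]; [case: fd|rewrite mulrC].
have : g %| f * dual f.
  by rewrite E /self_dual_part; case: ifP => _; rewrite ?dvdp_mulr.
by case/(Phi_dvdM gP fP dP) => ->; rewrite eqxx ?orbT.
Qed.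

End Phis.

Section Csum.
Variables (F : finFieldType) (N : nat) (J U : 'M[F]_N) (e : nat).
Hypothesis (H : symp J U e).
Implicit Types (W : {vspace 'cV[F]_N}) (p q : {poly F}) (s : seq ({poly F} * nat)).

(** A direct sum of the primary cyclic modules listed in s. It is built one
    block at a time. *)
Definition csum W s := exists b, cyclic_sum U W
  (fun j : 'I_(size s) => (tnth (in_tuple s) j).1 ^+ (tnth (in_tuple s) j).2) b.

Lemma csum0 : csum 0 [::].
Proof.
exists (fun=> 0); split=> [w|p]; last by rewrite big_ord0; split=> // _ [].
by rewrite memv0; split=> [/eqP ->|[p ->]]; [exists (fun=> 0)|]; rewrite big_ord0.
Qed.

Lemma csum_cons (x : {poly F} * nat) s W1 W2 v :
  (forall w, w \in W1 <-> exists p, w = pact U p v) ->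
  (forall p, pact U p v = 0 <-> x.1 ^+ x.2 %| p) -> csum W2 s ->
  (W1 :&: W2 = 0)%VS -> csum (W1 + W2) (x :: s).
Proof.
move=> W1E av [b [W2E ker]] cap.
pose b' (j : 'I_(size s).+1) := if unlift ord0 j is Some i then b i else v.
have b0 : b' ord0 = v by rewrite /b' unlift_none.
have bS i : b' (lift ord0 i) = b i by rewrite /b' liftK.
have sumE (p : 'I_(size s).+1 -> {poly F}) :
    \sum_j pact U (p j) (b' j) = pact U (p ord0) v + \sum_i pact U (p (lift ord0 i)) (b i).
  by rewrite big_ord_recl b0; congr (_ + _); apply: eq_bigr => i _; rewrite bS.
have in1 p : pact U p v \in W1 by apply/W1E; exists p.
have in2 (p : 'I_(size s) -> {poly F}) : \sum_i pact U (p i) (b i) \in W2 by apply/W2E; exists p.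
have tS i : tnth (in_tuple (x :: s)) (lift ord0 i) = tnth (in_tuple s) i.
  by rewrite (tnth_nth x) [RHS](tnth_nth x).
have t0 : tnth (in_tuple (x :: s)) ord0 = x by rewrite (tnth_nth x).
exists b'; split=> [w|p].
  split=> [/memv_addP[_ /W1E[p ->] [_ /W2E[q ->] ->]]|[p ->]]; last first.
    by rewrite sumE memv_add.
  exists (fun j => if unlift ord0 j is Some i then q i else p).
  rewrite sumE unlift_none; congr (_ + _); apply: eq_bigr => i _; by rewrite liftK.
rewrite sumE; split=> [E j|dv].
  have z : pact U (p ord0) v = 0.
    apply/eqP; rewrite -memv0 -cap memv_cap in1 /=.
    move/eqP: E; rewrite addr_eq0 => /eqP ->; rewrite memvN //; exact: in2.
  case: (unliftP ord0 j) => [i|] ->; last by rewrite t0; apply/av.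
  rewrite tS; move: i; apply/(ker (fun i => p (lift ord0 i))).
  by rewrite z add0r in E.
have -> : pact U (p ord0) v = 0 by apply/av; have := dv ord0; rewrite t0.
rewrite add0r; apply/(ker (fun i => p (lift ord0 i))) => i.
by have := dv (lift ord0 i); rewrite tS.
Qed.

Lemma csum_cons2 (x y : {poly F} * nat) s W1 W2 v w :
  (forall z, z \in W1 <-> exists p q, z = pact U p v + pact U q w) ->
  (forall p q, pact U p v + pact U q w = 0 <-> x.1 ^+ x.2 %| p /\ y.1 ^+ y.2 %| q) -> csum W2 s ->
  (W1 :&: W2 = 0)%VS -> csum (W1 + W2) [:: x, y & s].
Proof.
move=> W1E av c2 cap.
have -> : W1 = (cycl U e v + cycl U e w)%VS.
  apply/eqP; rewrite eqEsubv; apply/andP; split; apply/subvP => z.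
    by case/W1E => p [q ->]; apply: memv_add; apply/(mem_cycl H); [exists p|exists q].
  case/memv_addP => _ /(mem_cycl H)[p ->] [_ /(mem_cycl H)[q ->] ->].
  by apply/W1E; exists p, q.
rewrite -addvA.
apply: (csum_cons (v := v)) => [z|p||]; first exact: mem_cycl H _ _.
- have := av p 0; rewrite linear0 mul0mx addr0 => ->.
  by split=> [[]|] //; rewrite dvdp0.
- apply: (csum_cons (v := w)) => // [z|q|]; first exact: mem_cycl H _ _.
    have := av 0 q; rewrite linear0 mul0mx add0r => ->.
    by split=> [[]|] //; rewrite dvdp0.
  apply/eqP; rewrite -subv0 -cap; apply/subvP => z; rewrite !memv_cap => /andP[/(mem_cycl H)[q ->] ->].
  by rewrite andbT; apply/W1E; exists 0, q; rewrite linear0 mul0mx add0r.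
apply/eqP; rewrite -subv0; apply/subvP => z; rewrite memv_cap => /andP[/(mem_cycl H)[p ->]].
case/memv_addP => _ /(mem_cycl H)[q ->] [w2 w2W E].
have z2 : pact U p v + pact U (- q) w = 0.
  apply/eqP; rewrite -memv0 -cap memv_cap; apply/andP; split; first by apply/W1E; exists p, (- q).
  by rewrite linearN /= mulNmx E addrAC subrr add0r.
have [xp _] := (av p (- q)).1 z2.
have := (av p 0).2; rewrite linear0 mul0mx addr0 => ->; first exact: mem0v.
by rewrite dvdp0.
Qed.

(** The two cyclic modules of a hyperbolic block are independent: each
    component is detected by pairing with the other isotropic copy. *)
Lemma hyp_indep W f r v w p q : is_Phi_s f -> hyp_block J U W (f ^+ r) v w ->
  pact U p v + pact U q w = 0 -> f ^+ r %| p /\ f ^+ r %| q.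
Proof.
move=> fP hb E; have hs := star_hyp H fP hb; have [WE [hv hw] [vv ww] hp] := hb.
have hdv : f ^+ r %| p.
  apply: hp => y; rewrite mulrC poly_actM -mulmxA.
  move/eqP: E; rewrite addr_eq0 => /eqP ->.
  by rewrite mulmxN bformNl mulmxA -poly_actM ww oppr0.
split=> //; have qw : pact U q w = 0.
  by move: E; rewrite (dvdp_act hdv hv) add0r.
have hsq : f ^+ r %| star e q.
  by apply: hp => y; rewrite poly_actM -mulmxA -(bform_actr H) qw bform0r.
apply: hp => y; have /dvdpP[z zE] := hsq.
have : pact U (star e (star e q)) v = 0.
  rewrite zE starM; apply: (@dvdp_act _ _ _ (f ^+ r)) => //; exact: dvdp_mull.
by rewrite (act_starK H) mulrC poly_actM -mulmxA => ->; rewrite mulmx0 bform0l.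
Qed.

(** Chinese remainders, which split a block at g * dual g into its primary
    parts. *)
Lemma cyc_pair W (h1 h2 : {poly F}) v : h1 != 0 -> h2 != 0 -> coprimep h1 h2 ->
  cyc_block J U W (h1 * h2) v ->
  (forall z, z \in W <-> exists p q, z = pact U p (pact U h2 v) + pact U q (pact U h1 v)) /\
  (forall p q, pact U p (pact U h2 v) + pact U q (pact U h1 v) = 0 <-> h1 %| p /\ h2 %| q).
Proof.
move=> h10 h20 cop cb; have [WE hv _] := cb.
have E p q : pact U p (pact U h2 v) + pact U q (pact U h1 v) = pact U (p * h2 + q * h1) v.
  by rewrite linearD /= mulmxDl !poly_actM !mulmxA.
split=> [z|p q].
  rewrite WE; split=> [[p ->]|[p [q ->]]]; last by exists (p * h2 + q * h1); rewrite E.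
  have [[a b] /= ab] := Bezout_eq1_coprimepP _ _ cop.
  exists (p * b), (p * a); rewrite E; congr (pact U _ v).
  by rewrite -[LHS]mulr1 -ab mulrDr !mulrA addrC.
rewrite E (cyc_block_ann _ cb); split=> [dv|[/dvdpP[p' ->] /dvdpP[q' ->]]].
  split.
    have : h1 %| p * h2 + q * h1 by apply: dvdp_trans dv; apply: dvdp_mulr.
    by rewrite (dvdp_addl _ (dvdp_mull _ (dvdpp h1))) Gauss_dvdpl.
  have : h2 %| p * h2 + q * h1 by apply: dvdp_trans dv; apply: dvdp_mull.
  by rewrite (dvdp_addr _ (dvdp_mull _ (dvdpp h2))) Gauss_dvdpl // coprimep_sym.
by rewrite -!mulrA [h2 * h1]mulrC; apply: dvdp_add; apply: dvdp_mull; apply: dvdpp.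
Qed.

Lemma exponents_cat s1 s2 (g : {poly F}) : exponents (s1 ++ s2) g = exponents s1 g ++ exponents s2 g.
Proof. by rewrite /exponents filter_cat map_cat. Qed.

Lemma exponents_nseq k f r (g : {poly F}) : exponents (nseq k (f, r)) g = if f == g then nseq k r else [::].
Proof. by rewrite /exponents filter_nseq /=; case: eqP; rewrite ?mul1n ?map_nseq. Qed.

(** s lists the primary summands of the blocks in t. A block at g * dual g
    gives one summand at g and one at dual g. *)
Definition primary_of (t : seq (label F)) s :=
  (forall x, x \in s -> [/\ x.1 \is monic, irreducible_poly x.1, (0 < x.2)%N
      & exists2 l, l \in t & x.1 %| l.1.1 /\ x.2 = l.1.2]) /\
  forall g, is_Phi g -> exponents s g = exponents (pairs t) (self_dual_part g).

Lemma block_csum W1 W2 l t s : block_on J U W1 l -> csum W2 s -> (W1 :&: W2 = 0)%VS ->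
  primary_of t s -> exists2 s', csum (W1 + W2) s' & primary_of (l :: t) s'.
Proof.
case: l => [[f r] d] [/= fP r0 b] cs cap [sP sE].
have fm := Phi_s_monic fP.
have sP' x : x \in s -> [/\ x.1 \is monic, irreducible_poly x.1, (0 < x.2)%N
      & exists2 l, l \in (f, r, d) :: t & x.1 %| l.1.1 /\ x.2 = l.1.2].
  by case/sP => xm xi x0 [l lt lE]; split=> //; exists l; rewrite // inE lt orbT.
suff [u cu [uP uE]] : exists2 u, csum (W1 + W2) (u ++ s) &
    (forall x, x \in u -> [/\ x.1 \is monic, irreducible_poly x.1, x.1 %| f & x.2 = r]) /\
    (forall g, is_Phi g -> exponents u g =
       if f == self_dual_part g then nseq (hyperb (f, r, d)).+1 r else [::]).
  exists (u ++ s) => //; split=> [x|g gP].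
    rewrite mem_cat => /orP[/uP[xm xi xf xr]|/sP' //]; split=> //; first by rewrite xr.
    by exists (f, r, d); rewrite ?mem_head.
  by rewrite exponents_cat sE // uE // pairs_cons exponents_cat -[(f, r, d).1]/(f, r) exponents_nseq.
have cyc v : cyc_block J U W1 (f ^+ r) v -> hyperb (f, r, d) = false ->
    exists2 u, csum (W1 + W2) (u ++ s) &
    (forall x, x \in u -> [/\ x.1 \is monic, irreducible_poly x.1, x.1 %| f & x.2 = r]) /\
    (forall g, is_Phi g -> exponents u g =
       if f == self_dual_part g then nseq (hyperb (f, r, d)).+1 r else [::]).
  move=> cb nh; have [WE hv hp] := cb; rewrite nh.
  case: (fP) => [[fPhi fd]|[g0 [gP gd fE]]].
    exists [:: (f, r)].
      by apply: (csum_cons (v := v)) => // p; apply: cyc_block_ann cb.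
    split=> [x|g gP]; last by rewrite self_dual_part_self // -[[:: _]]/(nseq 1 (f, r)) exponents_nseq.
    by rewrite inE => /eqP ->; have [_ fi _] := fPhi.
  have dP := Phi_dual gP; have [gm gi _] := gP; have [dm di _] := dP.
  exists [:: (g0, r); (dual g0, r)].
    rewrite fE exprMn in cb.
    have [|||z1 z2] := cyc_pair _ _ _ cb; rewrite ?expf_neq0 ?monic_neq0 //.
      by apply: coprimep_expl; apply: coprimep_expr; apply: Phi_coprime => //; apply/eqP.
    exact: (csum_cons2 (x := (g0, r)) (y := (dual g0, r)) z1 z2 cs cap).
  split=> [x|g gP'].
    rewrite !inE fE => /orP[]/eqP -> /=; split=> //; [exact: dvdp_mulr|exact: dvdp_mull].
  rewrite fE self_dual_part_pair // /exponents /=.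
  have [E|_] := eqVneq g0 g; have [E'|_] //= := eqVneq (dual g0) g.
  by case: gd; rewrite E'.
move: b; case: ifP => uf; last by case=> _ [v cb]; apply: (cyc v cb); rewrite /hyperb uf.
case: ifP => ro; last by case=> v cb _; apply: (cyc v cb); rewrite /hyperb ro andbF.
case=> _ [v [w hb]]; have [WE [hv hw] _ _] := hb.
have [c c2 fE] := unitbP _ uf.
have fPhi : is_Phi f by rewrite fE; apply: Phi_XsubC; apply: contra_eq_neq c2 => ->; rewrite expr0n eq_sym oner_eq0.
have fd : f = dual f by rewrite fE dual_Xsub.
exists [:: (f, r); (f, r)].
  apply: (csum_cons2 (v := v) (w := w)) => // p q /=.
  split=> [E|[hp hq]]; first exact: hyp_indep fP hb E.
  by rewrite (dvdp_act hp hv) (dvdp_act hq hw) addr0.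
split=> [x|g gP]; last by rewrite self_dual_part_self // -[[:: _; _]]/(nseq 2 (f, r)) exponents_nseq /hyperb uf ro.
by rewrite !inE orbb => /eqP ->; have [_ fi _] := fPhi.
Qed.

Lemma dec_csum W t : dec J U W t -> exists2 s, csum W s & primary_of t s.
Proof.
elim: t W => [|l t IHt] W.
  by move=> ->; exists [::]; [apply: csum0|].
case=> W1 [W2 [-> o b /IHt[s cs sP]]].
by apply: (block_csum b cs _ sP); apply: (nondeg_orth_cap H o (block_nondeg H b)).
Qed.

Lemma dec_primary_decomposition t : dec J U fullv t -> exists2 s, primary_decomposition U s &
  (forall f, is_Phi f -> f = dual f -> perm_eq (parts_of t f) (exponents s f)) /\
  (forall g, is_Phi g -> g <> dual g -> perm_eq (parts_of t (g * dual g)) (exponents s g)).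
Proof.
case/dec_csum => s cs [sP sE]; exists s.
  by split=> // x /sP[].
split=> f fP fd; rewrite sE // /self_dual_part; case: (f =P dual f) => // _; by rewrite perm_sort.
Qed.
End Csum.

(** * Eigenspace decomposition and signs from blocks *)

Section EigenExists.
Variables (F : finFieldType) (N : nat) (U : 'M[F]_N) (e : nat).
Hypothesis oF : odd #|F|.
Local Notation J := (form_mx F N).
Hypothesis (H : symp J U e).
Variable (eps : F).
Hypothesis (eps2 : eps ^+ 2 = 1).
Local Notation f := ('X - eps%:P : {poly F}).
Implicit Types (W : {vspace 'cV[F]_N}) (p q : {poly F}) (t : seq (label F)).

Lemma nonzero_squareM2 (a b : F) : a != 0 -> b != 0 ->
  nonzero_square (a * b) = (nonzero_square a == nonzero_square b).
Proof.
move=> a0 b0; have [sa|na] := boolP (nonzero_square a).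
  by rewrite nonzero_squareM.
have [sb|nb] /= := boolP (nonzero_square b); first by rewrite mulrC nonzero_squareM // (negPf na).
have [|z z0 ->] := square_ratio oF a0 b0; first by rewrite (negPf na) (negPf nb).
apply/nonzero_squareP; exists (b * z); first by rewrite mulf_neq0.
by rewrite exprMn mulrAC -expr2.
Qed.

(** Groups the blocks with polynomial f and exponent i into V i, the others
    going to R. *)
Lemma dec_split n W t : dec J U W t -> exists (V : nat -> {vspace 'cV[F]_N}) (R : {vspace 'cV[F]_N}),
  [/\ W = (\sum_(i < n) V i + R)%VS,
      forall i, (i < n)%N -> dec J U (V i) [seq l <- t | l.1 == (f, i)],
      dec J U R [seq l <- t | ~~ ((l.1.1 == f) && (l.1.2 < n)%N)],
      forall i j, (i < n)%N -> (j < n)%N -> i != j -> orth J (V i) (V j)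
    & forall i, (i < n)%N -> orth J (V i) R].
Proof.
elim: n W t => [|n IHn] W t d.
  exists (fun=> 0%VS), W; split=> //; first by rewrite big_ord0 add0v.
  by rewrite (eq_filter (a2 := predT)) ?filter_predT // => l; rewrite ltn0 andbF.
have [V [R [WE dV dR oV oR]]] := IHn _ _ d.
set t' := [seq l <- t | _] in dR.
have pt : perm_eq t' ([seq l <- t' | l.1 == (f, n)] ++ [seq l <- t' | l.1 != (f, n)]).
  by rewrite perm_sym; apply: permEl; apply: perm_filterC.
have [X [R' [RE oX dX dR']]] := (dec_cat H _ _ _).1 (dec_perm H pt dR).
have sX : (X <= R)%VS by rewrite RE addvSl.
have sR' : (R' <= R)%VS by rewrite RE addvSr.
exists (fun i => if i == n then X else V i), R'; split.
- rewrite big_ord_recr /= eqxx WE RE addvA; congr (_ + _ + _)%VS.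
  by apply: eq_bigr => i _; rewrite (ltn_eqF (ltn_ord i)).
- move=> i; rewrite ltnS leq_eqVlt; case: eqP => [-> _|_ /= /dV //].
  move: dX; rewrite /t' -filter_predI; congr (dec _ _ _ _); apply: eq_filter => l /=.
  by rewrite andb_idr // => /eqP ->; rewrite ltnn andbF.
- move: dR'; rewrite /t' -filter_predI; congr (dec _ _ _ _); apply: eq_filter => -[[g r] b] /=.
  rewrite (xpair_eqE g f r n) ltnS [(r <= n)%N]leq_eqVlt.
  by case: (g == f) => //=; rewrite negb_or.
- move=> i j; rewrite !ltnS => iN jN ij.
  have [iE|ni] := eqVneq i n; have [jE|nj] := eqVneq j n.
  + by rewrite iE jE eqxx in ij.
  + by apply: (orthC H); apply: orthS (oR j _); rewrite // ltn_neqAle nj.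
  + by apply: orthS (oR i _); rewrite // ltn_neqAle ni.
  by apply: oV; rewrite // ltn_neqAle ?ni ?nj.
move=> i; rewrite ltnS leq_eqVlt; case: eqP => [-> _|_ /= jn] //.
exact: orthS (oR i jn).
Qed.

Lemma unit_Phi : is_Phi f.
Proof. by apply: Phi_XsubC; apply: contra_eq_neq eps2 => ->; rewrite expr0n eq_sym oner_eq0. Qed.

Lemma mem_generalized x : (x \in generalized_eigenspace U eps) = (pact U (f ^+ N) x == 0).
Proof.
rewrite memv_ker lfunE /=; congr (_ *m _ == 0).
by rewrite poly_actXp linearB /= poly_actX poly_actC.
Qed.

Lemma dec_kill W t x : dec J U W t -> x \in W -> pact U (\prod_(l <- t) l.1.1 ^+ l.1.2) x = 0.
Proof.
elim: t W x => [|l t IHt] W x /=.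
  by move=> ->; rewrite memv0 => /eqP ->; rewrite mulmx0.
case=> W1 [W2 [-> _ b d]] /memv_addP[x1 x1W [x2 x2W ->]].
rewrite big_cons mulmxDr poly_actM -[X in _ + X]mulmxA (IHt _ _ d x2W) mulmx0 addr0.
by rewrite poly_actMC -mulmxA (block_kill b x1W) mulmx0.
Qed.

(** f^r divides the characteristic polynomial. *)
Lemma label_bound W t l : dec J U W t -> l \in t -> l.1.1 = f -> (l.1.2 < N.+1)%N.
Proof.
move=> d lt lf; have := dec_min (p := char_poly U) d lt; rewrite char_poly_act lf => dv.
have {}dv : f ^+ l.1.2 %| char_poly U by apply: dv => x _; rewrite mul0mx.
have := dvdp_leq (monic_neq0 (char_poly_monic U)) dv.
by rewrite size_exp_XsubC size_char_poly.
Qed.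

(** The blocks at f = t - eps give the W^i. The remaining ones are killed by a
    polynomial prime to f, so they do not meet the generalized eigenspace. *)
Lemma dec_eigen t : dec J U fullv t -> exists2 V : 'I_N.+1 -> {vspace 'cV[F]_N},
  eigen_decomposition U eps V & forall i, dec J U (V i) [seq l <- t | l.1 == (f, i : nat)].
Proof.
move=> d; have [V [R [WE dV dR oV oR]]] := dec_split N.+1 d.
exists (fun i => V i); last by move=> i; apply: dV.
have sV i (x : 'cV_N) : (i < N.+1)%N -> x \in V i -> pact U (f ^+ N) x = 0.
  move=> iN xV; have := dec_kill (dV i iN) xV.
  move=> k; apply: (dvdp_act _ (p := f ^+ i)); first by apply: dvdp_exp2l.
  suff fk s : dec J U (V i) s -> all (fun l => l.1 == (f, i)) s -> pact U (f ^+ i) x = 0.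
    by apply: (fk _ (dV i iN)); apply: filter_all.
  move: (V i) x xV {k} => W x xW dW; clear -xW dW.
  elim: s W x dW xW => [|l s IHs] W x /=.
    by move=> ->; rewrite memv0 => /eqP ->; rewrite mulmx0.
  case=> W1 [W2 [-> _ b d]] /memv_addP[x1 x1W [x2 x2W ->]] /andP[/eqP lE a].
  by rewrite mulmxDr (IHs _ _ d x2W a) addr0; have := block_kill b x1W; rewrite lE.
split.
- apply/eqP; rewrite eqEsubv; apply/andP; split; apply/subvP => x; rewrite mem_generalized; last first.
    case/memv_sumP => v vV ->; rewrite mulmx_sumr big1 // => i _.
    by apply: (sV i) => //; apply: vV.
  move=> /eqP fx; have : x \in (\sum_(i < N.+1) V i + R)%VS by rewrite -WE memvf.
  case/memv_addP => y yV [z zR xE]; rewrite xE; suff -> : z = 0 by rewrite addr0.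
  have fz : pact U (f ^+ N) z = 0.
    move: fx; rewrite xE mulmxDr; case/memv_sumP: yV => v vV ->.
    rewrite mulmx_sumr big1 ?add0r // => i _; by apply: (sV i) => //; apply: vV.
  apply: (coprimep_act _ fz (dec_kill dR zR)); apply: coprimep_expl.
  rewrite big_seq; elim/big_rec: _ => [|l p]; first exact: coprimep1.
  rewrite mem_filter negb_and => /andP[nl lt] cp; rewrite coprimepMr cp andbT.
  apply: coprimep_expr; have [W' _ [lP l0 _]] := dec_mem d lt.
  have nf : l.1.1 != f.
    by apply: contraTneq nl => lf; rewrite lf eqxx /= negbK (label_bound d lt).
  case: lP => [[lPhi _]|[g [gP gd lE]]].
    by apply: Phi_coprime; rewrite 1?eq_sym //; exact: unit_Phi.
  have dg h : is_Phi h -> h <> dual h -> coprimep f h.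
    move=> hP hd; apply: Phi_coprime => //; first exact: unit_Phi.
    by apply/eqP => fh; case: hd; rewrite -fh dual_Xsub.
  rewrite lE coprimepMr (dg _ gP gd); apply: dg; first exact: Phi_dual.
  by rewrite dualK ?(Phi_neq0 gP) //; [move/esym|case: gP].
- apply/directv_sumP => i _; have ni := dec_nondeg H (dV i (ltn_ord i)).
  apply: (nondeg_orth_cap H _ ni).
  move=> x _ xV /memv_sumP[y yV ->]; rewrite linear_sum big1 // => j /andP[_ ji].
  by apply: (oV i j) => //; [rewrite eq_sym|apply: yV; rewrite ji].
- by move=> i j ij v w vV wW; rewrite Q_form; apply: (oV i j).
- move=> i; apply/subvP => _ /memv_imgP[x xV ->]; rewrite lfunE /=.
  by apply: (dec_stable (dV i (ltn_ord i))).
move=> i; have [s [b cs] [sP _]] := dec_csum H (dV i (ltn_ord i)).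
exists (size s), b; apply: cyclic_ext cs => j.
have [xm xi x0 [l]] := sP _ (mem_tnth j (in_tuple s)).
rewrite mem_filter => /andP[/eqP -> _] /= [xf ->]; congr (_ ^+ _).
have := (irredp_XsubC eps).2 _ _ xf; rewrite eqp_monic ?monicXsubC // => E.
by apply/eqP/E; rewrite gtn_eqF //; case: xi.
Qed.

(** The generators of the blocks form a basis of W / (U - eps) W, orthogonal
    for the form, so that the Gram determinant is the product of the values of
    beta. *)
Lemma dec_gram i W u : (0 < i)%N -> ~~ odd i -> dec J U W u -> all (fun l => l.1 == (f, i)) u ->
  exists c : (size u).-tuple 'cV[F]_N,
  [/\ quotient_basis W (mx_act (U - eps%:M) @: W)%VS c, gram_det U i c != 0
    & nonzero_square (gram_det U i c) = ~~ odd (count_mem (f, i, false) u)].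
Proof.
move=> i0 io; have fU (x : 'cV_N) : mx_act (U - eps%:M) x = pact U f x.
  by rewrite lfunE /= linearB /= poly_actX poly_actC.
elim: u W => [|[[g r] d] u IHu] W /=.
  move=> -> _; exists [tuple]; split; last 2 first.
  - by rewrite /gram_det det_mx00 oner_eq0.
  - by rewrite /gram_det det_mx00; apply/nonzero_squareP; exists 1; rewrite ?oner_eq0 ?expr1n.
  by rewrite /quotient_basis limg0 span_nil addv0 nil_free eqxx capv0 eqxx.
case=> W1 [W2 [-> o b d2]] /andP[/eqP[gE rE] a]; move: b; rewrite gE rE => b.
have [c [/and3P[fc /eqP gen /eqP cap] g0 gs]] := IHu _ d2 a.
have s1 := block_stable b; have s2 := dec_stable d2.
have c12 := nondeg_orth_cap H o (block_nondeg H b).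
have [_ _ /=] := b; have uf : unitb f by apply/unitbP; exists eps.
rewrite uf (negPf io) => -[v cb vd].
have [WE hv hp] := cb; have ann p := cyc_block_ann p cb.
have vW : v \in W1 by apply/WE; exists 1; rewrite poly_act1 mul1mx.
have b0 := cyc_beta oF H eps2 i0 cb.
have cW j : tnth c j \in W2.
  by rewrite -gen; apply: (subvP (addvSl _ _)); apply: memv_span; apply: mem_tnth.
exists (cons_tuple v c).
have gE' : gram_det U i (cons_tuple v c) = beta J U i v * gram_det U i c.
  rewrite /gram_det; set M := (X in \det X = _).
  rewrite -[M](@submxK _ 1 _ 1 _).
  have -> : dlsubmx (M : 'M_(1 + _, 1 + _)) = 0.
    apply/matrixP => j k; rewrite !mxE Q_form.
    have -> : tnth (cons_tuple v c) (lshift (size u) k) = v by rewrite [k]ord1 (tnth_nth v).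
    have -> : tnth (cons_tuple v c) (rshift 1 j) = tnth c j by rewrite !(tnth_nth v).
    rewrite (sub_invE H) -poly_actXp (bform_skew H) o ?oppr0 //; exact: stable_act.
  rewrite (@det_ublock _ 1 (size u)) det_mx11; congr (_ * _).
    by rewrite !mxE (tnth_nth v) /= Q_form.
  by congr (\det _); apply/matrixP => j k; rewrite !mxE; congr (Q (_ *m _) _); rewrite !(tnth_nth v).
have D : (mx_act (U - eps%:M) @: (W1 + W2) = mx_act (U - eps%:M) @: W1 + mx_act (U - eps%:M) @: W2)%VS.
  exact: limgD.
split; last first.
- rewrite gE' nonzero_squareM2 // vd gs.
  rewrite (xpair_eqE (f, i) (f, i) d false) eqxx /= oddD.
  by case: d {b vd}; case: (odd _).
- by rewrite gE' mulf_neq0.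
have fW1 x : x \in (mx_act (U - eps%:M) @: W1)%VS -> x \in W1.
  by case/memv_imgP => y yW ->; rewrite fU; apply: stable_act.
have fW2 x : x \in (mx_act (U - eps%:M) @: W2)%VS -> x \in W2.
  by case/memv_imgP => y yW ->; rewrite fU; apply: stable_act.
have cs : (<<c>> <= W2)%VS by rewrite -gen addvSl.
have z12 x : x \in W1 -> x \in W2 -> x = 0.
  by move=> x1 x2; apply/eqP; rewrite -memv0 -c12 memv_cap x1.
have v0 : v != 0.
  apply: contraNneq b0 => ->; by rewrite /beta mulmx0 bform0l.
have cap1 k x : x \in W1 -> k *: v = pact U f x -> k = 0.
  case/WE => p -> E; have : pact U (k%:P - f * p) v = 0.
    by rewrite linearB /= mulmxBl poly_actC mul_scalar_mx poly_actM -mulmxA E subrr.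
  move/ann => dv; have : f %| k%:P - f * p.
    by apply: dvdp_trans dv; rewrite -{1}[f]expr1 dvdp_exp2l.
  rewrite dvdp_subl ?dvdp_mulr // dvdp_XsubCl rootE hornerC => /eqP ->; by [].
apply/and3P; split.
- rewrite free_cons fc andbT; apply: contra v0 => vc.
  by apply/eqP/z12 => //; apply: (subvP cs).
- rewrite span_cons D -addvA [(<<c>> + (_ + _))%VS]addvA [(<<c>> + _)%VS]addvC.
  rewrite -[(_ + <<c>> + _)%VS]addvA addvA gen; apply/eqP; congr (_ + _)%VS.
  apply/eqP; rewrite eqEsubv; apply/andP; split.
    rewrite subv_add -memvE vW; apply/subvP => x /fW1 //.
  apply/subvP => _ /WE[p ->].
  have /dvdpP[q qE] : f %| p - (p.[eps])%:P by rewrite dvdp_XsubCl rootE !hornerE subrr.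
  have -> : p = (p.[eps])%:P + f * q by rewrite mulrC -qE addrC subrK.
  rewrite linearD /= mulmxDl poly_actC mul_scalar_mx poly_actM -mulmxA; apply: memv_add.
    by apply: memvZ; apply: memv_line.
  by apply/memv_imgP; exists (pact U q v); rewrite ?fU //; apply: stable_act.
rewrite -subv0; apply/subvP => x; rewrite memv_cap span_cons D memv0.
case/andP => /memv_addP[_ /vlineP[k ->] [y yc ->]] /memv_addP[z1 z1W [z2 z2W E]].
have yW : y \in W2 by apply: (subvP cs).
have E1 : k *: v - z1 = z2 - y.
  by apply/eqP; rewrite subr_eq addrAC eq_sym subr_eq E addrC.
have Ez : k *: v - z1 = 0.
  apply: z12; first by apply: memvB; [exact: memvZ|exact: fW1].
  by rewrite E1; apply: memvB; [exact: fW2|].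
have y0 : y = 0.
  apply/eqP; rewrite -memv0 -cap memv_cap yc /=.
  by move: E1; rewrite Ez => /esym/eqP; rewrite subr_eq0 => /eqP <-.
move/eqP: Ez; rewrite subr_eq0 => /eqP Ez.
case/memv_imgP: z1W Ez => x' xW ->; rewrite fU => /(cap1 _ _ xW) ->.
by rewrite y0 scale0r addr0.
Qed.
Lemma dec_signs t (p : seq nat) (h : {fmap nat -> bool}) : dec J U fullv t -> sign_normal t -> 0%N \notin p ->
  (forall i, i \in p -> fnd h i = Some (sign_of t f i)) -> eigen_signs U eps p h.
Proof.
move=> d nt p0 hE; have [V eV dV] := dec_eigen d; exists V => // i ip.
rewrite hE // /sign_of; case: (boolP (odd i)) => //= io.
have i0 : (0 < i)%N by rewrite lt0n; apply: contraNneq p0 => <-.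
have [c [qb g0 gs]] := dec_gram i0 io (dV i) (filter_all _ _).
exists (size [seq l <- t | l.1 == (f, i : nat)]), c; split=> //; rewrite gs; congr Some.
have -> : count_mem (f, i : nat, false) [seq l <- t | l.1 == (f, i : nat)] = count_mem (f, i : nat, false) t.
  rewrite count_filter; apply: eq_count => l /=; apply: andb_idr => /eqP -> /=; exact: eqxx.
have uf : unitb f by apply/unitbP; exists eps.
by have := nt f i uf; rewrite mem_count; case: (count_mem _ t) => [|[|?]].
Qed.
End EigenExists.

Section TypeExists.
Variable F : finFieldType.
Hypothesis oF : odd #|F|.

Theorem has_type_dec n (U : Sp F n) t : sign_normal t -> dec (form_mx F n.*2) (val U) fullv t ->
  has_symplectic_type U (type_of t).
Proof.
move=> nt d; have [e H] := Sp_symp U.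
have vt : valid t by move=> l; apply: dec_label d.
have [s ps [sE1 sE2]] := dec_primary_decomposition H d.
have e1 : (1 : F) ^+ 2 = 1 by rewrite expr1n.
have e2 : (-1 : F) ^+ 2 = 1 by rewrite sqrrN expr1n.
split.
- exact: type_symplectic.
- by exists s => //; split=> f fP fd; rewrite parts_type; [apply: sE1|apply: sE2].
- apply: (dec_signs oF H e1 d nt); rewrite parts_type; first by have /andP[] := part_parts ('X - 1) vt.
  by move=> i ip; rewrite /type_of; cbn [sgn_minus]; rewrite fnd_sgn_map ip LmE.
apply: (dec_signs oF H e2 d nt); rewrite parts_type; first by have /andP[] := part_parts ('X + 1) vt.
by move=> i ip; rewrite /type_of; cbn [sgn_plus]; rewrite fnd_sgn_map ip LpE.
Qed.
End TypeExists.

(** * Invariance of the signs *)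

Section SignUnique.
Variables (F : finFieldType) (N : nat) (U : 'M[F]_N) (e : nat).
Hypothesis oF : odd #|F|.
Local Notation J := (form_mx F N).
Hypothesis (H : symp J U e).
Variable (eps : F).
Hypothesis (eps2 : eps ^+ 2 = 1).
Local Notation f := ('X - eps%:P : {poly F}).
Implicit Types (x y z v w : 'cV[F]_N) (p q : {poly F}) (W : 'I_N.+1 -> {vspace 'cV[F]_N}).

Lemma kill_leq m n x : (m <= n)%N -> pact U (f ^+ m) x = 0 -> pact U (f ^+ n) x = 0.
Proof. by move=> mn; apply: dvdp_act; apply: dvdp_exp2l. Qed.

(** Only the gcd of f^m with the characteristic polynomial matters, whose
    degree is at most N. *)
Lemma ker_stab m x : pact U (f ^+ m) x = 0 -> pact U (f ^+ N) x = 0.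
Proof.
move=> fx; have cx : pact U (char_poly U) x = 0 by rewrite char_poly_act mul0mx.
have gx := gcdp_act fx cx; have /dvdp_exp_XsubCP[d _ gE] := dvdp_gcdl (f ^+ m) (char_poly U).
have dx : pact U (f ^+ d) x = 0 by apply: dvdp_act gx; rewrite (eqp_dvdl _ gE).
apply: kill_leq dx; have : f ^+ d %| char_poly U.
  by rewrite -(eqp_dvdl _ gE) dvdp_gcdr.
move/(dvdp_leq (monic_neq0 (char_poly_monic U))).
by rewrite size_exp_XsubC size_char_poly ltnS.
Qed.

(** Fitting decomposition into the kernel and the image of f^N. *)
Lemma fitting y : exists y1 y2, y = y1 + pact U (f ^+ N) y2 /\ pact U (f ^+ N) y1 = 0.
Proof.
have [m [mu [fmu cd]]] := coprime_factor f (monic_neq0 (char_poly_monic U)).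
have [[a b] /= ab] := Bezout_eq1_coprimepP _ _ (coprimep_expl N fmu).
exists (pact U (b * mu) y), (pact U a y); split.
  rewrite mulmxA -poly_actM -mulmxDl -linearD /= [f ^+ N * a]mulrC addrC ab.
  by rewrite poly_act1 mul1mx.
apply: (@ker_stab m); rewrite mulmxA -poly_actM; apply: (dvdp_act (p := char_poly U)).
  by apply: dvdp_trans cd _; rewrite mulrCA dvdp_mull.
by rewrite char_poly_act mul0mx.
Qed.

Lemma mem_stable W i x p : eigen_decomposition U eps W -> x \in W i -> pact U p x \in W i.
Proof.
case=> _ _ _ st _ xW; apply: stable_act => // y yW.
by apply: (subvP (st i)); apply/memv_imgP; exists y; rewrite ?lfunE.
Qed.

Lemma eigen_kill W i x : eigen_decomposition U eps W -> x \in W i -> pact U (f ^+ i) x = 0.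
Proof.
case=> _ _ _ _ fr; have [k [b cs]] := fr i; have [WE ker] := cs.
case/WE => p ->; rewrite mulmx_sumr big1 // => j _.
by rewrite mulmxA poly_actMC -mulmxA (cyc_kill j cs) mulmx0.
Qed.

Lemma eigen_div W i m x : eigen_decomposition U eps W -> x \in W i -> (m <= i)%N ->
  pact U (f ^+ m) x = 0 -> exists2 z, z \in W i & x = pact U (f ^+ (i - m)) z.
Proof.
case=> _ _ _ _ fr; have [k [b [WE ker]]] := fr i; case/WE => p -> mi.
rewrite mulmx_sumr => E.
have {}E : \sum_j pact U (f ^+ m * p j) (b j) = 0.
  by rewrite -[RHS]E; apply: eq_bigr => j _; rewrite poly_actM mulmxA.
have dv j : f ^+ (i - m) %| p j.
  have := (ker (fun j => f ^+ m * p j)).1 E j.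
  rewrite -{1}(subnKC mi) exprD dvdp_mul2l // expf_neq0 //; exact: (monic_neq0 (monicXsubC _)).
exists (\sum_j pact U (p j %/ f ^+ (i - m)) (b j)); first by apply/WE; exists (fun j => p j %/ f ^+ (i - m)).
rewrite mulmx_sumr; apply: eq_bigr => j _.
by rewrite mulmxA -poly_actM mulrC divpK.
Qed.

(** On the kernel of f^i, the vectors killed by f^(i-1) and the multiples by f
    of vectors killed by f^(i+1) lie in the radical of Q(f^(i-1) x, y). *)
Let radical_orth i x y d : pact U (f ^+ i) x = 0 -> pact U (f ^+ i.-1) y = 0 -> pact U (f ^+ i.+1) d = 0 -> (0 < i)%N ->
  bform J (pact U (f ^+ i.-1) x) (y + pact U f d) = 0 /\
  bform J (pact U (f ^+ i.-1) (y + pact U f d)) x = 0.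
Proof.
move=> fx fy fd i0; have fP := Phi_unit eps2; split.
  rewrite bformDr (bform_act H) (star_kill H fP fy) bform0r add0r (bform_actr H).
  have := star_kill (k := 1) H fP (x := pact U (f ^+ i.-1) x).
  rewrite !expr1 => ->; first by rewrite bform0l.
  by rewrite mulmxA -poly_actM -exprS prednK.
rewrite mulmxDr fy add0r mulmxA -poly_actM -exprSr prednK // (bform_act H).
by rewrite (star_kill H fP fx) bform0r.
Qed.

(** Components in W^j with j < i are killed by f^(i-1). Components in W^j with
    j > i are killed by f^i, so they are multiples of f^(j-i), hence f times a
    vector killed by f^(i+1). So W^i / f W^i represents ker f^i modulo vectors
    that radical_orth shows to be invisible to the form. *)
Lemma ker_power_span W (i : 'I_N.+1) k (c : k.-tuple 'cV[F]_N) x : eigen_decomposition U eps W ->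
  quotient_basis (W i) (mx_act (U - eps%:M) @: W i)%VS c -> pact U (f ^+ i) x = 0 -> (0 < i)%N ->
  exists (P : 'I_k -> F) y d, [/\ x = \sum_a P a *: tnth c a + (y + pact U f d),
    pact U (f ^+ i.-1) y = 0 & pact U (f ^+ i.+1) d = 0].
Proof.
move=> ed qb fx i0; have [gE dir _ _ _] := ed.
have : x \in generalized_eigenspace U eps by rewrite mem_generalized; apply/eqP/ker_stab/fx.
rewrite gE => /memv_sumP[v vW xE].
have fv j : pact U (f ^+ i) (v j) = 0.
  have /directv_sum_independent ind := dir.
  apply: (ind (fun j => pact U (f ^+ i) (v j))) => // [l _|].
    by apply: (mem_stable _ ed); apply: vW.
  by rewrite -mulmx_sumr -xE.
have [/and3P[fc /eqP gen _]] := qb.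
have := vW i isT; rewrite -gen => /memv_addP[s sc [_ /memv_imgP[w wW ->] vE]].
have fU (z : 'cV_N) : mx_act (U - eps%:M) z = pact U f z.
  by rewrite lfunE /= linearB /= poly_actX poly_actC.
rewrite fU in vE.
have zex (j : 'I_N.+1) : exists z, (i < j)%N -> z \in W j /\ v j = pact U (f ^+ (j - i)) z.
  case: (ltnP i j) => ij; last by exists 0.
  by have [z zW zE] := eigen_div ed (vW j isT) (ltnW ij) (fv j); exists z.
have [z zE] := fin_all_exists zex.
exists (fun a => coord c a s), (\sum_(j : 'I_N.+1 | (j < i)%N) v j), (w + \sum_(j : 'I_N.+1 | (i < j)%N) pact U (f ^+ (j - i).-1) (z j)).
split.
- rewrite {1}xE (bigD1 i) //= vE {1}(coord_span sc) -!addrA; congr (_ + _).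
    by apply: eq_bigr => a _; rewrite -tnth_nth.
  rewrite mulmxDr addrCA; congr (_ + _).
  rewrite (bigID (fun j : 'I_N.+1 => (j < i)%N)) /=; congr (_ + _).
    by apply: eq_bigl => j; case: ltngtP; rewrite ?andbT ?andbF // -val_eqE => /ltn_eqF ->.
  rewrite mulmx_sumr; apply: eq_big => j.
    by rewrite -leqNgt [(i < j)%N]ltn_neqAle eq_sym.
  move=> /andP[ji]; rewrite -leqNgt leq_eqVlt eq_sym => /orP[/eqP /val_inj E|ij].
    by rewrite E eqxx in ji.
  have [_ ->] := zE j ij; rewrite mulmxA -poly_actM -exprS prednK // subn_gt0 //.
- rewrite mulmx_sumr big1 // => j ji; apply: (kill_leq (m := j)).
    by rewrite -ltnS prednK.
  exact: (eigen_kill ed (vW j isT)).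
rewrite mulmxDr (kill_leq (leqnSn i) (eigen_kill ed wW)) add0r mulmx_sumr big1 // => j ij.
rewrite mulmxA -poly_actM -exprD.
have -> : (i.+1 + (j - i).-1 = j)%N by rewrite addSnnS prednK ?subn_gt0 // subnKC // ltnW.
by have [zW _] := zE j ij; apply: eigen_kill ed zW.
Qed.

Lemma basis_mem W (i : 'I_N.+1) k (c : k.-tuple 'cV[F]_N) D a :
  quotient_basis (W i) D c -> tnth c a \in W i.
Proof.
by case/and3P => _ /eqP <- _; apply: (subvP (addvSl _ _)); apply: memv_span; apply: mem_tnth.
Qed.

Definition gram_mx i k (c : k.-tuple 'cV[F]_N) : 'M[F]_k :=
  \matrix_(a, b) Q ((U - invmx U) ^+ i.-1 *m tnth c a) (tnth c b).

Lemma gram_mxE (i k : nat) (c : k.-tuple 'cV[F]_N) a b : (0 < i)%N -> pact U (f ^+ i) (tnth c a) = 0 ->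
  gram_mx i c a b = 2%:R ^+ i.-1 * bform J (pact U (f ^+ i.-1) (tnth c a)) (tnth c b).
Proof. by move=> i0 fc; rewrite mxE (unit_skew_power H eps2 i0 fc) Q_form bformZl. Qed.

(** If f^(i-1) x is orthogonal to W^i, it is orthogonal to the other W^j and to
    the image of f^N, so it is 0; then x lies in f W^i, and its coordinates in
    a basis modulo f W^i vanish. *)
Lemma gram_nondeg W (i : 'I_N.+1) k (c : k.-tuple 'cV[F]_N) : eigen_decomposition U eps W -> (0 < i)%N ->
  quotient_basis (W i) (mx_act (U - eps%:M) @: W i)%VS c -> gram_mx i c \in unitmx.
Proof.
move=> ed i0 qb; rewrite unitmxE unitfE; apply/det0P => -[u u0 uM].
have [/and3P[fc /eqP gen /eqP cap]] := qb; have [gE dir og _ _] := ed.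
have fU (z : 'cV_N) : mx_act (U - eps%:M) z = pact U f z.
  by rewrite lfunE /= linearB /= poly_actX poly_actC.
pose x := \sum_a u 0 a *: tnth c a.
have cW a : tnth c a \in W i by apply: basis_mem qb.
have xW : x \in W i by apply: memv_suml => a _; apply: memvZ.
have fx := eigen_kill ed xW.
have xc b : bform J (pact U (f ^+ i.-1) x) (tnth c b) = 0.
  have := congr1 (fun A : 'rV[F]_k => A 0 b) uM; rewrite !mxE.
  rewrite /x mulmx_sumr bform_suml => E; apply/eqP.
  have t0 : (2%:R : F) ^+ i.-1 != 0 by rewrite expf_neq0 // two_neq0.
  rewrite -(inj_eq (mulfI t0)) mulr0 mulr_sumr -[X in _ == X]E; apply/eqP; apply: eq_bigr => a _.
  by rewrite gram_mxE ?(eigen_kill ed) // -scalemxAr bformZl mulrCA.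
have xWi y : y \in W i -> bform J (pact U (f ^+ i.-1) x) y = 0.
  rewrite -gen => /memv_addP[s sc [_ /memv_imgP[w wW ->] ->]].
  rewrite bformDr fU (coord_span sc) linear_sum big1 ?add0r => [|a _]; last first.
    by rewrite linearZ /= -tnth_nth xc mulr0.
  have [E _] := radical_orth fx (linear0 (mulmx (poly_act U (f ^+ i.-1)))) (kill_leq (leqnSn i) (eigen_kill ed wW)) i0.
  by rewrite add0r in E.
have fx0 : pact U (f ^+ i.-1) x = 0.
  apply: (nondeg_full H) (memvf _) _ => y _.
  have [y1 [y2 [-> fy1]]] := fitting y; rewrite bformDr (bform_actr H).
  have fP := Phi_unit eps2.
  rewrite [X in _ + bform _ X _](star_kill H fP) ?bform0l ?addr0; last first.
    by rewrite mulmxA poly_actMC -mulmxA (kill_leq _ fx) ?mulmx0 // -ltnS.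
  have : y1 \in generalized_eigenspace U eps by rewrite mem_generalized fy1.
  rewrite gE => /memv_sumP[v vW ->]; rewrite linear_sum big1 // => j _.
  have [->|ji] := eqVneq j i; first exact: xWi (vW i isT).
  have xi := mem_stable (f ^+ i.-1) ed xW.
  by have := og i j; rewrite eq_sym => /(_ ji _ _ xi (vW j isT)).
have [z zW zE] := eigen_div ed xW (leq_pred i) fx0.
have x0 : x = 0.
  apply/eqP; rewrite -memv0 -cap memv_cap; apply/andP; split.
    by apply: memv_suml => a _; apply: memvZ; apply: memv_span; apply: mem_tnth.
  apply/memv_imgP; exists z => //; rewrite fU zE; congr (poly_act _ _ *m _).
  by rewrite -{1}(prednK i0) subSnn expr1.
case/negP: u0; apply/eqP/rowP => a; rewrite mxE.
have /freeP := fc; apply; rewrite -[RHS]x0 /x; apply: eq_bigr => b _; by rewrite -tnth_nth.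
Qed.

(** P expresses c' in terms of c modulo the radical. *)
Lemma gram_change W W' (i : 'I_N.+1) k k' (c : k.-tuple 'cV[F]_N) (c' : k'.-tuple 'cV[F]_N) :
  eigen_decomposition U eps W -> eigen_decomposition U eps W' -> (0 < i)%N ->
  quotient_basis (W i) (mx_act (U - eps%:M) @: W i)%VS c ->
  quotient_basis (W' i) (mx_act (U - eps%:M) @: W' i)%VS c' ->
  exists P : 'M_(k', k), gram_mx i c' = P *m gram_mx i c *m P^T.
Proof.
move=> ed ed' i0 qb qb'.
have fc a : pact U (f ^+ i) (tnth c a) = 0 by apply: (eigen_kill ed); apply: basis_mem qb.
have fc' a : pact U (f ^+ i) (tnth c' a) = 0 by apply: (eigen_kill ed'); apply: basis_mem qb'.
have ex a : exists P : {ffun 'I_k -> F}, exists y d, [/\ tnth c' a = \sum_j P j *: tnth c j + (y + pact U f d),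
    pact U (f ^+ i.-1) y = 0 & pact U (f ^+ i.+1) d = 0].
  have [P [y [d [E fy fd]]]] := ker_power_span ed qb (fc' a) i0.
  exists [ffun j => P j], y, d; split=> //; rewrite E; congr (_ + _).
  by apply: eq_bigr => j _; rewrite ffunE.
have [P PE] := fin_all_exists ex.
exists (\matrix_(a, j) P a j); apply/matrixP => a b; rewrite gram_mxE //.
have fS (p : 'I_k -> F) : pact U (f ^+ i) (\sum_j p j *: tnth c j) = 0.
  by rewrite mulmx_sumr big1 // => j _; rewrite -scalemxAr fc scaler0.
have -> : bform J (pact U (f ^+ i.-1) (tnth c' a)) (tnth c' b) =
    bform J (pact U (f ^+ i.-1) (\sum_j P a j *: tnth c j)) (\sum_j P b j *: tnth c j).
  have [y [d [Ea fy fd]]] := PE a; have [y' [d' [Eb fy' fd']]] := PE b.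
  rewrite {1}Ea mulmxDr bformDl (radical_orth (fc' b) fy fd i0).2 addr0.
  by rewrite Eb bformDr (radical_orth (fS _) fy' fd' i0).1 addr0.
have GE j l : gram_mx i c j l = 2%:R ^+ i.-1 * bform J (pact U (f ^+ i.-1) (tnth c j)) (tnth c l).
  exact: gram_mxE.
move: (gram_mx i c) GE => G GE.
transitivity (\sum_l \sum_j P a j * G j l * P b l); last first.
  by rewrite mxE; apply: eq_bigr => l _; rewrite !mxE mulr_suml; apply: eq_bigr => j _; rewrite mxE.
rewrite exchange_big mulmx_sumr bform_suml mulr_sumr; apply: eq_bigr => j _ /=.
rewrite -scalemxAr bformZl linear_sum !mulr_sumr; apply: eq_bigr => l _.
by rewrite linearZ_LR /= GE; ring.
Qed.

(** Gram determinants related by a base change differ by the square of its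
    determinant. The two bases have the same length because both Gram matrices
    are invertible. *)
Lemma sign_unique W W' (i : 'I_N.+1) k k' (c : k.-tuple 'cV[F]_N) (c' : k'.-tuple 'cV[F]_N) :
  eigen_decomposition U eps W -> eigen_decomposition U eps W' -> (0 < i)%N ->
  quotient_basis (W i) (mx_act (U - eps%:M) @: W i)%VS c ->
  quotient_basis (W' i) (mx_act (U - eps%:M) @: W' i)%VS c' ->
  nonzero_square (gram_det U i c) = nonzero_square (gram_det U i c').
Proof.
move=> ed ed' i0 qb qb'.
have le : forall W W' k k' (c : k.-tuple 'cV[F]_N) (c' : k'.-tuple 'cV[F]_N),
  eigen_decomposition U eps W -> eigen_decomposition U eps W' ->
  quotient_basis (W i) (mx_act (U - eps%:M) @: W i)%VS c ->
  quotient_basis (W' i) (mx_act (U - eps%:M) @: W' i)%VS c' -> (k' <= k)%N.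
  move=> {k k' c c' W W' ed ed' qb qb'} W W' k k' c c' ed ed' qb qb'.
  have [P E] := gram_change ed ed' i0 qb qb'.
  have := gram_nondeg ed' i0 qb'; rewrite -row_free_unit -row_leq_rank E => rk.
  apply: leq_trans rk _; rewrite -mulmxA; apply: leq_trans (mulmx_max_rank _ _) _.
  exact: leqnn.
have kk : k = k' by apply/eqP; rewrite eqn_leq (le _ _ _ _ _ _ ed ed' qb qb') (le _ _ _ _ _ _ ed' ed qb' qb).
move: kk c c' qb qb' => <- c c' qb qb'.
have [P E] := gram_change ed ed' i0 qb qb'.
have := gram_nondeg ed' i0 qb'; rewrite unitmxE E !det_mulmx !unitfE !mulf_eq0 !negb_or => /andP[/andP[p0 g0] _].
rewrite -[gram_det U i c']/(\det (gram_mx i c')) E !det_mulmx det_tr mulrAC.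
apply/esym/nonzero_squareM; apply/nonzero_squareP; exists (\det P) => //.
Qed.
End SignUnique.

Section TypeUnique.
Variable F : finFieldType.
Hypothesis oF : odd #|F|.

Lemma eigen_signs_unique n (U : Sp F n) eps p h h' (i : nat) : eps ^+ 2 = 1 ->
  (i <= n.*2)%N -> i \in p -> (0 < i)%N -> eigen_signs (val U) eps p h -> eigen_signs (val U) eps p h' ->
  fnd h i = fnd h' i.
Proof.
move=> e2 iN ip i0 [W ed hE] [W' ed' hE']; have [e H] := Sp_symp U.
have iN' : (i < (n.*2).+1)%N by rewrite ltnS.
have := hE (Ordinal iN') ip; have := hE' (Ordinal iN') ip; rewrite /=.
case: ifP => _; first by move=> -> ->.
case=> k [c [qb ->]] [k' [c' [qb' ->]]]; congr Some.
exact: (sign_unique (i := Ordinal iN') oF H e2 ed ed' i0 qb' qb).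
Qed.

(** The partitions are determined by exponents_uniq and the signs by
    sign_unique. *)
Theorem type_unique n (U : Sp F n) L L' :
  has_symplectic_type U L -> has_symplectic_type U L' -> L = L'.
Proof.
case=> [[[pt PhiL] sm sp] [s ds [s1 s2]] em ep] [[[pt' PhiL'] sm' sp'] [s' ds' [s1' s2']] em' ep'].
have Phi_parts f : is_Phi_s f -> parts L f = parts L' f.
  move=> fP; apply: sorted_count_eq; [by have /andP[] := pt f|by have /andP[] := pt' f|move=> r].
  suff /seq.permP : perm_eq (parts L f) (parts L' f) by apply.
  case: fP => [[fP fd]|[g [gP gd ->]]].
    apply: perm_trans (s1 f fP fd) _; rewrite perm_sym; apply: perm_trans (s1' f fP fd) _.
    by case: (fP) => fm fi _; exact: (exponents_uniq ds' ds fm fi).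
  apply: perm_trans (s2 g gP gd) _; rewrite perm_sym; apply: perm_trans (s2' g gP gd) _.
  by case: (gP) => fm fi _; exact: (exponents_uniq ds' ds fm fi).
have pE f : parts L f = parts L' f.
  have [E|/PhiL/Phi_parts //] := eqVneq (parts L f) [::].
  have [E'|/PhiL'/Phi_parts //] := eqVneq (parts L' f) [::].
  by rewrite E E'.
have u1 : unit_poly ('X - 1 : {poly F}) by exists 1; rewrite ?expr1n // polyC1.
have u2 : unit_poly ('X + 1 : {poly F}) by exists (-1); rewrite ?sqrrN ?expr1n // polyCN polyC1 opprK.
have bound f i : unit_poly f -> i \in parts L f -> (i <= n.*2)%N /\ (0 < i)%N.
  case=> c c2 fE ip; split.
    have fP : is_Phi f by rewrite fE; apply: unit_Phi.
    have fd : f = dual f by rewrite fE dual_Xsub.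
    have : i \in exponents s f by rewrite -(perm_mem (s1 f fP fd)).
    by rewrite mem_exponents => /(primary_bound ds).
  by rewrite lt0n; apply: contraTneq ip => ->; have /andP[] := pt f.
apply: sp_ext => // i.
  have [[_ dom] _] := sp; have [[_ dom'] _] := sp'; rewrite -pE in dom'.
  have [ip|ip] := boolP (i \in parts L ('X + 1)); last by rewrite !not_fnd // ?dom ?dom'.
  have [iN i0] := bound _ _ u2 ip; rewrite -pE in ep'.
  by apply: (eigen_signs_unique _ iN ip i0 ep ep'); rewrite sqrrN expr1n.
have [[_ dom] _] := sm; have [[_ dom'] _] := sm'; rewrite -pE in dom'.
have [ip|ip] := boolP (i \in parts L ('X - 1)); last by rewrite !not_fnd // ?dom ?dom'.
have [iN i0] := bound _ _ u1 ip; rewrite -pE in em'.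
by apply: (eigen_signs_unique _ iN ip i0 em em'); rewrite expr1n.
Qed.
End TypeUnique.

(** * Reflection length and dimensions *)

Section Reflections.
Variables (F : finFieldType) (N : nat).
Implicit Types (U T : 'M[F]_N) (u v a b : 'cV[F]_N).

Lemma reflection_inv T : reflection T -> reflection (invmx T).
Proof.
case/andP => Tu Tr; rewrite /reflection unitmx_inv Tu /=.
have -> : invmx T - 1%:M = (1%:M - T) *m invmx T by rewrite mulmxBl mul1mx mulmxV.
by rewrite mxrankMfree ?row_free_unit ?unitmx_inv // -mxrank_opp opprB.
Qed.

(** T V - 1 = (T - 1) V + (V - 1), and T - 1 has rank 1. *)
Lemma reflection_product_rank U r : reflection_product U r -> (\rank (U - 1%:M)%R <= r)%N.
Proof.
case=> -[s /= /eqP <-] [+ ->] {U r}; elim: s => [|T s IHs] /=.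
  by rewrite big_nil subrr mxrank0.
case/andP => /andP[_ /eqP Tr] /IHs {}IHs; rewrite big_cons -[_ * _]/(_ *m _); set V := \prod_(T <- s) T in IHs *.
have -> : T *m V - 1%:M = (T - 1%:M) *m V + (V - 1%:M) by rewrite mulmxBl mul1mx addrA subrK.
apply: leq_trans (mxrank_add _ _) _; rewrite -add1n -Tr leq_add //; exact: mxrankM_maxl.
Qed.

(** A space is not the union of two hyperplanes; here a linear form vanishing
    on neither vector is produced. *)
Lemma dual_vector a b : a != 0 -> b != 0 ->
  exists x : 'rV[F]_N, (x *m a) 0 0 != 0 /\ (x *m b) 0 0 = 1.
Proof.
have nz (c : 'cV[F]_N) : c != 0 -> exists x : 'rV[F]_N, (x *m c) 0 0 != 0.
  move=> c0; have [i ci] : exists i, c i 0 != 0.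
    apply/existsP; apply: contraNT c0; rewrite negb_exists => /forallP z.
    by apply/eqP/colP => i; rewrite mxE; apply/eqP; have := z i; rewrite negbK.
  by exists (delta_mx 0 i); rewrite -rowE mxE.
move=> a0 b0; suff [x [xa xb]] : exists x : 'rV[F]_N, (x *m a) 0 0 != 0 /\ (x *m b) 0 0 != 0.
  exists (((x *m b) 0 0)^-1 *: x); have sE (z : 'cV[F]_N) k : ((k *: x) *m z) 0 0 = k * (x *m z) 0 0 by rewrite -scalemxAl mxE.
  rewrite !sE mulVf //; split=> //.
  by rewrite mulf_neq0 ?invr_eq0.
have [x xa] := nz _ a0; have [y yb] := nz _ b0.
have [xb|xb] := eqVneq ((x *m b) 0 0) 0; last by exists x.
have [ya|ya] := eqVneq ((y *m a) 0 0) 0; last by exists y.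
have aE (z : 'cV[F]_N) : ((x + y) *m z) 0 0 = (x *m z) 0 0 + (y *m z) 0 0 by rewrite mulmxDl mxE.
by exists (x + y); rewrite !aE xb ya addr0 add0r.
Qed.

(** With A = U - 1 and A v nonzero, take T = 1 - (A v)(x A) where the row
    vector x has x U A v = 1, so that T U v = v, and x A v nonzero, so that T
    is invertible. Since T U - 1 is a left multiple of A and kills v as well,
    its rank is smaller. *)
Lemma reflection_step U : U \in unitmx -> U != 1%:M -> exists2 T, reflection T &
  (\rank (T *m U - 1%:M)%R < \rank (U - 1%:M)%R)%N.
Proof.
move=> Uu U1; set A := U - 1%:M.
have [v Av] : exists v, A *m v != 0.
  have [j Aj] : exists j, col j A != 0.
    apply/existsP; apply: contraNT U1; rewrite negb_exists => /forallP z.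
    rewrite -subr_eq0 -/A; apply/eqP/matrixP => i j.
    by have := z j; rewrite negbK => /eqP/colP/(_ i); rewrite !mxE.
  by exists (delta_mx j 0); rewrite -colE.
have UA : U *m A = A *m U by rewrite mulmxBr mulmxBl mulmx1 mul1mx.
have UAv : U *m (A *m v) != 0.
  by apply: contraNneq Av => E; rewrite -(mulKmx Uu (A *m v)) E mulmx0.
have [x [xa xb]] := dual_vector Av UAv.
pose u := A *m v; pose phi := x *m A; pose T := 1%:M - u *m phi.
have phiUv : phi *m (U *m v) = 1%:M.
  apply/matrixP => i j; rewrite !ord1 [RHS]mxE /= -xb /phi.
  by rewrite -mulmxA [A *m (U *m v)]mulmxA -UA !mulmxA.
have phiv : phi *m v = ((x *m u) 0 0)%:M by rewrite -mulmxA -/u [LHS]mx11_scalar.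
have Tr : reflection T.
  apply/andP; split.
    have s : phi *m u = (1 - (x *m u) 0 0)%:M.
      have -> : phi *m u = phi *m (U *m v) - phi *m v by rewrite /u mulmxBl mul1mx mulmxBr.
      by rewrite phiUv phiv raddfB.
    set c := (x *m u) 0 0 in s xa.
    suff /mulmx1_unit[] : T *m (1%:M + c^-1 *: (u *m phi)) = 1%:M by [].
    rewrite mulmxDr mulmx1 /T mulmxBl mul1mx -scalemxAr.
    have -> : u *m phi *m (u *m phi) = (1 - c) *: (u *m phi).
      by rewrite mulmxA -[u *m phi *m u]mulmxA s mul_mx_scalar -scalemxAl.
    rewrite scalerA -scalerBl -[RHS]addr0 -addrA; congr (_ + _).
    rewrite -scaleN1r -scalerDl mulrBr mulr1 mulVf //; set d := c^-1.
    by rewrite (_ : -1 + _ = 0) ?scale0r //; ring.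
  have -> : T - 1%:M = - (u *m phi) by rewrite /T addrAC subrr add0r.
  rewrite mxrank_opp eqn_leq; apply/andP; split.
    by apply: leq_trans (mxrankM_maxl _ _) (rank_leq_col _).
  rewrite lt0n mxrank_eq0; apply: contraNneq Av => E; have := congr1 (mulmx^~ (U *m v)) E.
  by rewrite /= -mulmxA phiUv mulmx1 mul0mx => <-.
exists T => //.
have E : T *m U - 1%:M = (1%:M - u *m x *m U) *m A.
  rewrite /T !mulmxBl !mul1mx addrAC; congr (_ - _).
  by rewrite /phi -!mulmxA UA.
have Ev : (T *m U - 1%:M) *m v = 0.
  rewrite /T mulmxBl mul1mx mulmxBl mul1mx mulmxBl.
  rewrite -[u *m phi *m U *m v]mulmxA -[u *m phi *m (U *m v)]mulmxA phiUv mulmx1 /u /A mulmxBl mul1mx.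
  by rewrite subKr subrr.
rewrite ltn_neqAle {2}E mxrankM_maxr andbT; apply: contra Av => /eqP rE.
have le : (T *m U - 1%:M <= A)%MS by rewrite E submxMl.
have [_] := mxrank_leqif_eq le; rewrite rE eqxx => /esym/andP[_ /submxP[D AE]].
by rewrite AE -mulmxA Ev mulmx0.
Qed.

Lemma reflection_product_ex U : U \in unitmx -> reflection_product U (\rank (U - 1%:M)).
Proof.
move: {2}(\rank (U - 1%:M)) (leqnn (\rank (U - 1%:M))) => r.
elim: r U => [|r IHr] U Ur Uu.
  move: Ur; rewrite leqn0 mxrank_eq0 subr_eq0 => /eqP ->; rewrite subrr mxrank0.
  by exists [tuple]; rewrite big_nil.
have [->|U1] := eqVneq U 1%:M.
  by rewrite subrr mxrank0; exists [tuple]; rewrite big_nil.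
have [T Tr lt] := reflection_step Uu U1.
have Tu : T \in unitmx by case/andP: Tr.
have [||s [sr sE]] := IHr (T *m U); last 1 first.
- have UE : U = \prod_(V <- invmx T :: s) V.
    by rewrite big_cons -[_ * _]/(_ *m _) -sE mulKmx.
  have rp : reflection_product U (\rank (T *m U - 1%:M)).+1.
    by exists (cons_tuple (invmx T) s); rewrite /= reflection_inv.
  have -> // : \rank (U - 1%:M) = (\rank (T *m U - 1%:M)).+1.
  by apply/eqP; rewrite eqn_leq lt reflection_product_rank.
- by rewrite -ltnS; apply: leq_trans lt Ur.
by rewrite unitmx_mul Tu.
Qed.

Lemma reflection_length_rank U r : U \in unitmx -> reflection_length U r <-> r = \rank (U - 1%:M).
Proof.
move=> Uu; have ex := reflection_product_ex Uu; split=> [[pr mi]|->].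
  by apply/eqP; rewrite eqn_leq mi // reflection_product_rank.
by split=> // r' /reflection_product_rank.
Qed.
End Reflections.

Section Dims.
Variables (F : finFieldType).

Lemma dim_mximg N (A : 'M[F]_N) : \dim (mximg A fullv) = \rank A.
Proof.
apply/eqP; rewrite eqn_leq; apply/andP; split.
  pose X := [seq col j (col_base A) | j : 'I_(\rank A)].
  have : (mximg A fullv <= <<X>>)%VS.
    apply/subvP => _ /mem_mximg[x _ ->]; rewrite -{1}(mulmx_base A) -mulmxA.
    set y := row_base A *m x; have -> : col_base A *m y = \sum_j y j 0 *: col j (col_base A).
      by apply/colP => i; rewrite !mxE summxE; apply: eq_bigr => j _; rewrite !mxE mulrC.
    apply: memv_suml => j _; apply: memvZ; apply: memv_span; apply: image_f => //.
  by move/dimvS => /leq_trans; apply; apply: leq_trans (dim_span _) _; rewrite size_image card_ord.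
set W := mximg A fullv; pose B : 'M[F]_(N, \dim W) := \matrix_(i, j) (vbasis W)`_j i 0.
have [C AE] : exists C, A = B *m C.
  exists (\matrix_(k, j) coord (vbasis W) k (col j A)); apply/matrixP => i j.
  have cW : col j A \in W by apply/mem_mximg; exists (delta_mx j 0); rewrite ?memvf // -colE.
  have := congr1 (fun c : 'cV[F]_N => c i 0) (coord_vbasis cW).
  rewrite mxE summxE => ->; rewrite mxE; apply: eq_bigr => k _; by rewrite !mxE mulrC.
rewrite AE; apply: leq_trans (mxrankM_maxl _ _) (rank_leq_col _).
Qed.

Variables (N : nat) (J U : 'M[F]_N) (e : nat).
Hypothesis (H : symp J U e).

Lemma csum_dim W s : csum U W s -> (forall x, x \in s -> x.1 != 0) ->
  \dim W = (\sum_(x <- s) pair_weight x)%N.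
Proof.
case=> b cs s0; have a0 j := s0 _ (mem_tnth j (in_tuple s)).
rewrite (cyc_dim _ cs) => [|j]; last by rewrite expf_neq0.
rewrite [RHS](big_tnth _ _ s); apply: eq_bigr => j _.
by rewrite /pair_weight size_exp.
Qed.

Lemma block_dim W l : block_on J U W l -> \dim W = label_weight l.
Proof.
case: l => [[f r] d] [/= fP r0 b]; rewrite -[W]addv0.
have f0 : f != 0 by apply: monic_neq0; apply: Phi_s_monic.
have cap : (W :&: 0 = 0)%VS by apply: capv0.
have cyc v : cyc_block J U W (f ^+ r) v -> hyperb (f, r, d) = false -> \dim (W + 0) = label_weight (f, r, d).
  move=> cb nh; have [WE _ _] := cb.
  have cs : csum U (W + 0) [:: (f, r)].
    by apply: (csum_cons WE _ (csum0 U) cap) => p; apply: cyc_block_ann cb.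
  rewrite (csum_dim cs) => [|x]; last by rewrite inE => /eqP ->.
  by rewrite big_seq1 /label_weight nh mul1n.
move: b; case: ifP => uf; last by case=> _ [v cb]; apply: (cyc v cb); rewrite /hyperb uf.
case: ifP => ro; last by case=> v cb _; apply: (cyc v cb); rewrite /hyperb ro andbF.
case=> _ [v [w hb]]; have [WE [hv hw] _ _] := hb.
have cs : csum U (W + 0) [:: (f, r); (f, r)].
  apply: (csum_cons2 H (x := (f, r)) (y := (f, r)) WE _ (csum0 U) cap) => p q.
  split=> [E|[hp hq]]; first exact: (hyp_indep H fP hb E).
  by rewrite (dvdp_act hp hv) (dvdp_act hq hw) addr0.
rewrite (csum_dim cs) => [|x]; last by rewrite !inE orbb => /eqP ->.
by rewrite big_cons big_seq1 /label_weight /hyperb uf ro mul2n addnn.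
Qed.

Lemma dec_dim W t : dec J U W t -> \dim W = weight_of t.
Proof.
elim: t W => [|l t IHt] W; first by move=> /= ->; rewrite dimv0 /weight_of big_nil.
case=> W1 [W2 [-> o b d]]; rewrite dimv_disjoint_sum; last exact: (nondeg_orth_cap H o (block_nondeg H b)).
by rewrite (block_dim b) (IHt _ d) /weight_of big_cons.
Qed.

Lemma dec_weight t : dec J U fullv t -> weight_of t = N.
Proof. by move/dec_dim <-; rewrite dimvf /dim /= muln1. Qed.
End Dims.

Section ReflectionWeight.
Variable F : finFieldType.
Hypothesis oF : odd #|F|.

(** rank (U - 1) is the dimension minus the number of parts at t - 1, and
    modification lowers the weight by this number of parts. *)
Lemma dec_rank n (U : Sp F n) t : dec (form_mx F n.*2) (val U) fullv t ->
  \rank (val U - 1%:M) = weight (modification (type_of t)).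
Proof.
move=> d; have [e H] := Sp_symp U; have vt : valid t by move=> l; apply: dec_label d.
have f1 : unit_poly ('X - 1 : {poly F}) by exists 1; rewrite ?expr1n // polyC1.
have gP : is_Phi ('X - 1 : {poly F}) by rewrite -LmE; apply: unit_Phi; rewrite expr1n.
have gd : 'X - 1 = dual ('X - 1 : {poly F}) by rewrite -LmE dual_Xsub ?expr1n.
have [s ds [s1 _]] := dec_primary_decomposition H d.
have [gm gi _] := gP; have := primary_rank 1 ds gm gi.
have -> : (size ('X - 1 : {poly F})).-1 = 1%N by rewrite -LmE size_XsubC.
rewrite expr1 mul1n dim_mximg linearB /= poly_actX poly_act1.
rewrite -(perm_big _ (s1 _ gP gd)) /=.
have -> : (\sum_(r <- parts_of t ('X - 1)%R) minn r 1 = size (parts_of t ('X - 1)%R))%N.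
  rewrite -sum1_size big_seq [RHS]big_seq; apply: eq_bigr => r rp.
  apply/minn_idPr; rewrite lt0n; have /andP[_] := part_parts ('X - 1) vt.
  by apply: contraNneq => <-.
have := weight_modification (type_symplectic vt); rewrite parts_type weight_type (dec_weight H d) => wE rE.
exact: (addIn (etrans rE (esym wE))).
Qed.
End ReflectionWeight.

(** * Types, conjugacy classes and the limit group *)

Section Main.
Variable F : finFieldType.
Hypothesis oF : odd #|F|.
Local Notation Jn n := (form_mx F n.*2).
Implicit Types (L : sp_data F) (t : seq (label F)).

Lemma labels_exist n (U : Sp F n) : exists t, sign_normal t /\ dec (Jn n) (val U) fullv t.
Proof. by have [t nt d] := Sp_dec oF U; exists t. Qed.

(** A chosen normal decomposition; labels_unique shows that the choice does not
    matter up to order. *)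
Definition labels n (U : Sp F n) : seq (label F) :=
  proj1_sig (constructive_indefinite_description _ (labels_exist U)).

Lemma labels_normal n (U : Sp F n) : sign_normal (labels U).
Proof. by rewrite /labels; case: constructive_indefinite_description => t []. Qed.

Lemma labels_dec n (U : Sp F n) : dec (Jn n) (val U) fullv (labels U).
Proof. by rewrite /labels; case: constructive_indefinite_description => t []. Qed.

Lemma labels_valid n (U : Sp F n) : valid (labels U).
Proof. by move=> l; apply: dec_label (labels_dec U). Qed.

Arguments labels_normal {n} U _ _ _.
Arguments labels_valid {n} U _ _.

Lemma labels_weight n (U : Sp F n) : weight_of (labels U) = n.*2.
Proof. by have [e H] := Sp_symp U; apply: dec_weight H _ (labels_dec U). Qed.

(** The list is determined by the type, and the type by the element. *)
Lemma labels_unique n (U : Sp F n) t : sign_normal t -> dec (Jn n) (val U) fullv t ->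
  perm_eq t (labels U).
Proof.
move=> nt d; have vt : valid t by move=> l; apply: dec_label d.
apply: (type_inj vt (labels_valid U) nt (labels_normal U)).
apply: (type_unique oF (U := U)); apply: (has_type_dec oF) => //; [exact: labels_normal|exact: labels_dec].
Qed.

Lemma has_typeE n (U : Sp F n) L : has_symplectic_type U L <-> L = type_of (labels U).
Proof.
have h := has_type_dec oF (labels_normal U) (labels_dec U).
by split=> [/(type_unique oF)/(_ h)|->].
Qed.

Definition modified_type n (U : Sp F n) := modification (type_of (labels U)).

Lemma has_modified_typeE n (U : Sp F n) L : has_modified_type U L <-> L = modified_type U.
Proof.
split=> [[M /has_typeE -> ->] //|->]; exists (type_of (labels U)) => //; exact/has_typeE.
Qed.

Lemma conjugateE n (U U' : Sp F n) : are_conjugate U U' <-> perm_eq (labels U) (labels U').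
Proof.
split=> [c|p].
  apply: labels_unique; [exact: labels_normal|exact: (conj_dec c (labels_dec U))].
apply: (dec_conj oF (labels_dec U)); have [e H] := Sp_symp U'.
by apply: (dec_perm H _ (labels_dec U')); rewrite perm_sym.
Qed.

Lemma normal_ones t k : sign_normal t -> sign_normal (t ++ nseq k (one_label F)).
Proof.
move=> nt f r /(nt f r); rewrite count_cat count_nseq.
by rewrite [pred1 _ _](xpair_eqE _ (f, r) true false) andbF addn0.
Qed.

Lemma labels_up m n (U : Sp F m) : (m <= n)%N ->
  perm_eq (labels (Sp_up n U)) (labels U ++ nseq (n - m) (one_label F)).
Proof.
move=> mn; rewrite perm_sym; apply: labels_unique; first exact/normal_ones/labels_normal.
exact: (dec_up mn (labels_dec U)).
Qed.

Lemma core_ones t k : core (t ++ nseq k (one_label F)) = core t.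
Proof. by rewrite /core filter_cat filter_nseq /= eqxx cats0. Qed.

Lemma core_perm_eq t t' : perm_eq t t' -> perm_eq (core t) (core t').
Proof. exact: perm_filter. Qed.

Lemma modification_coreE t t' : valid t -> valid t' -> perm_eq (core t) (core t') ->
  modification (type_of t) = modification (type_of t').
Proof.
by move=> vt vt' p; rewrite -(modification_core oF vt) -(modification_core oF vt') (type_perm p).
Qed.

Lemma modified_type_up m n (U : Sp F m) : (m <= n)%N -> modified_type (Sp_up n U) = modified_type U.
Proof.
move=> mn; apply: modification_coreE; try exact: labels_valid.
by have := core_perm_eq (labels_up U mn); rewrite core_ones.
Qed.

(** Completion recovers the labels other than the trivial planes from the
    modified type. *)
Lemma modified_core t t' : valid t -> valid t' -> sign_normal t -> sign_normal t' ->
  modification (type_of t) = modification (type_of t') -> perm_eq (core t) (core t').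
Proof.
move=> vt vt' nt nt' E; apply: type_inj; rewrite ?(core_normal nt) ?(core_normal nt') //.
- exact: core_valid.
- exact: core_valid.
- exact: core_normal.
- exact: core_normal.
by rewrite -(completion_modification oF vt) -(completion_modification oF vt') E.
Qed.

(** In a fixed dimension the number of trivial planes is determined by the
    other labels. *)
Lemma modified_conj n (U V : Sp F n) : are_conjugate U V <-> modified_type U = modified_type V.
Proof.
rewrite conjugateE; split=> [p|E].
  by apply: modification_coreE; try exact: labels_valid; apply: core_perm_eq.
have vU := labels_valid U; have vV := labels_valid V.
have c := modified_core vU vV (labels_normal U) (labels_normal V) E.
apply: perm_trans (core_perm vU) _; rewrite perm_sym; apply: perm_trans (core_perm vV) _.
have := weight_core vU; have := weight_core vV; rewrite !labels_weight => ->.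
have -> : weight_of (core (labels U)) = weight_of (core (labels V)) by apply: perm_big.
move/addnI/double_inj => ->; rewrite perm_cat2r perm_sym; exact: c.
Qed.

Lemma to_infJ n (U G : Sp F n) : (to_inf U ^ to_inf G)%g = to_inf (U ^ G)%g.
Proof.
rewrite /conjg -[RHS]inf_mulE -[to_inf (U * G)%g]inf_mulE -[to_inf G^-1%g]inf_invE //.
Qed.

Lemma Sp_inf2P (x y : Sp_inf F) : exists n (U V : Sp F n), x = to_inf U /\ y = to_inf V.
Proof.
have [m [U ->]] := Sp_infP x; have [n [V ->]] := Sp_infP y.
exists (maxn m n), (Sp_up _ U), (Sp_up _ V).
by rewrite !to_inf_up ?leq_maxl ?leq_maxr.
Qed.

Definition inf_type (x : Sp_inf F) := modified_type (tagged (repr x)).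

Lemma inf_typeE n (U : Sp F n) : inf_type (to_inf U) = modified_type U.
Proof.
pose k := maxn n (tag (repr (to_inf U))).
have nk : (n <= k)%N by apply: leq_maxl.
have rk : (tag (repr (to_inf U)) <= k)%N by apply: leq_maxr.
by rewrite /inf_type -(modified_type_up _ rk) repr_inf // modified_type_up.
Qed.

Lemma inf_conj (x y : Sp_inf F) : are_conjugate x y <-> inf_type x = inf_type y.
Proof.
split=> [[g ->]|].
  have [n [U [G [-> ->]]]] := Sp_inf2P x g.
  by rewrite to_infJ !inf_typeE; apply/modified_conj; exists G.
have [n [U [V [-> ->]]]] := Sp_inf2P x y; rewrite !inf_typeE => /modified_conj[G ->].
by exists (to_inf G); rewrite to_infJ.
Qed.

Lemma symplectic_realize M : symplectic_function M -> exists n (U : Sp F n), M = type_of (labels U).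
Proof.
move=> sM; have [t [vt nt <-]] := type_exists oF sM.
have [n [U d]] := realize oF vt; exists n, U; apply: type_perm; exact: labels_unique.
Qed.

Lemma modified_type_symplectic n (U : Sp F n) : modified_symplectic (modified_type U).
Proof. by exists (type_of (labels U)); split=> //; apply: type_symplectic; apply: labels_valid. Qed.

(** The labels other than trivial planes are realised in the dimension that
    they require, and trivial planes are added up to dimension 2n. *)
Lemma modified_realize m (U : Sp F m) n : (weight_of (core (labels U)) <= n.*2)%N ->
  exists V : Sp F n, modified_type V = modified_type U.
Proof.
move=> le; have vc := core_valid (labels_valid U).
have [k [V d]] := realize oF vc.
have p := labels_unique (core_normal (labels_normal U)) d.
have kE : weight_of (core (labels U)) = k.*2.
  by rewrite -(labels_weight V); apply: perm_big.
have kn : (k <= n)%N by rewrite -leq_double -kE.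
exists (Sp_up n V); rewrite modified_type_up //; apply: modification_coreE; try exact: labels_valid.
rewrite perm_sym; have := core_perm_eq p.
by rewrite [core (core _)](_ : _ = core (labels U)) // /core filter_id.
Qed.

End Main.
Arguments labels_normal {F} oF {n} U _ _ _.
Arguments labels_valid {F} oF {n} U _ _.

Theorem lemma4p22 (F : finFieldType) (q_odd : odd #|F|) :
  [/\
   forall (m n : nat) (U U' : Sp F m), (m <= n)%N ->
     (are_conjugate U U' <-> are_conjugate (Sp_up n U) (Sp_up n U')),
   exists phi : Sp_inf F -> sp_data F,
     [/\ forall (n : nat) (U : Sp F n) (L : sp_data F),
           has_modified_type U L <-> L = phi (to_inf U),
         forall x y : Sp_inf F, are_conjugate x y <-> phi x = phi y
       & forall L : sp_data F,
           modified_symplectic L <-> exists x : Sp_inf F, phi x = L],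
   forall L : sp_data F, modified_symplectic L -> forall m : nat,
     (exists U : Sp F m, has_modified_type U L) <->
     (weight (completion L) <= m.*2)%N,
   forall (L : sp_data F) (m : nat) (U : Sp F m) (n : nat),
     modified_symplectic L -> weight (completion L) = m.*2 ->
     has_modified_type U L -> (m < n)%N ->
     forall M : sp_data F,
       has_symplectic_type (Sp_up n U) M <-> M = nth_completion n L
   &
   (forall (m n : nat) (U : Sp F m) (r : nat), (m <= n)%N ->
      (reflection_length (Sp_mx U) r <->
       reflection_length (Sp_mx (Sp_up n U)) r)) /\
   (forall (n : nat) (U : Sp F n) (L : sp_data F),
      has_modified_type U L -> reflection_length (Sp_mx U) (weight L))].
Proof.
split.
- move=> m n U U' mn; rewrite !(conjugateE q_odd) -(perm_cat2r (nseq (n - m) (one_label F))).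
  have p := labels_up q_odd U mn; have p' := labels_up q_odd U' mn.
  split=> [E|E]; first by apply: perm_trans p _; rewrite perm_sym; apply: perm_trans p' _; rewrite perm_sym.
  rewrite perm_sym in p; apply: perm_trans p _; exact: perm_trans E p'.
- exists (inf_type q_odd); split.
  + by move=> n U L; rewrite inf_typeE; apply: has_modified_typeE.
  + exact: inf_conj.
  move=> L; split=> [[M [/(symplectic_realize q_odd)[n [U ->]] ->]]|[x <-]].
    by exists (to_inf U); rewrite inf_typeE.
  by have [n [U ->]] := Sp_infP x; rewrite inf_typeE; apply: modified_type_symplectic.
- move=> _ [M [/(symplectic_realize q_odd)[n [U ->]] ->]] m.
  have vU := labels_valid q_odd U.
  rewrite completion_modification // weight_type.
  split=> [[V /(has_modified_typeE q_odd) E]|/modified_realize[V E]]; last first.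
    by exists V; apply/(has_modified_typeE q_odd); rewrite E.
  have vV := labels_valid q_odd V.
  have p := modified_core q_odd vU vV (labels_normal q_odd U) (labels_normal q_odd V) E.
  rewrite -(labels_weight q_odd V) (weight_core vV) [weight_of (core (labels q_odd U))](perm_big _ p).
  exact: leq_addr.
- move=> L m U n _ + /(has_modified_typeE q_odd) LE mn M; rewrite {}LE (has_typeE q_odd) /modified_type.
  have vU := labels_valid q_odd U.
  rewrite completion_modification // weight_type => wE.
  rewrite (@nth_completion_modification _ q_odd _ _ (n - m)) //; last first.
    by rewrite wE -doubleD subnKC // ltnW.
  suff -> : type_of (labels q_odd (Sp_up n U)) = type_of (core (labels q_odd U) ++ nseq (n - m) (one_label F)) by [].
  apply: type_perm; apply: perm_trans (labels_up q_odd U (ltnW mn)) _; rewrite perm_cat2r.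
  have := core_perm vU; suff -> : count_mem (one_label F) (labels q_odd U) = 0%N by rewrite cats0.
  have := weight_core vU; rewrite labels_weight wE => /eqP.
  by rewrite -{1}[m.*2]addn0 eqn_add2l eq_sym double_eq0 => /eqP.
have rkE n (U : Sp F n) r : reflection_length (Sp_mx U) r <-> r = weight (modified_type q_odd U).
  rewrite reflection_length_rank; last by case/isometryP: (valP U).
  by rewrite -(dec_rank (labels_dec q_odd U)).
split=> [m n U r mn|n U L /(has_modified_typeE q_odd) ->]; last exact/rkE.
by rewrite !rkE modified_type_up.
Qed.
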